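(* Let $(t_k)_{k=1}^\infty$ be a sequence of real numbers with $1>t_1>t_2>t_3>\dots>0$ and $\lim_{k\to\infty}t_k=0$. Let $n\ge1$, $a>1$, $0<s\le1/2$, and assume that $\sum_{k=1}^\infty t_k^\gamma<\infty$, where $\gamma=2s/(a-s)$. If $f\in H_s(\mathbb{R}^n)$, then $$\lim_{k\to\infty}S_{t_k}f(x)=f(x)$$ for almost every $x\in\mathbb{R}^n$.
   Context: The Fourier transform is $\hat f(\xi)=\int_{\mathbb{R}^n}e^{-i\xi\cdot x}f(x)\,dx$. For $f\in L^2(\mathbb{R}^n)$ and $a>0$, $S_tf(x)=(2\pi)^{-n}\int_{\mathbb{R}^n}e^{i\xi\cdot x}e^{it|\xi|^a}\hat f(\xi)\,d\xi$, i.e. $S_tf$ is the $L^2$ function with Fourier transform $e^{it|\xi|^a}\hat f(\xi)$. The Sobolev space is $H_s=\{f\in\mathscr{S}' : \|f\|_{H_s}<\infty\}$ with $\|f\|_{H_s}=\left(\int_{\mathbb{R}^n}(1+|\xi|^2)^s|\hat f(\xi)|^2\,d\xi\right)^{1/2}$. *)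

(* Defs.v *)
From HB Require Import structures.
From mathcomp Require Import all_boot all_order all_algebra.
From mathcomp Require Import all_classical all_reals all_analysis.
From mathcomp Require Import complex.

Set Implicit Arguments.
Unset Strict Implicit.
Unset Printing Implicit Defensive.
Import Order.TTheory GRing.Theory Num.Theory.
Import numFieldNormedType.Exports.
Local Open Scope classical_set_scope.
Local Open Scope ring_scope.

(* The sigma-algebra on 'rV[T]_n is generated by the coordinate maps; for
   T = R it is the Borel sigma-algebra of R^n. *)
Section measurable_rV.
Context {d} {T : sigmaRingType d}.
Variable n : nat.

Let coors : 'I_n -> 'rV[T]_n -> T := fun i x => x ord0 i.

Let rV_set0 : g_sigma_preimage coors set0.
Proof. exact: sigma_algebra0. Qed.

Let rV_setC A : g_sigma_preimage coors A -> g_sigma_preimage coors (~` A).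
Proof. exact: sigma_algebraC. Qed.

Let rV_bigcup (F : _^nat) : (forall i, g_sigma_preimage coors (F i)) ->
  g_sigma_preimage coors (\bigcup_i (F i)).
Proof. exact: sigma_algebra_bigcup. Qed.

HB.instance Definition _ := @isMeasurable.Build (measure_tuple_display d)
  'rV[T]_n (g_sigma_preimage coors) rV_set0 rV_setC rV_bigcup.

End measurable_rV.

Lemma measurable_rV_coord d (T : sigmaRingType d) n (i : 'I_n) :
  measurable_fun [set: 'rV[T]_n] (fun x : 'rV[T]_n => x ord0 i).
Proof.
move=> _ Y mY; rewrite setTI; apply: sub_sigma_algebra => /=.
rewrite -bigcup_seq/=; exists i => /=; first by rewrite mem_index_enum.
by exists Y => //; rewrite setTI.
Qed.

Lemma measurable_fun_rVP d1 d2 (T1 : measurableType d1) (T2 : measurableType d2)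
    n (f : T1 -> 'rV[T2]_n) :
  (forall i, measurable_fun [set: T1] (fun x => f x ord0 i)) ->
  measurable_fun [set: T1] f.
Proof.
move=> mf _ A mA.
have : <<s \big[setU/set0]_(i < n)
    preimage_set_system setT (fun x : 'rV[T2]_n => x ord0 i) measurable >> A.
  exact: mA.
move=> /(_ (image_set_system setT f measurable)); apply; split.
  exact/sigma_algebra_image/sigma_algebra_measurable.
rewrite -bigcup_seq; apply: bigcup_sub => i _ _ [B mB <-].
rewrite /image_set_system /= setTI.
exact: mf.
Qed.

Section lebesgue_rV.
Context {R : realType}.

Definition rV_cons n (p : measurableTypeR R * 'rV[R]_n) : 'rV[R]_n.+1 :=
  \row_i oapp (p.2 ord0) p.1 (unlift ord0 i).

Lemma rV_cons0 n (p : measurableTypeR R * 'rV[R]_n) : rV_cons p ord0 ord0 = p.1.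
Proof. by rewrite mxE unlift_none. Qed.

Lemma rV_consS n (p : measurableTypeR R * 'rV[R]_n) j :
  rV_cons p ord0 (lift ord0 j) = p.2 ord0 j.
Proof. by rewrite mxE liftK. Qed.

Lemma measurable_rV_cons n : measurable_fun setT (@rV_cons n).
Proof.
apply: measurable_fun_rVP => i; have [j ->|->] := unliftP ord0 i.
  under eq_fun do rewrite rV_consS.
  exact: measurableT_comp (measurable_rV_coord _) measurable_snd.
by under eq_fun do rewrite rV_cons0; exact: measurable_fst.
Qed.

Definition rV_uncons n (x : 'rV[R]_n.+1) : measurableTypeR R * 'rV[R]_n :=
  (x ord0 ord0, \row_j x ord0 (lift ord0 j)).

Lemma rV_consK n : cancel (@rV_cons n) (@rV_uncons n).
Proof.
move=> [r x]; rewrite /rV_uncons rV_cons0; congr pair.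
by apply/rowP => j; rewrite mxE rV_consS.
Qed.

Lemma rV_unconsK n : cancel (@rV_uncons n) (@rV_cons n).
Proof.
move=> x; apply/rowP => i; have [j ->|->] := unliftP ord0 i.
  by rewrite rV_consS mxE.
by rewrite rV_cons0.
Qed.

Lemma measurable_rV_uncons n : measurable_fun setT (@rV_uncons n).
Proof.
apply/measurable_fun_pairP; split.
  exact: (measurable_rV_coord ord0).
apply: measurable_fun_rVP => i; rewrite /=.
under eq_fun do rewrite mxE.
exact: measurable_rV_coord.
Qed.

Section step.
Variables (n : nat) (mu : {sigma_finite_measure set 'rV[R]_n -> \bar R}).

Definition lebesgue_rV_step : set 'rV[R]_n.+1 -> \bar R :=
  pushforward (lebesgue_measure \x mu)%E (@rV_cons n).

Let step0 : lebesgue_rV_step set0 = 0%E.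
Proof. by rewrite /lebesgue_rV_step /pushforward preimage_set0 measure0. Qed.

Let step_ge0 A : (0 <= lebesgue_rV_step A)%E.
Proof. by rewrite /lebesgue_rV_step /pushforward measure_ge0. Qed.

Let step_sigma_additive : semi_sigma_additive lebesgue_rV_step.
Proof.
have mpre A : measurable A -> measurable (@rV_cons n @^-1` A).
  by move=> mA; rewrite -[X in measurable X]setTI; exact: measurable_rV_cons.
move=> F mF tF mUF; rewrite /lebesgue_rV_step /pushforward preimage_bigcup.
apply: measure_semi_sigma_additive.
- by move=> i; exact: mpre.
- apply/trivIsetP => /= i j _ _ ij; rewrite -preimage_setI.
  by move/trivIsetP : tF => /(_ _ _ _ _ ij) ->//; rewrite preimage_set0.
- by rewrite -preimage_bigcup; exact: mpre.
Qed.

HB.instance Definition _ := isMeasure.Build _ _ _ lebesgue_rV_step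
  step0 step_ge0 step_sigma_additive.

Let step_sigma_finite : sigma_finite setT lebesgue_rV_step.
Proof.
have /sigma_finiteP[F [TF ndF Foo]] := sigma_finiteT (@lebesgue_measure R).
have /sigma_finiteP[G [TG ndG Goo]] := sigma_finiteT mu.
exists (fun i => @rV_uncons n @^-1` (F i `*` G i)).
  rewrite -preimage_bigcup (_ : \bigcup_i _ = setT) ?preimage_setT//.
  apply/seteqP; split=> // -[x y] _.
  have [k _ Fkx] : (\bigcup_i F i) x by rewrite -TF.
  have [l _ Gly] : (\bigcup_i G i) y by rewrite -TG.
  exists (maxn k l) => //; split.
  - by move: x Fkx; exact/subsetPset/ndF/leq_maxl.
  - by move: y Gly; exact/subsetPset/ndG/leq_maxr.
move=> i; have [mF Fi] := Foo i; have [mG Gi] := Goo i; split.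
  rewrite -[X in measurable X]setTI; apply: measurable_rV_uncons => //.
  exact: measurableX.
rewrite /lebesgue_rV_step /pushforward -comp_preimage.
rewrite (_ : _ \o _ = id); last exact/funext/rV_consK.
by rewrite preimage_id product_measure1E// lte_mul_pinfty// ge0_fin_numE.
Qed.

HB.instance Definition _ := Measure_isSigmaFinite.Build _ _ _ lebesgue_rV_step
  step_sigma_finite.

End step.

(* Lebesgue measure on R^n as the n-fold product of the one on R *)
Fixpoint lebesgue_rV n : {sigma_finite_measure set 'rV[R]_n -> \bar R} :=
  match n with
  | 0 => \d_(0 : 'rV[R]_0)
  | n.+1 => lebesgue_rV_step (lebesgue_rV n)
  end.

Lemma lebesgue_rV_box n (a b : 'rV[R]_n) :
  (forall i, a ord0 i <= b ord0 i) ->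
  lebesgue_rV n [set x : 'rV[R]_n | forall i, x ord0 i \in `[a ord0 i, b ord0 i]] =
  (\prod_i (b ord0 i - a ord0 i))%:E.
Proof.
elim: n a b => [|n IH] a b ab /=.
  rewrite big_ord0 diracE mem_set//; by case.
rewrite /lebesgue_rV_step /pushforward big_ord_recl.
pose a' : 'rV[R]_n := \row_j a ord0 (lift ord0 j).
pose b' : 'rV[R]_n := \row_j b ord0 (lift ord0 j).
have -> : @rV_cons n @^-1`
      [set x : 'rV[R]_n.+1 | forall i, x ord0 i \in `[a ord0 i, b ord0 i]] =
    [set` `[a ord0 ord0, b ord0 ord0]] `*`
    [set x : 'rV[R]_n | forall i, x ord0 i \in `[a' ord0 i, b' ord0 i]].
  apply/seteqP; split => [[r x] /= h|[r x] /= [h0 h] i].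
    split; first by have := h ord0; rewrite rV_cons0.
    by move=> i; have := h (lift ord0 i); rewrite rV_consS !mxE.
  have [j ->|->] := unliftP ord0 i; first by have := h j; rewrite rV_consS !mxE.
  by rewrite rV_cons0.
rewrite product_measure1E//=; last first.
  rewrite (_ : [set x : 'rV[R]_n | _] = \big[setI/setT]_i
      ((fun x : 'rV[R]_n => x ord0 i) @^-1` [set` `[a' ord0 i, b' ord0 i]])).
    apply: bigsetI_measurable => i _; rewrite -[X in measurable X]setTI.
    exact: measurable_rV_coord.
  by rewrite -bigcap_seq; apply/seteqP; split=> x /= h i => [_|]; apply: h;
    rewrite /= ?mem_index_enum.
rewrite IH => [|i]; last by rewrite !mxE.
rewrite lebesgue_measure_itv/= lte_fin.
have -> : \prod_i (b' ord0 i - a' ord0 i) =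
    \prod_(i < n) (b ord0 (lift ord0 i) - a ord0 (lift ord0 i)).
  by apply: eq_bigr => i _; rewrite !mxE.
have := ab ord0; rewrite le_eqVlt => /orP[/eqP ->|->].
  by rewrite ltxx subrr mul0e mul0r.
by rewrite EFinM EFinB.
Qed.

End lebesgue_rV.

Section fourier.
Context {R : realType} {n : nat}.
Local Notation C := R[i].
Local Notation Rn := 'rV[R]_n.
Local Notation mu := (@lebesgue_rV R n).
Local Notation normc := ComplexField.Normc.normc.
Implicit Types (x y xi : Rn) (f g u phi psi : Rn -> C)
  (T : (Rn -> C) -> C).

Definition rdot x y : R := \sum_i x ord0 i * y ord0 i.

(* the Euclidean norm; `|x| on 'rV[R]_n is the sup norm *)
Definition enorm x : R := Num.sqrt (rdot x x).

(* e^{i theta} *)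
Definition expi (theta : R) : C := Complex (cos theta) (sin theta).

Definition cmeasurable f :=
  measurable_fun setT (fun x => complex.Re (f x)) /\
  measurable_fun setT (fun x => complex.Im (f x)).

Definition cintegrable f :=
  mu.-integrable setT (fun x => (complex.Re (f x))%:E) /\
  mu.-integrable setT (fun x => (complex.Im (f x))%:E).

Definition cintegral f : C :=
  Complex (\int[mu]_x complex.Re (f x)) (\int[mu]_x complex.Im (f x)).

Definition L2 f :=
  cmeasurable f /\ (\int[mu]_x (normc (f x) ^+ 2)%:E < +oo)%E.

Definition fourier f : Rn -> C :=
  fun xi => cintegral (fun x => expi (- rdot xi x) * f x).

Definition partial (i : 'I_n) phi : Rn -> C := fun x =>
  Complex ('D_(delta_mx ord0 i) (fun y => complex.Re (phi y)) x)
          ('D_(delta_mx ord0 i) (fun y => complex.Im (phi y)) x).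

(* Iterated partial derivatives are indexed by the words beta over the
   coordinates rather than by multi-indices. *)
Definition partials (beta : seq 'I_n) phi : Rn -> C := foldr partial phi beta.

Definition smooth phi := forall beta : seq 'I_n,
  [/\ continuous (fun x => complex.Re (partials beta phi x)),
      continuous (fun x => complex.Im (partials beta phi x)) &
      forall (i : 'I_n) x,
        derivable (fun y => complex.Re (partials beta phi y)) x
          (delta_mx ord0 i) /\
        derivable (fun y => complex.Im (partials beta phi y)) x
          (delta_mx ord0 i)].

(* sup over x and |beta| <= N of (1 + |x|)^N |d^beta phi (x)| *)
Definition schwartz_norm (N : nat) phi : \bar R :=
  ereal_sup [set r | exists (beta : seq 'I_n) x, (size beta <= N)%N /\
    r = ((1 + enorm x) ^+ N * normc (partials beta phi x))%:E].

Definition schwartz phi :=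
  smooth phi /\ forall N, (schwartz_norm N phi < +oo)%E.

(* T is an element of S'. A tempered distribution is a functional on all
   functions, of which only the values on Schwartz functions are relevant. *)
Definition tempered T :=
  (forall (c : C) phi psi, schwartz phi -> schwartz psi ->
     T (fun x => c * phi x + psi x) = c * T phi + T psi) /\
  (exists (N : nat) (M : R), forall phi, schwartz phi ->
     ((normc (T phi))%:E <= M%:E * schwartz_norm N phi)%E).

Definition dist f : (Rn -> C) -> C :=
  fun phi => cintegral (fun x => f x * phi x).

(* The distribution T is (given by) the function f, which is determined by T
   up to a null set. *)
Definition represents f T := cmeasurable f /\
  forall phi, schwartz phi ->
    cintegrable (fun x => f x * phi x) /\ T phi = dist f phi.

(* Fourier transform on S', by duality; on L^2 it is the Plancherel extension
   of [fourier]. *)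
Definition fourier_dist T : (Rn -> C) -> C := fun phi => T (fourier phi).

(* the H_s norm of a distribution whose Fourier transform is the function g *)
Definition Hs_norm (s : R) g : \bar R :=
  ((\int[mu]_xi ((1 + enorm xi ^+ 2) `^ s * normc (g xi) ^+ 2)%:E)
     `^ 2^-1)%E.

Definition Hs (s : R) T := tempered T /\
  exists2 g, represents g (fourier_dist T) & (Hs_norm s g < +oo)%E.

(* u is a version of S_t f: the L^2 function with Fourier transform
   e^{it|xi|^a} times the one of f *)
Definition is_schrodinger (a t : R) f u := [/\ L2 f, L2 u &
  exists2 g, represents g (fourier_dist (dist f)) &
    represents (fun xi => expi (t * enorm xi `^ a) * g xi)
      (fourier_dist (dist u))].

End fourier.

(* Main.v *)
Require Import Defs.
From HB Require Import structures.
From mathcomp Require Import all_boot all_order all_algebra.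
From mathcomp Require Import all_classical all_reals all_analysis.
From mathcomp Require Import measurable_realfun complex ring lra.
Set Implicit Arguments.
Unset Strict Implicit.
Unset Printing Implicit Defensive.
Import Order.TTheory GRing.Theory Num.Theory.
Import numFieldNormedType.Exports.
Local Open Scope classical_set_scope.
Local Open Scope ring_scope.

(* Let t_k lie in (2^-(l+1), 2^-l] and split the multiplier e^{it|xi|^a} - 1 at
   |xi|^(a-s) = 2^l.  On the high frequencies the multiplier is bounded while
   1 <= (2 t_k |xi|^(a-s))^gamma = (2 t_k)^gamma |xi|^(2s), so by Plancherel the
   L^2 norms squared are at most a constant times t_k^gamma ||f||_{H_s}^2, which
   is summable.  The low-frequency part at time t_k is the integral of its time
   derivative over [0, t_k]; hence it is controlled, for all the k of the l-th
   block at once, by X_l = 2^-l times the integral over [0, 2^-l] of the squared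
   derivative.  The sum over l of the integrals of X_l is again at most a
   constant times ||f||_{H_s}^2, so that X_l -> 0 almost everywhere.

   The Fourier transform of the tempered distributions involved is only used
   through Gaussian test functions e^{-sum e_i (x_i - m_i)^2 / 2}, translated or
   modulated, which determine a function up to a null set. *)

(** The cutoff exponent a - s is forced from both sides. For low frequencies, the sum of 4^-l
    |xi|^(2a) over the l with 2^l >= |xi|^(a-s) is at most a constant times |xi|^(2a) |xi|^(-2(a-s))
    = |xi|^(2s), the weight of H_s. For high frequencies, (|xi|^(a-s))^gamma = |xi|^(2s), which
    determines gamma. Nothing bounds the number of t_k in one dyadic block, so the low part cannot
    be summed over k; it needs a majorant depending on l alone.

    For s <= 1/2 the transform of f need not be integrable, so neither f nor S_t f is given by a
    pointwise integral. Truncated frequencies do give honest integrals. The remainder is accessible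
    only through its integrals against Gaussians, and its L^2 bound has to be derived from these.
    Since f is treated directly, no dense class of functions is involved.

    All analysis is real-valued: the real part of f corresponds to the data (Re g, Im g) of its
    transform g, the imaginary part to the data (Im g, -Re g) of -i g. Only an upper bound in
    Plancherel is needed, with a constant that need not be sharp. *)

Notation integ mu f := (integrable mu setT (fun x => (f x)%:E)).

(** * Real-valued integrals *)

Lemma measurable_cos {R : realType} : measurable_fun setT (@cos R).
Proof. by apply: continuous_measurable_fun; exact: continuous_cos. Qed.

Lemma measurable_sin {R : realType} : measurable_fun setT (@sin R).
Proof. by apply: continuous_measurable_fun; exact: continuous_sin. Qed.

Lemma normr_cos_le1 {R : realType} (x : R) : `|cos x| <= 1.
Proof. by rewrite ler_norml cos_geN1 cos_le1. Qed.

Lemma normr_sin_le1 {R : realType} (x : R) : `|sin x| <= 1.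
Proof. by rewrite ler_norml sin_geN1 sin_le1. Qed.

Section integ.
Context {d} {T : measurableType d} {R : realType} {mu : {measure set T -> \bar R}}.
Implicit Types f g b : T -> R.

Lemma integ_meas f : integ mu f -> measurable_fun setT f.
Proof. by move=> /integrableP[/measurable_EFinP]. Qed.

Lemma integ_le f g : measurable_fun setT f -> integ mu g ->
  (forall x, `|f x| <= g x) -> integ mu f.
Proof.
move=> mf ig fg; apply: (@le_integrable _ _ _ mu _ measurableT _ (fun x => (g x)%:E)) => //.
  exact/measurable_EFinP.
move=> x _ /=; rewrite lee_fin (le_trans (fg x))// ler_norm//.
Qed.

Lemma integD f g : integ mu f -> integ mu g -> integ mu (fun x => f x + g x).
Proof.
by move=> fi gi; have := integrableD measurableT fi gi; under eq_fun do rewrite -EFinD.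
Qed.

Lemma integB f g : integ mu f -> integ mu g -> integ mu (fun x => f x - g x).
Proof.
by move=> fi gi; have := integrableB measurableT fi gi; under eq_fun do rewrite -EFinB.
Qed.

Lemma integZ c f : integ mu f -> integ mu (fun x => c * f x).
Proof.
by move=> fi; have := integrableZl measurableT c fi; under eq_fun do rewrite -EFinM.
Qed.

Lemma integ_norm f : integ mu f -> integ mu (fun x => `|f x|).
Proof. by move=> /integrable_abse. Qed.

Lemma integ_bound c b f : measurable_fun setT b -> (forall x, `|b x| <= c) ->
  integ mu f -> integ mu (fun x => b x * f x).
Proof.
move=> mb bc fi; apply: (@integ_le _ (fun x => c * `|f x|)).
- by apply: measurable_funM => //; exact: integ_meas.
- exact/integZ/integ_norm.
- by move=> x; rewrite normrM ler_wpM2r.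
Qed.

Lemma RintegralE f : integ mu f -> (\int[mu]_x f x)%:E = (\int[mu]_x (f x)%:E)%E.
Proof. by move=> fi; rewrite /Rintegral fineK// integrable_fin_num. Qed.

Lemma integ_lty f : measurable_fun setT f -> (forall x, 0 <= f x) ->
  (\int[mu]_x (f x)%:E < +oo)%E -> integ mu f.
Proof.
move=> mf f0 fi; apply/integrableP; split; first exact/measurable_EFinP.
by under eq_integral do rewrite gee0_abs ?lee_fin//.
Qed.

Lemma Rint_dominated (f_ : nat -> T -> R) f g :
  (forall n, measurable_fun setT (f_ n)) -> measurable_fun setT f ->
  {ae mu, forall x, (f_ n x) @[n --> \oo] --> f x} ->
  integ mu g -> {ae mu, forall x n, `|f_ n x| <= g x} ->
  integ mu f /\ (\int[mu]_x f_ n x) @[n --> \oo] --> \int[mu]_x f x.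
Proof.
move=> mf_ mf cf ig fg.
have [| | | | |fi _ H] := @dominated_convergence _ _ _ mu _ measurableT
  (fun n x => (f_ n x)%:E) (fun x => (f x)%:E) (fun x => (g x)%:E).
- by move=> n; exact/measurable_EFinP.
- exact/measurable_EFinP.
- apply: filterS cf => x cx _; apply: cvg_EFin => //; exact: nearW.
- exact: ig.
- by apply: filterS fg => x fx n _ /=; rewrite lee_fin.
by split=> //; apply: fine_cvg; rewrite RintegralE//.
Qed.

Lemma fatou_le (f_ : nat -> T -> R) f (M : \bar R) :
  (forall n, measurable_fun setT (f_ n)) -> measurable_fun setT f ->
  (forall n x, 0 <= f_ n x) ->
  {ae mu, forall x, (f_ n x) @[n --> \oo] --> f x} ->
  (forall n, (\int[mu]_x (f_ n x)%:E <= M)%E) ->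
  (\int[mu]_x (f x)%:E <= M)%E.
Proof.
move=> mf_ mf f0 cf fM.
have mEf n : measurable_fun setT (fun x => (f_ n x)%:E) by exact/measurable_EFinP.
rewrite (@ae_eq_integral _ _ _ mu setT (fun x => limn_einf (fun n => (f_ n x)%:E)))//.
- apply: (le_trans (fatou mu measurableT mEf _)) => [n x _|]; first by rewrite lee_fin.
  rewrite limn_einf_lim; apply: lime_le; first exact: is_cvg_einfs.
  apply: nearW => n; apply: le_trans (fM n); apply: ereal_inf_lbound.
  by exists n => //=.
- exact/measurable_EFinP.
- under eq_fun do rewrite limn_einf_lim.
  apply: (emeasurable_fun_cvg (fun k x => einfs (fun n => (f_ n x)%:E) k)).
    by move=> k; exact: measurable_fun_einfs.
  by move=> x _; exact: is_cvg_einfs.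
- apply: filterS cf => x cx _ /=.
  have cE : (f_ n x)%:E @[n --> \oo] --> (f x)%:E by apply: cvg_EFin => //; exact: nearW.
  by rewrite is_cvg_limn_einfE; [apply/esym/cvg_lim|apply/cvg_ex; exists (f x)%:E].
Qed.

Lemma integ_sum (F : nat -> T -> R) N : (forall j, integ mu (F j)) ->
  integ mu (fun x => \sum_(j < N) F j x) /\
  \int[mu]_x (\sum_(j < N) F j x) = \sum_(j < N) \int[mu]_x F j x.
Proof.
move=> iF; elim: N => [|N [IH1 IH2]].
  rewrite big_ord0; under eq_fun do rewrite big_ord0.
  under eq_Rintegral do rewrite big_ord0.
  by split; [exact: integrable0|rewrite Rintegral_cst// mul0r].
rewrite big_ord_recr/= -IH2; under eq_fun do rewrite big_ord_recr/=.
under eq_Rintegral do rewrite big_ord_recr/=.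
by split; [exact: (integD IH1 (iF N))|exact: (RintegralD measurableT IH1 (iF N))].
Qed.

Lemma Rintegral_indicr D f : \int[mu]_x (f x * \1_D x) = \int[mu]_(x in D) f x.
Proof.
rewrite [RHS]Rintegral_mkcond; apply: eq_Rintegral => x _.
by rewrite patchE indicE; case: (_ \in _); rewrite ?mulr1 ?mulr0.
Qed.

End integ.

(** * Measurability of partial integrals, Fubini and the multiplication formula *)

Section fubini.
Context {d1 d2} {T1 : measurableType d1} {T2 : measurableType d2} {R : realType}.
Context {m1 : {sigma_finite_measure set T1 -> \bar R}}
        {m2 : {sigma_finite_measure set T2 -> \bar R}}.

(** By Tonelli the integrals of the positive and of the negative part are measurable in [x]. [fine]
    sends infinite values to 0, so the result is a measurable function defined everywhere, including
    where the section is not integrable. *)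
Lemma measurable_Rintegral (f : T1 * T2 -> R) : measurable_fun setT f ->
  measurable_fun setT (fun x => \int[m2]_y f (x, y)).
Proof.
move=> mf; have mEf : measurable_fun setT (fun p => (f p)%:E) by exact/measurable_EFinP.
rewrite /Rintegral; apply: measurableT_comp => //.
under eq_fun do rewrite integralE.
apply: emeasurable_funB.
  apply: (eq_measurable_fun (fubini_F m2 (funepos (EFin \o f)))).
    by move=> x _; apply: eq_integral => y _; rewrite !funeposE.
  apply: measurable_fun_fubini_tonelli_F => //; exact: measurable_funepos.
apply: (eq_measurable_fun (fubini_F m2 (funeneg (EFin \o f)))).
  by move=> x _; apply: eq_integral => y _; rewrite !funenegE.
apply: measurable_fun_fubini_tonelli_F => //; exact: measurable_funeneg.
Qed.

Lemma RFubini (f : T1 -> T2 -> R) :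
  integ (m1 \x m2)%E (fun p => f p.1 p.2) ->
  (forall x, integ m2 (f x)) -> (forall y, integ m1 (f^~ y)) ->
  \int[m1]_x \int[m2]_y f x y = \int[m2]_y \int[m1]_x f x y.
Proof.
move=> fi f1 f2; rewrite /Rintegral.
under eq_integral do rewrite RintegralE//.
under [in RHS]eq_integral do rewrite RintegralE//.
by rewrite (Fubini fi).
Qed.

Lemma integ_prod f1 f2 : integ m1 f1 -> integ m2 f2 ->
  integ (m1 \x m2)%E (fun p => f1 p.1 * f2 p.2).
Proof.
move=> i1 i2; apply/integrable12ltyP.
  apply/measurable_EFinP; apply: measurable_funM.
    exact: (measurableT_comp (integ_meas i1) measurable_fst).
  exact: (measurableT_comp (integ_meas i2) measurable_snd).
under eq_integral do under eq_integral do rewrite /= normrM EFinM.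
have /integrableP[_ l1] := i1.
have /integrableP[m2f l2] := i2.
have H x : (\int[m2]_y (`|f1 x|%:E * `|f2 y|%:E) = `|f1 x|%:E * \int[m2]_y `|f2 y|%:E)%E.
  by rewrite ge0_integralZl//; [exact: (measurableT_comp (@abse_measurable _ _) m2f)].
under eq_integral do rewrite H.
rewrite ge0_integralZr//=; last 2 first.
- by apply/measurable_EFinP; apply: measurableT_comp => //; exact: integ_meas i1.
- by apply: integral_ge0 => ? _; rewrite lee_fin.
by apply: lte_mul_pinfty => //; [exact: integral_ge0|rewrite ge0_fin_numE//; exact: integral_ge0].
Qed.

Lemma Rintegral_prod f1 f2 : integ m1 f1 -> integ m2 f2 ->
  \int[(m1 \x m2)%E]_p (f1 p.1 * f2 p.2) = (\int[m1]_x f1 x) * (\int[m2]_y f2 y).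
Proof.
move=> i1 i2.
have i12 := integ_prod i1 i2.
rewrite {1}/Rintegral -(integral12_prod_meas1 i12) /=.
rewrite -[RHS]/(fine ((\int[m1]_x f1 x) * (\int[m2]_y f2 y))%:E); congr fine.
rewrite mulrC EFinM (RintegralE i1) -integralZl//.
apply: eq_integral => x _; rewrite /fubini_F/=.
under eq_integral do rewrite EFinM.
by rewrite integralZl// -(RintegralE i2) muleC.
Qed.

(** Both sides are the double integral of k(x, y) f1(x) f2(y), which is dominated by c |f1| |f2|.
    With a trigonometric kernel this moves a Fourier transform from one factor of a product to the
    other. *)
Lemma mult_formula (k : T1 -> T2 -> R) c f1 f2 :
  measurable_fun setT (fun p => k p.1 p.2) -> (forall x y, `|k x y| <= c) ->
  integ m1 f1 -> integ m2 f2 ->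
  \int[m1]_x (f1 x * \int[m2]_y (k x y * f2 y)) =
  \int[m2]_y (f2 y * \int[m1]_x (k x y * f1 x)).
Proof.
move=> mk kc i1 i2.
have mk1 x : measurable_fun setT (k x).
  exact: (measurableT_comp mk (measurable_pair1 x)).
have mk2 y : measurable_fun setT (k^~ y).
  exact: (measurableT_comp mk (measurable_pair2 y)).
transitivity (\int[m1]_x \int[m2]_y (k x y * (f1 x * f2 y))).
  apply: eq_Rintegral => x _; rewrite -RintegralZl//.
    by apply: eq_Rintegral => y _; ring.
  exact: (@integ_bound _ _ _ _ c).
rewrite RFubini.
- apply: eq_Rintegral => y _; rewrite -RintegralZl//.
    by apply: eq_Rintegral => x _; ring.
  exact: (@integ_bound _ _ _ _ c).
- apply: (@integ_bound _ _ _ _ c (fun p => k p.1 p.2) (fun p => f1 p.1 * f2 p.2)) => //.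
  exact: integ_prod.
- by move=> x; apply: (@integ_bound _ _ _ _ c) => //; exact: integZ.
- move=> y; apply: (@integ_bound _ _ _ _ c) => //.
  by under eq_fun do rewrite mulrC; exact: integZ.
Qed.

End fubini.

(** * Gaussians *)

Section gauss1.
Context {R : realType}.
Local Notation leb := (@lebesgue_measure R).
Implicit Types e m x y : R.

(* [e] is the inverse of the variance. *)
Definition gauss1 e m x := expR (- (e * (x - m) ^+ 2 / 2)).

Lemma gauss1_gt0 e m x : 0 < gauss1 e m x.
Proof. exact: expR_gt0. Qed.

Lemma gauss1_le1 e m x : 0 < e -> gauss1 e m x <= 1.
Proof.
move=> e0; rewrite /gauss1 -expR0 ler_expR oppr_le0 divr_ge0// mulr_ge0 ?sqr_ge0//.
exact: ltW.
Qed.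

Lemma is_derive_gauss1 e m x :
  is_derive x 1 (gauss1 e m) (- (e * (x - m)) * gauss1 e m x).
Proof.
by rewrite /gauss1; apply: trigger_derive; rewrite /GRing.scale/=; field.
Qed.

Lemma continuous_gauss1 e m : continuous (gauss1 e m).
Proof.
move=> x; apply: differentiable_continuous; apply/derivable1_diffP.
exact: (@ex_derive _ _ _ _ _ _ _ (is_derive_gauss1 e m x)).
Qed.

Lemma measurable_gauss1 e m : measurable_fun setT (gauss1 e m).
Proof. by apply: continuous_measurable_fun; exact: continuous_gauss1. Qed.

Let gauss1E e m : 0 < e ->
  gauss1 e m = fun x => Num.sqrt (2 * pi / e) * normal_pdf m (Num.sqrt e)^-1 x.
Proof.
move=> e0; apply/funext => x.
have s0 : (Num.sqrt e)^-1 != 0 :> R by rewrite invr_eq0 gt_eqF// sqrtr_gt0.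
rewrite normal_pdfE// /normal_peak /normal_fun exprVn sqr_sqrtr ?ltW//.
have -> : e^-1 * pi *+ 2 = 2 * pi / e by rewrite -mulr_natr; ring.
rewrite mulrA divff ?mul1r ?gt_eqF ?sqrtr_gt0 ?divr_gt0 ?mulr_gt0 ?pi_gt0//.
by congr expR; field; rewrite gt_eqF.
Qed.

Lemma integ_gauss1 e m : 0 < e -> integ leb (gauss1 e m).
Proof. by move=> e0; rewrite gauss1E//; apply: integZ; exact: integrable_normal_pdf. Qed.

Lemma Rintegral_gauss1 e m : 0 < e -> \int[leb]_x gauss1 e m x = Num.sqrt (2 * pi / e).
Proof.
move=> e0; rewrite gauss1E// RintegralZl//; last exact: integrable_normal_pdf.
by rewrite /Rintegral integral_normal_pdf mulr1.
Qed.

(** With r = |x - m|: 1 + |x| <= (1 + |m|)(1 + r), then (1 + r)^k <= e^(kr), and completing the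
    square bounds e^(kr - e r^2 / 2) by e^(k^2 / (2e)). The existence is informative so that a
    constant can later be named for each coordinate. *)
Lemma gauss1_pow_le e m (k : nat) : 0 < e ->
  {C : R | 0 <= C & forall x, (1 + `|x|) ^+ k * gauss1 e m x <= C}.
Proof.
move=> e0; exists ((1 + `|m|) ^+ k * expR (k%:R ^+ 2 / (2 * e))).
  by rewrite mulr_ge0// ?expR_ge0// exprn_ge0// addr_ge0.
move=> x.
have h1 : 1 + `|x| <= (1 + `|m|) * (1 + `|x - m|).
  have := ler_normD (x - m) m; rewrite subrK => h.
  have := mulr_ge0 (normr_ge0 m) (normr_ge0 (x - m)); lra.
have h2 : (1 + `|x|) ^+ k <= (1 + `|m|) ^+ k * expR (k%:R * `|x - m|).
  apply: (@le_trans _ _ (((1 + `|m|) * (1 + `|x - m|)) ^+ k)).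
    by rewrite lerXn2r// nnegrE ?mulr_ge0// addr_ge0.
  rewrite exprMn ler_wpM2l ?exprn_ge0 ?addr_ge0//.
  rewrite mulrC expRM_natr lerXn2r ?nnegrE ?expR_ge0 ?addr_ge0//.
  exact: expR_ge1Dx.
apply: (@le_trans _ _ (((1 + `|m|) ^+ k * expR (k%:R * `|x - m|)) * gauss1 e m x)).
  by rewrite ler_wpM2r// ltW ?gauss1_gt0.
rewrite -mulrA ler_wpM2l ?exprn_ge0 ?addr_ge0//.
rewrite /gauss1 -expRD ler_expR -(real_normK (num_real (x - m))).
set r := `|x - m|.
rewrite -subr_ge0.
have -> : k%:R ^+ 2 / (2 * e) - (k%:R * r - e * r ^+ 2 / 2) = (e * r - k%:R) ^+ 2 / (2 * e).
  by field; rewrite gt_eqF.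
by rewrite divr_ge0 ?sqr_ge0// mulr_ge0// ltW.
Qed.

(** A Gaussian is the product of two Gaussians with half the exponent: one absorbs the polynomial
    growth, the other stays integrable. *)
Lemma integ_pow_gauss1 e m (k : nat) (f : R -> R) : 0 < e ->
  measurable_fun setT f -> (forall x, `|f x| <= (1 + `|x|) ^+ k) ->
  integ leb (fun x => f x * gauss1 e m x).
Proof.
move=> e0 mf fk; have e20 : 0 < e / 2 by rewrite divr_gt0.
have [C C0 HC] := @gauss1_pow_le (e / 2) m k e20.
apply: (@integ_le _ _ R leb _ (fun x => C * gauss1 (e / 2) m x)).
- by apply: measurable_funM => //; exact: measurable_gauss1.
- exact/integZ/integ_gauss1.
move=> x; have -> : gauss1 e m x = gauss1 (e / 2) m x * gauss1 (e / 2) m x.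
  by rewrite /gauss1 -expRD; congr expR; field.
rewrite mulrA normrM (ger0_norm (ltW (gauss1_gt0 (e / 2) _ _))) ler_wpM2r ?(ltW (gauss1_gt0 _ _ _))//.
rewrite normrM (ger0_norm (ltW (gauss1_gt0 (e / 2) _ _))).
by apply: le_trans (HC x); rewrite ler_wpM2r// ltW ?gauss1_gt0.
Qed.

(** Integration by parts without boundary terms: the fundamental theorem of calculus on [-n, n],
    then dominated convergence. *)
Lemma Rintegral_derive_eq0 (F f : R -> R) : (forall x, is_derive x 1 F (f x)) ->
  continuous f -> integ leb f ->
  F n%:R @[n --> \oo] --> 0 -> F (- n%:R) @[n --> \oo] --> 0 ->
  \int[leb]_x f x = 0.
Proof.
move=> dF cf fi F1 F2.
have mf := integ_meas fi.
pose D (n : nat) : set R := [set` `[- n%:R, n%:R]].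
have [|||||_] := @Rint_dominated _ _ _ leb (fun n x => f x * \1_(D n) x) f
    (fun x => `|f x|).
- by move=> n; apply: (measurable_funM mf); apply: measurable_indic; exact: measurable_itv.
- exact: mf.
- apply/aeW => x; apply: cvg_near_cst.
  near=> n; rewrite indicE mem_set ?mulr1// /D/= in_itv/= -ler_norml.
  by near: n; exact: nbhs_infty_ger.
- exact: integ_norm.
- apply/aeW => x n; rewrite normrM ler_piMr// indicE.
  by case: (_ \in _); rewrite ?normr1 ?normr0.
move=> H.
suff H0 : \int[leb]_x (f x * \1_(D n) x) @[n --> \oo] --> 0.
  by rewrite -(cvg_lim _ H)// (cvg_lim _ H0).
rewrite (_ : (fun n => _) = (fun n => F n%:R - F (- n%:R))).
  by rewrite -(subr0 0); apply: cvgB.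
(* The fundamental theorem is applied on a nondegenerate interval, so n = 0 is settled
   separately. *)
apply/funext => -[|n].
  rewrite oppr0 subrr /D oppr0 set_itv1.
  by rewrite Rintegral_indicr Rintegral_set1.
rewrite Rintegral_indicr /Rintegral (@continuous_FTC2 _ f F)//.
- by rewrite (@lt_trans _ _ 0)// oppr_lt0 ltr0n.
- by apply: continuous_subspaceT.
- have cF x : {for x, continuous F}.
    by apply: differentiable_continuous; apply/derivable1_diffP; exact: ex_derive.
  split.
  + by move=> x _; exact: ex_derive.
  + by apply: cvg_at_right_filter; exact: cF.
  + by apply: cvg_at_left_filter; exact: cF.
- by move=> x _; rewrite derive1E; exact: derive_val.
Unshelve. all: by end_near. Qed.

Lemma gauss1_cvg0 e m (u : nat -> R) (b : nat -> R) : 0 < e ->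
  (forall n, `|u n| = n%:R) -> (forall n, `|b n| <= 1) ->
  gauss1 e m (u n) * b n @[n --> \oo] --> 0.
Proof.
move=> e0 un bn; have [C C0 HC] := @gauss1_pow_le e m 1 e0.
apply/norm_cvg0P.
apply: (@squeeze_cvgr _ _ _ _ (fun=> 0) (fun n => C * n.+1%:R^-1)).
- apply: nearW => n; rewrite normr_ge0/= normrM.
  rewrite (ger0_norm (ltW (gauss1_gt0 _ _ _))).
  apply: (@le_trans _ _ (gauss1 e m (u n))).
    by rewrite ler_piMr// ltW// gauss1_gt0.
  by rewrite ler_pdivlMr// mulrC -natr1 -un addrC -(expr1 (1 + _)).
- exact: cvg_cst.
- rewrite -(mulr0 C); apply: cvgM; first exact: cvg_cst.
  exact: cvg_harmonic.
Qed.


(** * The Fourier transform of a one-dimensional Gaussian *)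

Section transform.
Variables e m : R.
Hypothesis e0 : 0 < e.
Local Notation g := (gauss1 e m).

Let gE x : 0 <= g x := ltW (gauss1_gt0 e m x).

Let integ_bd (b : R -> R) : measurable_fun setT b -> (forall x, `|b x| <= 1) ->
  integ leb (fun x => b x * g x).
Proof.
move=> mb b1; apply: (@integ_pow_gauss1 _ _ 0) => // x; exact: b1.
Qed.

Let integ_bd1 (b : R -> R) : measurable_fun setT b -> (forall x, `|b x| <= 1) ->
  integ leb (fun x => x * b x * g x).
Proof.
move=> mb b1; apply: (@integ_pow_gauss1 _ _ 1) => //; first exact: measurable_funM.
move=> x; rewrite expr1 normrM; have := b1 x; have := normr_ge0 x; nra.
Qed.

Let mcos y : measurable_fun setT (fun x => cos (y * x)).
Proof. by apply: measurableT_comp; [exact: measurable_cos|exact: measurable_funM]. Qed.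

Let msin y : measurable_fun setT (fun x => sin (y * x)).
Proof. by apply: measurableT_comp; [exact: measurable_sin|exact: measurable_funM]. Qed.

Let icos y : integ leb (fun x => cos (y * x) * g x).
Proof. exact: (integ_bd (mcos y) (fun x => normr_cos_le1 _)). Qed.

Let isin y : integ leb (fun x => sin (y * x) * g x).
Proof. exact: (integ_bd (msin y) (fun x => normr_sin_le1 _)). Qed.

Let icos1 y : integ leb (fun x => x * cos (y * x) * g x).
Proof. exact: (integ_bd1 (mcos y) (fun x => normr_cos_le1 _)). Qed.

Let isin1 y : integ leb (fun x => x * sin (y * x) * g x).
Proof. exact: (integ_bd1 (msin y) (fun x => normr_sin_le1 _)). Qed.

Let C y := \int[leb]_x (cos (y * x) * g x).
Let S y := \int[leb]_x (sin (y * x) * g x).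
Let C1 y := \int[leb]_x (x * cos (y * x) * g x).
Let S1 y := \int[leb]_x (x * sin (y * x) * g x).

Let integ_dom : integ leb (fun x => `|x| * g x).
Proof.
apply: (@integ_pow_gauss1 _ _ 1) => // x; by rewrite expr1 normr_id lerDr.
Qed.

(** Differentiation under the integral sign; |x| g(x) dominates the derivative of the integrand for
    all y. *)
Let dC y : is_derive y 1 C (- S1 y).
Proof.
have yI : `]y - 1, y + 1[%classic y by rewrite /= in_itv/=; apply/andP; split; lra.
pose f (y x : R) := cos (y * x) * g x.
have df y' x : is_derive y' 1 (f^~ x) (- (x * sin (y' * x) * g x)).
  by rewrite /f; apply: trigger_derive; rewrite /GRing.scale/=; ring.
have d1 : partial1of2 f = fun y' x => - (x * sin (y' * x) * g x).
  by apply/funext => y'; apply/funext => x; rewrite partial1of2E; exact: derive_val.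
have H1 z : `]y - 1, y + 1[%classic z -> integ leb (f z) by move=> _; exact: icos.
have H2 z x : `]y - 1, y + 1[%classic z -> setT x -> derivable (f^~ x) z 1.
  by move=> _ _; exact: ex_derive.
have H3 z x : `]y - 1, y + 1[%classic z -> setT x -> `|partial1of2 f z x| <= `|x| * g x.
  move=> _ _; rewrite d1 normrN !normrM (ger0_norm (gE x)) ler_wpM2r//.
  by rewrite ler_piMr// normr_sin_le1.
apply: DeriveDef.
  exact: (derivable_under_integral measurableT yI H1 H2 (fun x => mulr_ge0 (normr_ge0 x) (gE x)) integ_dom H3).
rewrite -derive1E.
rewrite (differentiation_under_integral measurableT yI H1 H2 (fun x => mulr_ge0 (normr_ge0 x) (gE x)) integ_dom H3)//.
rewrite d1 /S1 -[RHS]mulN1r -RintegralZl//; last exact: isin1.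
by apply: eq_Rintegral => x _; rewrite mulN1r.
Qed.

Let dS y : is_derive y 1 S (C1 y).
Proof.
have yI : `]y - 1, y + 1[%classic y by rewrite /= in_itv/=; apply/andP; split; lra.
pose f (y x : R) := sin (y * x) * g x.
have df y' x : is_derive y' 1 (f^~ x) (x * cos (y' * x) * g x).
  by rewrite /f; apply: trigger_derive; rewrite /GRing.scale/=; ring.
have d1 : partial1of2 f = fun y' x => x * cos (y' * x) * g x.
  by apply/funext => y'; apply/funext => x; rewrite partial1of2E; exact: derive_val.
have H1 z : `]y - 1, y + 1[%classic z -> integ leb (f z) by move=> _; exact: isin.
have H2 z x : `]y - 1, y + 1[%classic z -> setT x -> derivable (f^~ x) z 1.
  by move=> _ _; exact: ex_derive.
have H3 z x : `]y - 1, y + 1[%classic z -> setT x -> `|partial1of2 f z x| <= `|x| * g x.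
  move=> _ _; rewrite d1 !normrM (ger0_norm (gE x)) ler_wpM2r//.
  by rewrite ler_piMr// normr_cos_le1.
apply: DeriveDef.
  exact: (derivable_under_integral measurableT yI H1 H2 (fun x => mulr_ge0 (normr_ge0 x) (gE x)) integ_dom H3).
rewrite -derive1E.
rewrite (differentiation_under_integral measurableT yI H1 H2 (fun x => mulr_ge0 (normr_ge0 x) (gE x)) integ_dom H3)//.
by rewrite d1.
Qed.

(** The derivative of g(x) sin(yx) integrates to zero, that is, y C + e m S - e S1 = 0. Together
    with [C1E] this expresses the derivatives of [C] and [S] through [C] and [S], which closes a
    linear differential system. *)
Let S1E y : S1 y = m * S y + y / e * C y.
Proof.
have d x : is_derive x 1 (fun x => g x * sin (y * x))
    (y * (cos (y * x) * g x) + (e * m) * (sin (y * x) * g x) - e * (x * sin (y * x) * g x)).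
  have := is_derive_gauss1 e m x => dg.
  by apply: trigger_derive; rewrite /GRing.scale/=; ring.
have c x : {for x, continuous g} by exact: continuous_gauss1.
have H := Rintegral_derive_eq0 d.
have : \int[leb]_x (y * (cos (y * x) * g x) + (e * m) * (sin (y * x) * g x) -
    e * (x * sin (y * x) * g x)) = 0.
  apply: H.
  - move=> x; have ccos : {for x, continuous (fun x => cos (y * x))}.
      by apply: differentiable_continuous; apply/derivable1_diffP; exact: ex_derive.
    have csin : {for x, continuous (fun x => sin (y * x))}.
      by apply: differentiable_continuous; apply/derivable1_diffP; exact: ex_derive.
    apply: cvgB; last first.
      apply: cvgM; first exact: cvg_cst.
      by apply: cvgM; [apply: cvgM => //; exact: cvg_id|exact: c].
    apply: cvgD; apply: cvgM; try exact: cvg_cst.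
      by apply: cvgM; [|exact: c].
    by apply: cvgM; [|exact: c].
  - apply: integB; last by apply: integZ; solve [exact: icos1|exact: isin1].
    by apply: integD; apply: integZ; solve [exact: icos|exact: isin].
  - by apply: (@gauss1_cvg0 e m (fun n => n%:R) (fun n => sin (y * n%:R))) => // n; rewrite ?normr_nat ?normr_sin_le1.
  - by apply: (@gauss1_cvg0 e m (fun n => - n%:R) (fun n => sin (y * - n%:R))) => // n; rewrite ?normrN ?normr_nat ?normr_sin_le1.
rewrite RintegralB//; last 2 first.
- by apply: integD; apply: integZ; solve [exact: icos|exact: isin].
- by apply: integZ; solve [exact: icos1|exact: isin1].
rewrite RintegralD//; try by apply: integZ; solve [exact: icos|exact: isin].
rewrite !RintegralZl; try (by []); try solve [exact: icos|exact: isin|exact: icos1|exact: isin1].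
rewrite -/(C y) -/(S y) -/(S1 y) => h.
have e1 : e != 0 by rewrite gt_eqF.
apply: (mulfI e1); rewrite [RHS](_ : _ = e * m * S y + y * C y); [lra|by field].
Qed.

Let C1E y : C1 y = m * C y - y / e * S y.
Proof.
have d x : is_derive x 1 (fun x => g x * cos (y * x))
    ((e * m) * (cos (y * x) * g x) - y * (sin (y * x) * g x) - e * (x * cos (y * x) * g x)).
  have := is_derive_gauss1 e m x => dg.
  by apply: trigger_derive; rewrite /GRing.scale/=; ring.
have c x : {for x, continuous g} by exact: continuous_gauss1.
have H := Rintegral_derive_eq0 d.
have : \int[leb]_x ((e * m) * (cos (y * x) * g x) - y * (sin (y * x) * g x) -
   e * (x * cos (y * x) * g x)) = 0.
  apply: H.
  - move=> x; have ccos : {for x, continuous (fun x => cos (y * x))}.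
      by apply: differentiable_continuous; apply/derivable1_diffP; exact: ex_derive.
    have csin : {for x, continuous (fun x => sin (y * x))}.
      by apply: differentiable_continuous; apply/derivable1_diffP; exact: ex_derive.
    apply: cvgB; last first.
      apply: cvgM; first exact: cvg_cst.
      by apply: cvgM; [apply: cvgM => //; exact: cvg_id|exact: c].
    apply: cvgB; apply: cvgM; try exact: cvg_cst.
      by apply: cvgM; [|exact: c].
    by apply: cvgM; [|exact: c].
  - apply: integB; last by apply: integZ; solve [exact: icos1|exact: isin1].
    by apply: integB; apply: integZ; solve [exact: icos|exact: isin].
  - by apply: (@gauss1_cvg0 e m (fun n => n%:R) (fun n => cos (y * n%:R))) => // n; rewrite ?normr_nat ?normr_cos_le1.
  - by apply: (@gauss1_cvg0 e m (fun n => - n%:R) (fun n => cos (y * - n%:R))) => // n; rewrite ?normrN ?normr_nat ?normr_cos_le1.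
rewrite RintegralB//; last 2 first.
- by apply: integB; apply: integZ; solve [exact: icos|exact: isin].
- by apply: integZ; solve [exact: icos1|exact: isin1].
rewrite RintegralB//; try by apply: integZ; solve [exact: icos|exact: isin].
rewrite !RintegralZl; try (by []); try solve [exact: icos|exact: isin|exact: icos1|exact: isin1].
rewrite -/(C y) -/(S y) -/(C1 y) => h.
have e1 : e != 0 by rewrite gt_eqF.
apply: (mulfI e1); rewrite [RHS](_ : _ = e * m * C y - y * S y); [lra|by field].
Qed.

Let C0 : C 0 = Num.sqrt (2 * pi / e).
Proof.
rewrite -(Rintegral_gauss1 m e0); apply: eq_Rintegral => x _.
by rewrite mul0r cos0 mul1r.
Qed.

Let S0 : S 0 = 0.
Proof.
rewrite /S (_ : (fun _ => _) = cst 0) ?Rintegral_cst//; last first.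
  by apply/funext => x; rewrite mul0r sin0 mul0r.
by rewrite mul0r.
Qed.

Let w y := expR (y ^+ 2 / (2 * e)).

(** For F = C + i S the system reads F' = (i m - y / e) F, so e^(y^2 / (2e)) e^(-i m y) F(y) is
    constant. The two identities are its real and imaginary parts, evaluated at y = 0. *)
Let CS y : w y * (C y * cos (y * m) + S y * sin (y * m)) = Num.sqrt (2 * pi / e) /\
  w y * (S y * cos (y * m) - C y * sin (y * m)) = 0.
Proof.
have e1 : e != 0 by rewrite gt_eqF.
have dw (z : R) : is_derive z 1 w (z / e * w z).
  by rewrite /w; apply: trigger_derive; rewrite /GRing.scale/=; field.
split.
  rewrite [LHS](_ : _ = w 0 * (C 0 * cos (0 * m) + S 0 * sin (0 * m))).
    by rewrite S0 C0 !mul0r ?cos0 ?sin0 /w ?expr0n ?mul0r ?expR0; ring.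
  pose h z := w z * (C z * cos (z * m) + S z * sin (z * m)).
  apply: (@is_derive_0_is_cst _ h) => z.
  have := dC z; have := dS z; rewrite C1E S1E => d1 d2.
  by rewrite /h; apply: trigger_derive; rewrite /GRing.scale/=; field.
rewrite [LHS](_ : _ = w 0 * (S 0 * cos (0 * m) - C 0 * sin (0 * m))).
  by rewrite S0 C0 !mul0r ?cos0 ?sin0 /w ?expr0n ?mul0r ?expR0; ring.
pose h z := w z * (S z * cos (z * m) - C z * sin (z * m)).
apply: (@is_derive_0_is_cst _ h) => z.
have := dC z; have := dS z; rewrite C1E S1E => d1 d2.
by rewrite /h; apply: trigger_derive; rewrite /GRing.scale/=; field.
Qed.

Let wV y : expR (- (y ^+ 2 / (2 * e))) * w y = 1.
Proof. by rewrite -expRD addNr expR0. Qed.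

Lemma cos_gauss1 y : \int[leb]_x (cos (y * x) * gauss1 e m x) =
  Num.sqrt (2 * pi / e) * expR (- (y ^+ 2 / (2 * e))) * cos (y * m).
Proof.
rewrite -/(C y); have [h1 h2] := CS y; have h3 := wV y; have := cos2Dsin2 (y * m).
have -> : C y = (expR (- (y ^+ 2 / (2 * e))) * w y) * (cos (y * m) ^+ 2 + sin (y * m) ^+ 2) * C y.
  by rewrite h3 cos2Dsin2; ring.
move=> _; rewrite -h1.
transitivity (expR (- (y ^+ 2 / (2 * e))) *
  (w y * (C y * cos (y * m) + S y * sin (y * m)) * cos (y * m)
   - w y * (S y * cos (y * m) - C y * sin (y * m)) * sin (y * m))); first by ring.
by rewrite h2; ring.
Qed.

Lemma sin_gauss1 y : \int[leb]_x (sin (y * x) * gauss1 e m x) =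
  Num.sqrt (2 * pi / e) * expR (- (y ^+ 2 / (2 * e))) * sin (y * m).
Proof.
rewrite -/(S y); have [h1 h2] := CS y; have h3 := wV y.
have -> : S y = (expR (- (y ^+ 2 / (2 * e))) * w y) * (cos (y * m) ^+ 2 + sin (y * m) ^+ 2) * S y.
  by rewrite h3 cos2Dsin2; ring.
rewrite -h1.
transitivity (expR (- (y ^+ 2 / (2 * e))) *
  (w y * (C y * cos (y * m) + S y * sin (y * m)) * sin (y * m)
   + w y * (S y * cos (y * m) - C y * sin (y * m)) * cos (y * m))); first by ring.
by rewrite h2; ring.
Qed.

End transform.

End gauss1.

(** * Integration over R^(n+1) as a product of R and R^n *)

Section rV_integral.
Context {R : realType} (n : nat).
Local Notation leb := (@lebesgue_measure R).
Local Notation tail x := (\row_j x ord0 (lift ord0 j)).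

Lemma measurable_rV_tail :
  measurable_fun setT (fun x : 'rV[R]_n.+1 => tail x : 'rV[R]_n).
Proof. exact: (measurableT_comp measurable_snd (@measurable_rV_uncons R n)). Qed.

Lemma tail_rV_cons r (z : 'rV[R]_n) : tail (rV_cons (r, z)) = z.
Proof. by have [] := @rV_consK R n (r, z). Qed.

Lemma integ_rV_cons (f : 'rV[R]_n.+1 -> R) : measurable_fun setT f ->
  integ (leb \x lebesgue_rV n)%E (fun p => f (rV_cons p)) ->
  integ (lebesgue_rV n.+1) f /\
  \int[lebesgue_rV n.+1]_x f x = \int[(leb \x lebesgue_rV n)%E]_p f (rV_cons p).
Proof.
move=> mf fi; have mEf : measurable_fun setT (EFin \o f) by exact/measurable_EFinP.
have fi' : integrable (leb \x lebesgue_rV n)%E (@rV_cons R n @^-1` setT) ((EFin \o f) \o @rV_cons R n).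
  by rewrite preimage_setT.
split; first exact: (integrable_pushforward (@measurable_rV_cons R n) mEf fi' measurableT).
rewrite /Rintegral; congr fine.
have := integral_pushforward (@measurable_rV_cons R n) mEf fi' measurableT.
by rewrite preimage_setT.
Qed.

Lemma integ_rV_prod (f1 : R -> R) (f2 : 'rV[R]_n -> R) :
  integ leb f1 -> integ (lebesgue_rV n) f2 ->
  integ (lebesgue_rV n.+1) (fun x => f1 (x ord0 ord0) * f2 (tail x)) /\
  \int[lebesgue_rV n.+1]_x (f1 (x ord0 ord0) * f2 (tail x)) =
  (\int[leb]_r f1 r) * \int[lebesgue_rV n]_z f2 z.
Proof.
move=> i1 i2; rewrite -(Rintegral_prod i1 i2).
have mf : measurable_fun setT (fun x : 'rV[R]_n.+1 => f1 (x ord0 ord0) * f2 (tail x)).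
  apply: measurable_funM.
    exact: (measurableT_comp (integ_meas i1) (measurable_rV_coord ord0)).
  exact: (measurableT_comp (integ_meas i2) measurable_rV_tail).
have E (p : measurableTypeR R * 'rV[R]_n) :
    f1 (rV_cons p ord0 ord0) * f2 (tail (rV_cons p)) = f1 p.1 * f2 p.2.
  by case: p => r z; rewrite rV_cons0 tail_rV_cons.
have [|i E2] := integ_rV_cons mf.
  by under eq_fun do rewrite E; exact: integ_prod.
by split=> //; rewrite E2; apply: eq_Rintegral => p _; exact: E.
Qed.

End rV_integral.

(** * Gaussians on R^n and their Fourier transform *)

Section gauss.
Context {R : realType}.
Local Notation leb := (@lebesgue_measure R).

(** Each coordinate has its own inverse variance: the proof that Gaussians separate functions
    multiplies by a Gaussian in a single coordinate, and the family has to be stable under this. *)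
Definition gauss n (e m x : 'rV[R]_n) : R :=
  \prod_i gauss1 (e ord0 i) (m ord0 i) (x ord0 i).

Definition rVpos n (e : 'rV[R]_n) := forall i, 0 < e ord0 i.

Definition rVinv n (e : 'rV[R]_n) : 'rV[R]_n := \row_i (e ord0 i)^-1.

Definition gauss_mass n (e : 'rV[R]_n) : R := \prod_i Num.sqrt (2 * pi / e ord0 i).

Lemma rVinv_pos n (e : 'rV[R]_n) : rVpos e -> rVpos (rVinv e).
Proof. by move=> e0 i; rewrite mxE invr_gt0. Qed.

Lemma rVinvK n (e : 'rV[R]_n) : rVinv (rVinv e) = e.
Proof. by apply/rowP => i; rewrite !mxE invrK. Qed.

Lemma gauss_mass_gt0 n (e : 'rV[R]_n) : rVpos e -> 0 < gauss_mass e.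
Proof.
by move=> e0; apply: prodr_gt0 => i _; rewrite sqrtr_gt0 divr_gt0// mulr_gt0// pi_gt0.
Qed.

(** This product, independent of [e], is the origin of the constant (2 pi)^n in Plancherel's
    inequality and in Fourier inversion. *)
Lemma gauss_mass_inv n (e : 'rV[R]_n) : rVpos e ->
  gauss_mass e * gauss_mass (rVinv e) = (2 * pi) ^+ n.
Proof.
move=> e0; rewrite /gauss_mass -big_split/= -[n in RHS]card_ord -prodr_const.
apply: eq_bigr => i _; have ei := e0 i; rewrite mxE invrK.
have p0 := pi_gt0 R.
rewrite -sqrtrM; last by rewrite divr_ge0// ?ltW// mulr_gt0.
rewrite [X in Num.sqrt X](_ : _ = (2 * pi) ^+ 2); last by field; rewrite gt_eqF.
by rewrite sqrtr_sqr ger0_norm// ltW// mulr_gt0.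
Qed.

Lemma gauss_gt0 n (e m x : 'rV[R]_n) : 0 < gauss e m x.
Proof. by apply: prodr_gt0 => i _; exact: gauss1_gt0. Qed.

Lemma gauss_le1 n (e m x : 'rV[R]_n) : rVpos e -> gauss e m x <= 1.
Proof.
by move=> e0; apply: prodr_ile1 => i _; rewrite ltW ?gauss1_gt0//= gauss1_le1.
Qed.

Lemma gauss_sym n (e m x : 'rV[R]_n) : gauss e m x = gauss e x m.
Proof.
apply: eq_bigr => i _; rewrite /gauss1.
by congr (expR (- (_ * _ / 2))); rewrite -sqrrN opprB.
Qed.

Lemma gauss_sub n (e m x : 'rV[R]_n) : gauss e m x = gauss e 0 (x - m).
Proof. by apply: eq_bigr => i _; rewrite /gauss1 !mxE subr0. Qed.

Lemma measurable_gauss n (e m : 'rV[R]_n) : measurable_fun setT (gauss e m).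
Proof.
apply: measurable_prod => i _.
exact: (measurableT_comp (measurable_gauss1 _ _) (measurable_rV_coord i)).
Qed.

Lemma measurable_rdot n (y : 'rV[R]_n) : measurable_fun setT (rdot y).
Proof.
apply: measurable_sum => i; apply: measurable_funM => //.
exact: measurable_rV_coord.
Qed.

Lemma measurable_rdot2 n :
  measurable_fun setT (fun p : 'rV[R]_n * 'rV[R]_n => rdot p.1 p.2).
Proof.
apply: measurable_sum => i; apply: measurable_funM.
  exact: (measurableT_comp (measurable_rV_coord i) measurable_fst).
exact: (measurableT_comp (measurable_rV_coord i) measurable_snd).
Qed.

Lemma rdotC n (x y : 'rV[R]_n) : rdot x y = rdot y x.
Proof. by apply: eq_bigr => i _; rewrite mulrC. Qed.

Lemma rdotBl n (x y z : 'rV[R]_n) : rdot (x - y) z = rdot x z - rdot y z.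
Proof. by rewrite -sumrB; apply: eq_bigr => i _; rewrite !mxE mulrBl. Qed.

Lemma rdotNl n (x z : 'rV[R]_n) : rdot (- x) z = - rdot x z.
Proof. by rewrite -sumrN; apply: eq_bigr => i _; rewrite !mxE mulNr. Qed.

Lemma rdot0l n (z : 'rV[R]_n) : rdot 0 z = 0.
Proof. by rewrite /rdot big1// => i _; rewrite !mxE mul0r. Qed.

Local Notation tail x := (\row_j x ord0 (lift ord0 j)).

Lemma rdot_tail n (x y : 'rV[R]_n.+1) :
  rdot x y = x ord0 ord0 * y ord0 ord0 + rdot (tail x) (tail y).
Proof.
by rewrite /rdot big_ord_recl; congr (_ + _); apply: eq_bigr => i _; rewrite !mxE.
Qed.

Lemma gauss_tail n (e m x : 'rV[R]_n.+1) :
  gauss e m x = gauss1 (e ord0 ord0) (m ord0 ord0) (x ord0 ord0) *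
    gauss (tail e) (tail m) (tail x).
Proof.
by rewrite /gauss big_ord_recl; congr (_ * _); apply: eq_bigr => i _; rewrite !mxE.
Qed.

Lemma gauss_mass_tail n (e : 'rV[R]_n.+1) :
  gauss_mass e = Num.sqrt (2 * pi / e ord0 ord0) * gauss_mass (tail e).
Proof.
by rewrite /gauss_mass big_ord_recl; congr (_ * _); apply: eq_bigr => i _; rewrite !mxE.
Qed.

Lemma rVinv_tail n (e : 'rV[R]_n.+1) : tail (rVinv e) = rVinv (tail e).
Proof. by apply/rowP => i; rewrite !mxE. Qed.

Let icos1 (e m y : R) : 0 < e -> integ leb (fun x => cos (y * x) * gauss1 e m x).
Proof.
move=> e0; apply: (@integ_bound _ _ _ _ 1); last exact: integ_gauss1.
  by apply: measurableT_comp; [exact: measurable_cos|exact: measurable_funM].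
by move=> x; exact: normr_cos_le1.
Qed.

Let isin1 (e m y : R) : 0 < e -> integ leb (fun x => sin (y * x) * gauss1 e m x).
Proof.
move=> e0; apply: (@integ_bound _ _ _ _ 1); last exact: integ_gauss1.
  by apply: measurableT_comp; [exact: measurable_sin|exact: measurable_funM].
by move=> x; exact: normr_sin_le1.
Qed.

Lemma integ_gauss n (e m : 'rV[R]_n) : rVpos e -> integ (lebesgue_rV n) (gauss e m).
Proof.
elim: n e m => [|n IH] e m e0.
  apply: integ_lty; [exact: measurable_gauss|by move=> x; exact/ltW/gauss_gt0|].
  have mg : measurable_fun setT (fun x => (gauss e m x)%:E).
    by apply/measurable_EFinP; exact: measurable_gauss.
  by rewrite [ltLHS](integral_dirac _ measurableT mg) diracT mul1e ltry.
have te0 : rVpos (tail e) by move=> i; rewrite mxE.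
have [+ _] := integ_rV_prod (integ_gauss1 (m ord0 ord0) (e0 ord0)) (IH (tail e) (tail m) te0).
by under eq_fun do rewrite -gauss_tail.
Qed.

Lemma integ_cos_gauss n (e m y : 'rV[R]_n) : rVpos e ->
  integ (lebesgue_rV n) (fun x => cos (rdot y x) * gauss e m x).
Proof.
move=> e0; apply: (@integ_bound _ _ _ _ 1); last exact: integ_gauss.
  by apply: measurableT_comp; [exact: measurable_cos|exact: measurable_rdot].
by move=> x; exact: normr_cos_le1.
Qed.

Lemma integ_sin_gauss n (e m y : 'rV[R]_n) : rVpos e ->
  integ (lebesgue_rV n) (fun x => sin (rdot y x) * gauss e m x).
Proof.
move=> e0; apply: (@integ_bound _ _ _ _ 1); last exact: integ_gauss.
  by apply: measurableT_comp; [exact: measurable_sin|exact: measurable_rdot].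
by move=> x; exact: normr_sin_le1.
Qed.

Let gauss1_inv (e y : R) : 0 < e -> expR (- (y ^+ 2 / (2 * e))) = gauss1 e^-1 0 y.
Proof. by move=> e0; rewrite /gauss1 subr0; congr expR; field; rewrite gt_eqF. Qed.

(** Induction on the dimension: the addition formulas split the kernel into products of a function
    of the first coordinate and a function of the others. Cosine and sine need each other, so both
    are proved together. *)
Lemma gauss_transform n (e m y : 'rV[R]_n) : rVpos e ->
  \int[lebesgue_rV n]_x (cos (rdot y x) * gauss e m x) =
    gauss_mass e * gauss (rVinv e) 0 y * cos (rdot y m) /\
  \int[lebesgue_rV n]_x (sin (rdot y x) * gauss e m x) =
    gauss_mass e * gauss (rVinv e) 0 y * sin (rdot y m).
Proof.
elim: n e m y => [|n IH] e m y e0.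
  rewrite /gauss_mass /gauss /rdot !big_ord0 cos0 sin0.
  have E (c : R) : \int[lebesgue_rV 0]_x c = c.
    have d1 : lebesgue_rV 0 setT = 1%E := diracT R (0 : 'rV[R]_0).
    transitivity (c * fine (lebesgue_rV 0 setT : \bar R)); last by rewrite d1 mulr1.
    exact: Rintegral_cst.
  split; rewrite -[RHS]E; apply: eq_Rintegral => x _; rewrite !big_ord0 ?cos0 ?sin0; ring.
have te0 : rVpos (tail e) by move=> i; rewrite mxE.
have [IHc IHs] := IH (tail e) (tail m) (tail y) te0.
have e00 := e0 ord0.
have t0 : tail (0 : 'rV[R]_n.+1) = 0 by apply/rowP => j; rewrite !mxE.
rewrite !gauss_mass_tail (gauss_tail (rVinv e)) rVinv_tail t0 !mxE !rdot_tail.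
set y0 := y ord0 ord0; set e0' := e ord0 ord0; set m0 := m ord0 ord0.
have c1 := cos_gauss1 m0 e00 y0; have s1 := sin_gauss1 m0 e00 y0.
rewrite gauss1_inv// in c1; rewrite gauss1_inv// in s1.
have ic1 := icos1 m0 y0 e00; have is1 := isin1 m0 y0 e00.
have ic2 := integ_cos_gauss (tail m) (tail y) te0.
have is2 := integ_sin_gauss (tail m) (tail y) te0.
have [icc Ecc] := integ_rV_prod ic1 ic2; have [iss Ess] := integ_rV_prod is1 is2.
have [ics Ecs] := integ_rV_prod ic1 is2; have [isc Esc] := integ_rV_prod is1 ic2.
split.
- transitivity (\int[lebesgue_rV n.+1]_x
   ((cos (y0 * x ord0 ord0) * gauss1 e0' m0 (x ord0 ord0)) *
    (cos (rdot (tail y) (tail x)) * gauss (tail e) (tail m) (tail x)) -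
    (sin (y0 * x ord0 ord0) * gauss1 e0' m0 (x ord0 ord0)) *
    (sin (rdot (tail y) (tail x)) * gauss (tail e) (tail m) (tail x)))).
    apply: eq_Rintegral => x _; rewrite gauss_tail rdot_tail cosD -/y0 -/e0' -/m0.
    by ring.
  by rewrite RintegralB// Ecc Ess c1 s1 IHc IHs cosD; ring.
- transitivity (\int[lebesgue_rV n.+1]_x
   ((sin (y0 * x ord0 ord0) * gauss1 e0' m0 (x ord0 ord0)) *
    (cos (rdot (tail y) (tail x)) * gauss (tail e) (tail m) (tail x)) +
    (cos (y0 * x ord0 ord0) * gauss1 e0' m0 (x ord0 ord0)) *
    (sin (rdot (tail y) (tail x)) * gauss (tail e) (tail m) (tail x)))).
    apply: eq_Rintegral => x _; rewrite gauss_tail rdot_tail sinD -/y0 -/e0' -/m0.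
    by ring.
  by rewrite RintegralD// Esc Ecs c1 s1 IHc IHs sinD; ring.
Qed.

Lemma Rintegral_gauss n (e m : 'rV[R]_n) : rVpos e ->
  \int[lebesgue_rV n]_x gauss e m x = gauss_mass e.
Proof.
move=> e0; have [+ _] := gauss_transform m 0 e0.
rewrite rdot0l cos0 mulr1.
have -> : gauss (rVinv e) 0 0 = 1.
  by apply: big1 => i _; rewrite /gauss1 subrr expr0n/= mulr0 mul0r oppr0 expR0.
rewrite mulr1 => <-; apply: eq_Rintegral => x _.
by rewrite rdot0l cos0 mul1r.
Qed.

End gauss.

(** * Trigonometric integrals and Plancherel's inequality *)

Section transforms.
Context {R : realType} {n : nat}.
Local Notation Rn := 'rV[R]_n.
Local Notation mu := (@lebesgue_rV R n).
Implicit Types (h v : Rn -> R) (x xi e m : Rn).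

Definition costr h x : R := \int[mu]_xi (cos (rdot xi x) * h xi).
Definition sintr h x : R := \int[mu]_xi (sin (rdot xi x) * h xi).
(* the real part of the integral of e^{i xi.x} (h1 + i h2)(xi) *)
Definition retr h1 h2 x : R := costr h1 x - sintr h2 x.

Lemma measurable_cos_rdot x : measurable_fun setT (fun xi => cos (rdot xi x)).
Proof.
apply: measurableT_comp; first exact: measurable_cos.
by under eq_fun do rewrite rdotC; exact: measurable_rdot.
Qed.

Lemma measurable_sin_rdot x : measurable_fun setT (fun xi => sin (rdot xi x)).
Proof.
apply: measurableT_comp; first exact: measurable_sin.
by under eq_fun do rewrite rdotC; exact: measurable_rdot.
Qed.

Let mcos2 : measurable_fun setT (fun p : Rn * Rn => cos (rdot p.2 p.1)).
Proof.
apply: measurableT_comp; first exact: measurable_cos.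
by under eq_fun do rewrite rdotC; exact: measurable_rdot2.
Qed.

Let msin2 : measurable_fun setT (fun p : Rn * Rn => sin (rdot p.2 p.1)).
Proof.
apply: measurableT_comp; first exact: measurable_sin.
by under eq_fun do rewrite rdotC; exact: measurable_rdot2.
Qed.

Lemma integ_cosM h x : integ mu h -> integ mu (fun xi => cos (rdot xi x) * h xi).
Proof.
by apply: (@integ_bound _ _ _ _ 1) => [|xi]; [exact: measurable_cos_rdot|exact: normr_cos_le1].
Qed.

Lemma integ_sinM h x : integ mu h -> integ mu (fun xi => sin (rdot xi x) * h xi).
Proof.
by apply: (@integ_bound _ _ _ _ 1) => [|xi]; [exact: measurable_sin_rdot|exact: normr_sin_le1].
Qed.

Lemma measurable_costr h : measurable_fun setT h -> measurable_fun setT (costr h).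
Proof.
move=> mh; apply: (@measurable_Rintegral _ _ _ _ _ _ (fun p : Rn * Rn => cos (rdot p.2 p.1) * h p.2)).
by apply: measurable_funM => //; exact: (measurableT_comp mh measurable_snd).
Qed.

Lemma measurable_sintr h : measurable_fun setT h -> measurable_fun setT (sintr h).
Proof.
move=> mh; apply: (@measurable_Rintegral _ _ _ _ _ _ (fun p : Rn * Rn => sin (rdot p.2 p.1) * h p.2)).
by apply: measurable_funM => //; exact: (measurableT_comp mh measurable_snd).
Qed.

Lemma measurable_retr h1 h2 : measurable_fun setT h1 -> measurable_fun setT h2 ->
  measurable_fun setT (retr h1 h2).
Proof.
by move=> m1 m2; apply: measurable_funB; [exact: measurable_costr|exact: measurable_sintr].
Qed.

Lemma costr_le h x : integ mu h -> `|costr h x| <= \int[mu]_xi `|h xi|.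
Proof.
move=> hi; have ci := integ_cosM x hi.
apply: le_trans (le_normr_Rintegral measurableT ci) _.
apply: le_Rintegral => //; [exact: integ_norm|exact: integ_norm|].
by move=> xi _; rewrite normrM ler_piMl// normr_cos_le1.
Qed.

Lemma sintr_le h x : integ mu h -> `|sintr h x| <= \int[mu]_xi `|h xi|.
Proof.
move=> hi; have ci := integ_sinM x hi.
apply: le_trans (le_normr_Rintegral measurableT ci) _.
apply: le_Rintegral => //; [exact: integ_norm|exact: integ_norm|].
by move=> xi _; rewrite normrM ler_piMl// normr_sin_le1.
Qed.

Lemma retrB h1 h2 h1' h2' x : integ mu h1 -> integ mu h2 -> integ mu h1' -> integ mu h2' ->
  retr h1 h2 x - retr h1' h2' x =
  retr (fun xi => h1 xi - h1' xi) (fun xi => h2 xi - h2' xi) x.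
Proof.
move=> i1 i2 i1' i2'.
have costrB : costr (fun xi => h1 xi - h1' xi) x = costr h1 x - costr h1' x.
  rewrite /costr -(RintegralB measurableT (integ_cosM x i1) (integ_cosM x i1')).
  by apply: eq_Rintegral => xi _; rewrite mulrBr.
have sintrB : sintr (fun xi => h2 xi - h2' xi) x = sintr h2 x - sintr h2' x.
  rewrite /sintr -(RintegralB measurableT (integ_sinM x i2) (integ_sinM x i2')).
  by apply: eq_Rintegral => xi _; rewrite mulrBr.
by rewrite /retr costrB sintrB; ring.
Qed.

Lemma costr_formula f h : integ mu f -> integ mu h ->
  \int[mu]_x (f x * costr h x) = \int[mu]_xi (h xi * \int[mu]_x (cos (rdot xi x) * f x)).
Proof.
move=> fi hi.
exact: (@mult_formula _ _ _ _ _ mu mu (fun x xi => cos (rdot xi x)) 1 f h mcos2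
  (fun x y => normr_cos_le1 _) fi hi).
Qed.

Lemma sintr_formula f h : integ mu f -> integ mu h ->
  \int[mu]_x (f x * sintr h x) = \int[mu]_xi (h xi * \int[mu]_x (sin (rdot xi x) * f x)).
Proof.
move=> fi hi.
exact: (@mult_formula _ _ _ _ _ mu mu (fun x xi => sin (rdot xi x)) 1 f h msin2
  (fun x y => normr_sin_le1 _) fi hi).
Qed.

(* [v = retr h1 h2], tested against Gaussians; this makes sense for [h1] and [h2]
   that are not integrable. *)
Definition ftrel v h1 h2 := forall e m, rVpos e ->
  \int[mu]_x (v x * gauss e m x) = gauss_mass e *
   \int[mu]_xi ((cos (rdot xi m) * h1 xi - sin (rdot xi m) * h2 xi) * gauss (rVinv e) 0 xi).

Lemma integ_costr_gauss h e m : integ mu h -> rVpos e ->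
  integ mu (fun x => costr h x * gauss e m x).
Proof.
move=> hi e0; apply: (@integ_bound _ _ _ _ (\int[mu]_xi `|h xi|)).
- apply: measurable_costr; exact: (integ_meas hi).
- by move=> x; exact: costr_le.
- exact: integ_gauss.
Qed.

Lemma integ_sintr_gauss h e m : integ mu h -> rVpos e ->
  integ mu (fun x => sintr h x * gauss e m x).
Proof.
move=> hi e0; apply: (@integ_bound _ _ _ _ (\int[mu]_xi `|h xi|)).
- apply: measurable_sintr; exact: (integ_meas hi).
- by move=> x; exact: sintr_le.
- exact: integ_gauss.
Qed.

Lemma integ_retr_gauss h1 h2 e m : integ mu h1 -> integ mu h2 -> rVpos e ->
  integ mu (fun x => retr h1 h2 x * gauss e m x).
Proof.
move=> i1 i2 e0; under eq_fun do rewrite mulrBl.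
by apply: integB; [exact: integ_costr_gauss|exact: integ_sintr_gauss].
Qed.

Lemma integ_gaussM h e m : integ mu h -> rVpos e -> integ mu (fun x => h x * gauss e m x).
Proof.
move=> hi e0; under eq_fun do rewrite mulrC.
apply: (@integ_bound _ _ _ _ 1) => //; first exact: measurable_gauss.
by move=> x; rewrite ger0_norm ?gauss_le1// ltW// gauss_gt0.
Qed.

(** The multiplication formula moves the transforms onto the Gaussian, where [gauss_transform]
    evaluates them; this produces the mass and the modulation by [m]. *)
Lemma ftrel_retr h1 h2 : integ mu h1 -> integ mu h2 -> ftrel (retr h1 h2) h1 h2.
Proof.
move=> i1 i2 e m e0.
have ig := integ_gauss m e0.
transitivity (\int[mu]_x (gauss e m x * costr h1 x) - \int[mu]_x (gauss e m x * sintr h2 x)).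
  rewrite -RintegralB//; last 2 first.
  - by under eq_fun do rewrite mulrC; exact: integ_costr_gauss.
  - by under eq_fun do rewrite mulrC; exact: integ_sintr_gauss.
  by apply: eq_Rintegral => x _; rewrite /retr; ring.
rewrite costr_formula// sintr_formula//.
have j1 : integ mu (fun xi => cos (rdot xi m) * h1 xi * gauss (rVinv e) 0 xi).
  by apply: integ_gaussM; [exact: integ_cosM|exact: rVinv_pos].
have j2 : integ mu (fun xi => sin (rdot xi m) * h2 xi * gauss (rVinv e) 0 xi).
  by apply: integ_gaussM; [exact: integ_sinM|exact: rVinv_pos].
rewrite [RHS](_ : _ = \int[mu]_xi (gauss_mass e * (cos (rdot xi m) * h1 xi * gauss (rVinv e) 0 xi)) -
  \int[mu]_xi (gauss_mass e * (sin (rdot xi m) * h2 xi * gauss (rVinv e) 0 xi))); last first.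
  rewrite !RintegralZl// -mulrBr -RintegralB//; congr (_ * _).
  by apply: eq_Rintegral => xi _; rewrite mulrBl.
congr (_ - _); apply: eq_Rintegral => xi _.
  by have [-> _] := gauss_transform m xi e0; ring.
by have [_ ->] := gauss_transform m xi e0; ring.
Qed.

(** Plancherel with a Gaussian weight, which makes all the integrals absolutely convergent. Two uses
    of the multiplication formula expand the left-hand side into a double integral of h(xi) h(eta)
    against the transform of the weight at eta - xi. *)
Lemma costr_sintr_gauss h e : integ mu h -> rVpos e ->
  \int[mu]_x ((costr h x ^+ 2 + sintr h x ^+ 2) * gauss e 0 x) =
  gauss_mass e * \int[mu]_xi (h xi * \int[mu]_eta (gauss (rVinv e) xi eta * h eta)).
Proof.
move=> hi e0.
have ic := integ_costr_gauss 0 hi e0; have is_ := integ_sintr_gauss 0 hi e0.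
have icc : integ mu (fun x => (costr h x * gauss e 0 x) * costr h x).
  under eq_fun do rewrite mulrC.
  apply: (@integ_bound _ _ _ _ (\int[mu]_xi `|h xi|)) => //.
  - apply: measurable_costr; exact: (integ_meas hi).
  - by move=> x; exact: costr_le.
have iss : integ mu (fun x => (sintr h x * gauss e 0 x) * sintr h x).
  under eq_fun do rewrite mulrC.
  apply: (@integ_bound _ _ _ _ (\int[mu]_xi `|h xi|)) => //.
  - apply: measurable_sintr; exact: (integ_meas hi).
  - by move=> x; exact: sintr_le.
(* One factor of each square takes the weight and thereby becomes integrable; the other remains a
   transform, as [costr_formula] and [sintr_formula] require. *)
transitivity (\int[mu]_x ((costr h x * gauss e 0 x) * costr h x) +
  \int[mu]_x ((sintr h x * gauss e 0 x) * sintr h x)).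
  by rewrite -RintegralD//; apply: eq_Rintegral => x _; ring.
rewrite (costr_formula ic hi) (sintr_formula is_ hi).
have igc xi := integ_cos_gauss 0 xi e0.
have igs xi := integ_sin_gauss 0 xi e0.
have E1 xi : \int[mu]_x (cos (rdot xi x) * (costr h x * gauss e 0 x)) =
   \int[mu]_eta (h eta * \int[mu]_x (cos (rdot eta x) * (cos (rdot xi x) * gauss e 0 x))).
  by rewrite -costr_formula//; apply: eq_Rintegral => x _; ring.
have E2 xi : \int[mu]_x (sin (rdot xi x) * (sintr h x * gauss e 0 x)) =
   \int[mu]_eta (h eta * \int[mu]_x (sin (rdot eta x) * (sin (rdot xi x) * gauss e 0 x))).
  by rewrite -sintr_formula//; apply: eq_Rintegral => x _; ring.
have bd (f : Rn -> R) : (forall x, `|f x| <= gauss e 0 x) -> measurable_fun setT f ->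
    `|\int[mu]_x f x| <= gauss_mass e.
  move=> fg mf; have fi := integ_le mf (integ_gauss 0 e0) fg.
  apply: le_trans (le_normr_Rintegral measurableT fi) _.
  rewrite -(Rintegral_gauss 0 e0); apply: le_Rintegral => //.
    exact: integ_norm.
  exact: integ_gauss.
have mg := measurable_gauss e 0.
have gE x : `|gauss e 0 x| = gauss e 0 x by rewrite ger0_norm// ltW// gauss_gt0.
have b1 eta xi : `|\int[mu]_x (cos (rdot eta x) * (cos (rdot xi x) * gauss e 0 x))| <= gauss_mass e.
  apply: bd => [x|]; last first.
    by apply: measurable_funM; [|exact: integ_meas (igc xi)]; apply: measurableT_comp;
     [exact: measurable_cos|exact: measurable_rdot].
  by rewrite !normrM gE mulrA ler_piMl ?(ltW (gauss_gt0 _ _ _))// mulr_ile1 ?normr_cos_le1.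
have b2 eta xi : `|\int[mu]_x (sin (rdot eta x) * (sin (rdot xi x) * gauss e 0 x))| <= gauss_mass e.
  apply: bd => [x|]; last first.
    by apply: measurable_funM; [|exact: integ_meas (igs xi)]; apply: measurableT_comp;
     [exact: measurable_sin|exact: measurable_rdot].
  by rewrite !normrM gE mulrA ler_piMl ?(ltW (gauss_gt0 _ _ _))// mulr_ile1 ?normr_sin_le1.
have mcx (f : Rn -> Rn -> R) : measurable_fun setT (fun p : Rn * Rn => f p.1 p.2) ->
    measurable_fun setT (fun xi => \int[mu]_x f xi x).
  by move=> mf; exact: (@measurable_Rintegral _ _ _ _ _ _ (fun p => f p.1 p.2)).
have mgs : measurable_fun setT (fun p : Rn * Rn => gauss e 0 p.2).
  exact: (measurableT_comp mg measurable_snd).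
have i1 xi : integ mu (fun eta => h eta * \int[mu]_x (cos (rdot eta x) * (cos (rdot xi x) * gauss e 0 x))).
  under eq_fun do rewrite mulrC.
  apply: (@integ_bound _ _ _ _ (gauss_mass e)) => //.
  apply: (mcx (fun eta x => _)); apply: measurable_funM.
    by apply: measurableT_comp; [exact: measurable_cos|exact: measurable_rdot2].
  exact: (measurableT_comp (integ_meas (igc xi)) measurable_snd).
have i2 xi : integ mu (fun eta => h eta * \int[mu]_x (sin (rdot eta x) * (sin (rdot xi x) * gauss e 0 x))).
  under eq_fun do rewrite mulrC.
  apply: (@integ_bound _ _ _ _ (gauss_mass e)) => //.
  apply: (mcx (fun eta x => _)); apply: measurable_funM.
    by apply: measurableT_comp; [exact: measurable_sin|exact: measurable_rdot2].
  exact: (measurableT_comp (integ_meas (igs xi)) measurable_snd).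
have ibig (k : Rn -> R) : integ mu k -> forall xi,
    `|\int[mu]_x (cos (rdot xi x) * k x)| <= \int[mu]_x `|k x| /\
    `|\int[mu]_x (sin (rdot xi x) * k x)| <= \int[mu]_x `|k x|.
  move=> ki xi; have := costr_le xi ki; have := sintr_le xi ki; rewrite /costr /sintr.
  under eq_Rintegral do rewrite rdotC; move=> s1.
  by under eq_Rintegral do rewrite rdotC; move=> c1; split.
have I1 : integ mu (fun xi => h xi * \int[mu]_x (cos (rdot xi x) * (costr h x * gauss e 0 x))).
  under eq_fun do rewrite mulrC.
  apply: (@integ_bound _ _ _ _ (\int[mu]_x `|costr h x * gauss e 0 x|)) => //; last first.
    by move=> xi; have [] := ibig _ ic xi.
  apply: (mcx (fun eta x => _)); apply: measurable_funM.
    by apply: measurableT_comp; [exact: measurable_cos|exact: measurable_rdot2].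
  exact: (measurableT_comp (integ_meas ic) measurable_snd).
have I2 : integ mu (fun xi => h xi * \int[mu]_x (sin (rdot xi x) * (sintr h x * gauss e 0 x))).
  under eq_fun do rewrite mulrC.
  apply: (@integ_bound _ _ _ _ (\int[mu]_x `|sintr h x * gauss e 0 x|)) => //; last first.
    by move=> xi; have [] := ibig _ is_ xi.
  apply: (mcx (fun eta x => _)); apply: measurable_funM.
    by apply: measurableT_comp; [exact: measurable_sin|exact: measurable_rdot2].
  exact: (measurableT_comp (integ_meas is_) measurable_snd).
rewrite -(RintegralD measurableT I1 I2).
have ginv : rVpos (rVinv e) by exact: rVinv_pos.
have E xi : h xi * (\int[mu]_x (cos (rdot xi x) * (costr h x * gauss e 0 x))) +
      h xi * (\int[mu]_x (sin (rdot xi x) * (sintr h x * gauss e 0 x))) =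
    gauss_mass e * (h xi * \int[mu]_eta (gauss (rVinv e) xi eta * h eta)).
  rewrite -mulrDr E1 E2 -(RintegralD measurableT (i1 xi) (i2 xi)) [RHS]mulrCA; congr (_ * _).
  have ih : integ mu (fun eta => gauss (rVinv e) xi eta * h eta).
    by under eq_fun do rewrite mulrC; exact: integ_gaussM.
  rewrite -RintegralZl//; apply: eq_Rintegral => eta _.
  rewrite -mulrDr [RHS](_ : _ = h eta * (gauss_mass e * gauss (rVinv e) xi eta)); last by ring.
  congr (_ * _).
  (* The cosine and sine contributions recombine into cos((eta - xi).x), so that a single Gaussian
     transform remains. *)
  have [+ _] := gauss_transform 0 (eta - xi) e0.
  rewrite (rdotC _ 0) rdot0l cos0 mulr1 (gauss_sub _ xi) => <-.
  rewrite -RintegralD//; last 2 first.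
  - apply: (@integ_bound _ _ _ _ 1) => //; last by move=> x; exact: normr_cos_le1.
    by apply: measurableT_comp; [exact: measurable_cos|exact: measurable_rdot].
  - apply: (@integ_bound _ _ _ _ 1) => //; last by move=> x; exact: normr_sin_le1.
    by apply: measurableT_comp; [exact: measurable_sin|exact: measurable_rdot].
  by apply: eq_Rintegral => x _; rewrite rdotBl cosB; ring.
under eq_Rintegral do rewrite E.
rewrite RintegralZl//.
apply: eq_integrable (integZ (gauss_mass e)^-1 (integD I1 I2)) => // xi _.
by rewrite E mulKf// gt_eqF// gauss_mass_gt0.
Qed.

Lemma integ_gauss_conv f e : integ mu f -> (forall x, 0 <= f x) -> rVpos e ->
  integ mu (fun xi => \int[mu]_eta (gauss e xi eta * f eta)) /\
  \int[mu]_xi \int[mu]_eta (gauss e xi eta * f eta) = gauss_mass e * \int[mu]_x f x.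
Proof.
move=> fi f0 e0.
have mg2 : measurable_fun setT (fun p : Rn * Rn => gauss e p.1 p.2 * f p.2).
  apply: measurable_funM; last exact: (measurableT_comp (integ_meas fi) measurable_snd).
  under eq_fun do rewrite gauss_sub.
  apply: (measurableT_comp (measurable_gauss e 0)).
  apply: measurable_fun_rVP => i; under eq_fun do rewrite !mxE.
  apply: measurable_funB.
    exact: (measurableT_comp (measurable_rV_coord i) measurable_snd).
  exact: (measurableT_comp (measurable_rV_coord i) measurable_fst).
have gE x y : 0 <= gauss e x y by exact/ltW/gauss_gt0.
have i1 x : integ mu (fun eta => gauss e x eta * f eta).
  by under eq_fun do rewrite mulrC; exact: integ_gaussM.
have i2 y : integ mu (fun x => gauss e x y * f y).
  under eq_fun do rewrite mulrC gauss_sym; exact/integZ/integ_gauss.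
have E y : \int[mu]_x (gauss e x y * f y) = gauss_mass e * f y.
  transitivity (\int[mu]_x (f y * gauss e y x)).
    by apply: eq_Rintegral => x _; rewrite mulrC gauss_sym.
  by rewrite RintegralZl//; [rewrite Rintegral_gauss// mulrC|exact: integ_gauss].
have ip : integ (mu \x mu)%E (fun p : Rn * Rn => gauss e p.1 p.2 * f p.2).
  apply/integrable21ltyP; first exact/measurable_EFinP.
  under eq_integral => y _.
    under eq_integral => x _ do rewrite gee0_abs ?lee_fin ?mulr_ge0//=.
    rewrite -RintegralE//= E.
    over.
  rewrite -RintegralE ?ltry//; exact: integZ.
split; last first.
  rewrite (RFubini (f := fun x y => gauss e x y * f y))//.
  by under eq_Rintegral do rewrite E; rewrite RintegralZl.
apply: integ_lty.
- exact: (@measurable_Rintegral _ _ _ _ _ _ (fun p : Rn * Rn => gauss e p.1 p.2 * f p.2)).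
- by move=> x; apply: Rintegral_ge0 => y _; rewrite mulr_ge0.
- under eq_integral => x _ do rewrite RintegralE//.
  suff -> : (\int[mu]_x \int[mu]_y (gauss e x y * f y)%:E = \int[mu]_x
      `|fubini_F mu (fun p : Rn * Rn => (gauss e p.1 p.2 * f p.2)%:E) x|)%E.
    by have /integrableP[] := integrable_fubini_F ip.
  apply: eq_integral => x _; rewrite gee0_abs//.
  by apply: integral_ge0 => y _; rewrite lee_fin mulr_ge0.
Qed.

(** Schur's test: h(xi) h(eta) <= (h(xi)^2 + h(eta)^2) / 2 against a positive symmetric kernel,
    where each half integrates to half the kernel's mass times the integral of h^2. By
    [gauss_mass_inv] the bound does not depend on [e]. *)
Lemma plancherel_gauss h e : integ mu h -> integ mu (fun x => h x ^+ 2) -> rVpos e ->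
  \int[mu]_x ((costr h x ^+ 2 + sintr h x ^+ 2) * gauss e 0 x) <=
  (2 * pi) ^+ n * \int[mu]_x h x ^+ 2.
Proof.
move=> hi h2 e0; rewrite costr_sintr_gauss// -(gauss_mass_inv e0) -mulrA.
rewrite ler_wpM2l ?(ltW (gauss_mass_gt0 e0))//.
have e0' := rVinv_pos e0; set g := rVinv e in e0' *.
have [iQ EQ] := integ_gauss_conv h2 (fun x => sqr_ge0 (h x)) e0'.
have gE x y : 0 <= gauss g x y by exact/ltW/gauss_gt0.
have i1 x : integ mu (fun eta => gauss g x eta * h eta).
  by under eq_fun do rewrite mulrC; exact: integ_gaussM.
have i2 x : integ mu (fun eta => gauss g x eta * h eta ^+ 2).
  by under eq_fun do rewrite mulrC; exact: integ_gaussM.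
pose B xi := 2^-1 * (gauss_mass g * h xi ^+ 2) +
   2^-1 * \int[mu]_eta (gauss g xi eta * h eta ^+ 2).
have iB : integ mu B by apply: integD; apply: integZ => //; exact: integZ.
have -> : gauss_mass g * \int[mu]_x h x ^+ 2 = \int[mu]_xi B xi.
  rewrite RintegralD//; [|by apply: integZ; exact: integZ|exact: integZ].
  by rewrite !RintegralZl//; [rewrite EQ; field|exact: integZ].
have hB xi : `|h xi * \int[mu]_eta (gauss g xi eta * h eta)| <= B xi.
  rewrite -RintegralZl//; last exact: i1.
  have iM : integ mu (fun eta => h xi * (gauss g xi eta * h eta)) by exact: integZ.
  apply: le_trans (le_normr_Rintegral measurableT iM) _.
  have E1 : 2^-1 * (gauss_mass g * h xi ^+ 2) =
      \int[mu]_eta (2^-1 * h xi ^+ 2 * gauss g xi eta).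
    by rewrite RintegralZl ?integ_gauss// Rintegral_gauss//; ring.
  have E2 : 2^-1 * (\int[mu]_eta (gauss g xi eta * h eta ^+ 2)) =
      \int[mu]_eta (2^-1 * (gauss g xi eta * h eta ^+ 2)) by rewrite RintegralZl//; exact: i2.
  have j1 : integ mu (fun eta => 2^-1 * h xi ^+ 2 * gauss g xi eta).
    by apply: integZ; exact: integ_gauss.
  have j2 : integ mu (fun eta => 2^-1 * (gauss g xi eta * h eta ^+ 2)) by exact: integZ.
  rewrite /B E1 E2 -RintegralD//.
  apply: le_Rintegral => //; [exact: integ_norm|exact: integD|].
  move=> eta _; rewrite mulrCA normrM (ger0_norm (gE _ _)).
  rewrite [leRHS](_ : _ = gauss g xi eta * (2^-1 * (h xi ^+ 2 + h eta ^+ 2))); last by ring.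
  rewrite ler_wpM2l// normrM -(real_normK (num_real (h xi))) -(real_normK (num_real (h eta))).
  have := sqr_ge0 (`|h xi| - `|h eta|); lra.
apply: le_trans (ler_norm _) _.
have mP : measurable_fun setT (fun xi => h xi * \int[mu]_eta (gauss g xi eta * h eta)).
  apply: measurable_funM; first exact: (integ_meas hi).
  apply: (@measurable_Rintegral _ _ _ _ _ _ (fun p : Rn * Rn => gauss g p.1 p.2 * h p.2)).
  apply: measurable_funM; last exact: (measurableT_comp (integ_meas hi) measurable_snd).
  under eq_fun do rewrite gauss_sub.
  apply: (measurableT_comp (measurable_gauss g 0)).
  apply: measurable_fun_rVP => i; under eq_fun do rewrite !mxE.
  apply: measurable_funB.
    exact: (measurableT_comp (measurable_rV_coord i) measurable_snd).
  exact: (measurableT_comp (measurable_rV_coord i) measurable_fst).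
have iP := integ_le mP iB hB.
apply: le_trans (le_normr_Rintegral measurableT iP) _.
by apply: le_Rintegral => //; exact: integ_norm.
Qed.

Lemma cvg_gauss1_one : forall x,
  gauss (const_mx k.+1%:R^-1) 0 x @[k --> \oo] --> (1 : R).
Proof.
move=> x.
have -> : (fun k => gauss (const_mx k.+1%:R^-1) 0 x) =
    fun k => expR (- (k.+1%:R^-1 * (\sum_i (x ord0 i) ^+ 2 / 2))).
  apply/funext => k; rewrite mulr_sumr -sumrN expR_sum.
  by rewrite /gauss; apply: eq_bigr => i _; rewrite /gauss1 !mxE; congr (expR (- _)); ring.
set c := \sum_i _.
have H : k.+1%:R^-1 * c @[k --> \oo] --> 0 * c.
  by apply: cvgM; [exact: cvg_harmonic|exact: cvg_cst].
rewrite [X in _ --> X](_ : 1 = expR (- (0 * c))); last by rewrite mul0r oppr0 expR0.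
by apply: cvg_comp; [exact: cvgN H|exact: continuous_expR].
Qed.

(** The weight tends to 1 along e = 1 / (k + 1), and the weighted bound is uniform in e, so Fatou's
    lemma applies. *)
Lemma plancherel h : integ mu h -> integ mu (fun x => h x ^+ 2) ->
  (\int[mu]_x (costr h x ^+ 2 + sintr h x ^+ 2)%:E <=
   ((2 * pi) ^+ n * \int[mu]_x h x ^+ 2)%:E)%E.
Proof.
move=> hi h2.
have mcs : measurable_fun setT (fun x => costr h x ^+ 2 + sintr h x ^+ 2).
  apply: measurable_funD; apply: measurable_funX.
    by apply: measurable_costr; exact: integ_meas hi.
  by apply: measurable_sintr; exact: integ_meas hi.
have e0 k : rVpos (const_mx k.+1%:R^-1 : Rn) by move=> i; rewrite mxE invr_gt0.
apply: (@fatou_le _ _ _ mu (fun k x => (costr h x ^+ 2 + sintr h x ^+ 2) * gauss (const_mx k.+1%:R^-1) 0 x)).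
- by move=> k; apply: measurable_funM => //; exact: measurable_gauss.
- exact: mcs.
- by move=> k x; rewrite mulr_ge0// ?addr_ge0 ?sqr_ge0// ltW// gauss_gt0.
- apply/aeW => x; rewrite -[X in _ --> X]mulr1; apply: cvgM; first exact: cvg_cst.
  exact: cvg_gauss1_one.
- move=> k; rewrite -RintegralE ?lee_fin; first exact: plancherel_gauss.
  apply: (@integ_bound _ _ _ _ ((\int[mu]_xi `|h xi|) ^+ 2 + (\int[mu]_xi `|h xi|) ^+ 2)) => //.
    move=> x; rewrite ger0_norm ?addr_ge0 ?sqr_ge0//.
    have I0 : 0 <= \int[mu]_xi `|h xi| by apply: Rintegral_ge0.
    rewrite lerD// -[leLHS]real_normK ?num_real// lerXn2r ?nnegrE//.
      exact: costr_le.
    exact: sintr_le.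
  exact: integ_gauss.
Qed.

(** The factor 2 comes from (A - B)^2 <= 2 (A^2 + B^2) with A = [costr h1 x] and B = [sintr h2 x].
    Adding the squares of the two other transforms then allows [plancherel] to be used for [h1] and
    [h2] separately. *)
Lemma plancherel_retr h1 h2 : integ mu h1 -> integ mu h2 ->
  integ mu (fun x => h1 x ^+ 2 + h2 x ^+ 2) ->
  (\int[mu]_x (retr h1 h2 x ^+ 2)%:E <=
   (2 * (2 * pi) ^+ n * \int[mu]_x (h1 x ^+ 2 + h2 x ^+ 2))%:E)%E.
Proof.
move=> i1 i2 i12.
have i1s : integ mu (fun x => h1 x ^+ 2).
  apply: (integ_le _ i12); first by apply: measurable_funX; exact: integ_meas i1.
  by move=> x; rewrite ger0_norm ?sqr_ge0// lerDl sqr_ge0.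
have i2s : integ mu (fun x => h2 x ^+ 2).
  apply: (integ_le _ i12); first by apply: measurable_funX; exact: integ_meas i2.
  by move=> x; rewrite ger0_norm ?sqr_ge0// lerDr sqr_ge0.
have m1 : measurable_fun setT (fun x => (2 * (costr h1 x ^+ 2 + sintr h1 x ^+ 2))%:E).
  apply/measurable_EFinP; apply: measurable_funM => //.
  by apply: measurable_funD; apply: measurable_funX;
    [apply: measurable_costr; exact: integ_meas i1|apply: measurable_sintr; exact: integ_meas i1].
have m2 : measurable_fun setT (fun x => (2 * (costr h2 x ^+ 2 + sintr h2 x ^+ 2))%:E).
  apply/measurable_EFinP; apply: measurable_funM => //.
  by apply: measurable_funD; apply: measurable_funX;
    [apply: measurable_costr; exact: integ_meas i2|apply: measurable_sintr; exact: integ_meas i2].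
have p0 (h : Rn -> R) x : (0 <= (2 * (costr h x ^+ 2 + sintr h x ^+ 2))%:E)%E.
  by rewrite lee_fin mulr_ge0// addr_ge0// sqr_ge0.
apply: (@le_trans _ _ (\int[mu]_x ((2 * (costr h1 x ^+ 2 + sintr h1 x ^+ 2))%:E +
   (2 * (costr h2 x ^+ 2 + sintr h2 x ^+ 2))%:E))%E).
  apply: ge0_le_integral => //.
  - by move=> x _; rewrite lee_fin sqr_ge0.
  - apply/measurable_EFinP/measurable_funX.
    by apply: measurable_retr; [exact: integ_meas i1|exact: integ_meas i2].
  - exact: emeasurable_funD.
  - move=> x _; rewrite -EFinD lee_fin /retr.
    have := sqr_ge0 (costr h1 x + sintr h2 x).
    have := sqr_ge0 (sintr h1 x); have := sqr_ge0 (costr h2 x); nra.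
rewrite ge0_integralD//.
have Hc (c : R) h : 0 < c -> integ mu h -> integ mu (fun x => h x ^+ 2) ->
    (\int[mu]_x (c * (costr h x ^+ 2 + sintr h x ^+ 2))%:E <=
     (c * ((2 * pi) ^+ n * \int[mu]_x h x ^+ 2))%:E)%E.
  move=> c0 hi hi2; under eq_integral do rewrite EFinM.
  rewrite ge0_integralZl//; last 3 first.
  - apply/measurable_EFinP; apply: measurable_funD; apply: measurable_funX.
      by apply: measurable_costr; exact: integ_meas hi.
    by apply: measurable_sintr; exact: integ_meas hi.
  - by move=> x _; rewrite lee_fin addr_ge0// sqr_ge0.
  - by rewrite lee_fin ltW.
  by rewrite (EFinM c) lee_pmul2l ?lte_fin//; exact: plancherel.
rewrite RintegralD// -mulrA 2!mulrDr EFinD.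
by apply: leeD; exact: Hc.
Qed.

End transforms.

(** * Gaussians separate functions *)

Section cutoff.
Context {R : realType}.

Lemma expRN_le (x : R) : 0 <= x -> expR (- x) <= (1 + x)^-1.
Proof.
move=> x0; rewrite expRN lef_pV2 ?posrE ?expR_gt0 ?expR_ge1Dx//.
by rewrite ltr_pwDl.
Qed.

Lemma bernoulli_ge (x : R) (N : nat) : 0 <= x <= 1 -> 1 - N%:R * x <= (1 - x) ^+ N.
Proof.
move=> /andP[x0 x1]; elim: N => [|N IH]; first by rewrite mul0r subr0 expr0.
rewrite exprS; apply: le_trans (ler_wpM2l _ IH); last by rewrite subr_ge0.
rewrite -natr1; have : 0 <= N%:R :> R by []; move: (N%:R) => z z0; nra.
Qed.

(* With [q = expR (- a)], the exponents make these powers of [1 - q ^ (k.+1 ^ 2)]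
   converge boundedly to the indicator of [q < 1/2]. *)
Lemma cvg_cutoff (a : R) : 0 <= a ->
  (1 - expR (- (k.+1%:R ^+ 2 * a))) ^+ (2 ^ (k.+1 ^ 2 + k.+1)) @[k --> \oo]
    --> (if ln 2 < a then 1 else 0 : R).
Proof.
move=> a0; have l2 : 0 < ln 2 :> R by rewrite ln_gt0// ltr1n.
have e2 (K : nat) : (2 ^ K)%:R = expR (K%:R * ln 2) :> R.
  by rewrite natrX expRM_natl lnK// posrE.
have Y (k : nat) : 0 <= expR (- (k%:R ^+ 2 * a)) <= 1.
  rewrite expR_ge0/= -expR0 ler_expR oppr_le0 mulr_ge0// sqr_ge0.
case: ifPn => [la|].
- pose d := a - ln 2; have d0 : 0 < d by rewrite subr_gt0.
  apply: (@squeeze_cvgr _ _ _ _ (fun k => 1 - k.+1%:R^-1) (fun=> 1)); last 2 first.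
  + rewrite -[X in _ --> X]subr0; apply: cvgB; first exact: cvg_cst.
    exact: cvg_harmonic.
  + exact: cvg_cst.
  near=> k; have /andP[y0 y1] := Y k.+1.
  apply/andP; split; last by rewrite exprn_ile1 ?subr_ge0// gerBl.
  apply: le_trans (bernoulli_ge _ (Y k.+1)).
  (* With K = k + 1 and d = a - ln 2, the error term of Bernoulli's inequality is e^(-K (K d - ln
     2)), and K d >= 1 + ln 2 eventually. *)
  rewrite lerD2l lerN2 e2 -expRD natrD natrX.
  set K : R := k.+1%:R.
  have K1 : 1 <= K by rewrite /K ler1n.
  have Kd : 1 + ln 2 <= K * d.
    rewrite -ler_pdivrMr//; apply: (@le_trans _ _ k%:R); last by rewrite /K ler_nat.
    by near: k; exact: nbhs_infty_ger.
  apply: (@le_trans _ _ (expR (- K))).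
    rewrite ler_expR.
    have -> : (K ^+ 2 + K) * ln 2 - K ^+ 2 * a = - (K * (K * d - ln 2)) by rewrite /d; ring.
    rewrite lerN2 ler_peMr//; lra.
  apply: le_trans (expRN_le _) _; first by lra.
  by rewrite lef_pV2 ?posrE; lra.
- rewrite -leNgt => al.
  apply: (@squeeze_cvgr _ _ _ _ (fun=> 0) (fun k => k.+1%:R^-1)); last 2 first.
  + exact: cvg_cst.
  + exact: cvg_harmonic.
  apply: nearW => k; have /andP[y0 y1] := Y k.+1.
  apply/andP; split; first by rewrite exprn_ge0// subr_ge0.
  set K : R := k.+1%:R; have K1 : 1 <= K by rewrite /K ler1n.
  set y := expR _ in y0 y1 *.
  apply: (@le_trans _ _ (expR (- y) ^+ (2 ^ (k.+1 ^ 2 + k.+1)))).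
    rewrite lerXn2r ?nnegrE ?expR_ge0 ?subr_ge0//.
    exact: expR_ge1Dx.
  rewrite -expRM_natl e2 natrD natrX -/K.
  apply: (@le_trans _ _ (expR (- K))); last first.
    apply: le_trans (expRN_le _) _; first by lra.
    by rewrite lef_pV2 ?posrE; lra.
  rewrite ler_expR mulrN lerN2 /y -expRD.
  (* The extra [k.+1] in the exponent serves the boundary case a = ln 2: the power times e^(-K^2 a)
     is still at least 2^K >= K. *)
  apply: (@le_trans _ _ (expR (K * ln 2))).
    rewrite -e2 ler_nat; exact/ltnW/ltn_expl.
  rewrite ler_expR mulrDl addrAC lerDr -mulrBr mulr_ge0 ?sqr_ge0// subr_ge0//.
Unshelve. all: by end_near. Qed.

Lemma gauss1M (e m e' c x : R) : 0 < e -> 0 < e' ->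
  gauss1 e m x * gauss1 e' c x =
  gauss1 (e * e' / (e + e')) c m * gauss1 (e + e') ((e * m + e' * c) / (e + e')) x.
Proof.
move=> e0 e0'; rewrite /gauss1 -!expRD; congr expR; field.
by rewrite gt_eqF// addr_gt0.
Qed.

End cutoff.

Section uniqueness.
Context {R : realType} {n : nat}.
Local Notation Rn := 'rV[R]_n.
Local Notation mu := (@lebesgue_rV R n).
Implicit Types (psi : Rn -> R).

Variable v : Rn -> R.
Hypothesis mv : measurable_fun setT v.
Hypothesis iv : forall e m, rVpos e -> integ mu (fun x => v x * gauss e m x).
Hypothesis v0 : forall e m, rVpos e -> \int[mu]_x (v x * gauss e m x) = 0.

(* The class of multipliers that keep [v] orthogonal to all Gaussians is stable
   under multiplication by one-dimensional Gaussians, hence, by [cvg_cutoff] and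
   bounded limits, contains the indicators of boxes. *)
Let good psi := [/\ measurable_fun setT psi, exists c : R, forall x, `|psi x| <= c &
  forall e m, rVpos e -> \int[mu]_x (psi x * (v x * gauss e m x)) = 0].

Let good_integ psi e m : good psi -> rVpos e -> integ mu (fun x => psi x * (v x * gauss e m x)).
Proof. by move=> [mp [c pc] _] e0; apply: (@integ_bound _ _ _ _ c) => //; exact: iv. Qed.

Let good1 : good (fun=> 1).
Proof.
split=> //; first by exists 1 => x; rewrite normr1.
by move=> e m e0; under eq_Rintegral do rewrite mul1r; exact: v0.
Qed.

Let goodB psi1 psi2 : good psi1 -> good psi2 -> good (fun x => psi1 x - psi2 x).
Proof.
move=> g1 g2; have [m1 [c1 b1] h1] := g1; have [m2 [c2 b2] h2] := g2; split.
- exact: measurable_funB.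
- by exists (c1 + c2) => x; apply: le_trans (ler_normB _ _) _; exact: lerD.
- move=> e m e0; under eq_Rintegral do rewrite mulrBl.
  by rewrite RintegralB ?h1 ?h2 ?subrr//; exact: good_integ.
Qed.

(** The test Gaussian absorbs the new factor by [gauss1M]: up to a constant, their product is
    another Gaussian whose inverse variance and centre differ in coordinate [i] only. *)
Let good_gauss1 psi (e' c : R) i : 0 < e' -> good psi ->
  good (fun x => psi x * gauss1 e' c (x ord0 i)).
Proof.
move=> e0' gp; have [mp [C b] h] := gp; split.
- apply: measurable_funM => //.
  exact: (measurableT_comp (measurable_gauss1 _ _) (measurable_rV_coord i)).
- exists C => x; rewrite normrM; apply: le_trans (b x); rewrite ler_piMr//.
  by rewrite ger0_norm ?gauss1_le1// ltW// gauss1_gt0.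
move=> e m e0.
pose e2 : Rn := \row_j (if j == i then e ord0 j + e' else e ord0 j).
pose m2 : Rn := \row_j (if j == i then (e ord0 j * m ord0 j + e' * c) / (e ord0 j + e')
   else m ord0 j).
have e20 : rVpos e2.
  by move=> j; rewrite mxE; case: ifP => _; rewrite ?addr_gt0.
pose K := gauss1 (e ord0 i * e' / (e ord0 i + e')) c (m ord0 i).
have E x : gauss e m x * gauss1 e' c (x ord0 i) = K * gauss e2 m2 x.
  rewrite /gauss (bigD1 i)//= mulrAC gauss1M// [in RHS](bigD1 i)//= mulrA; congr (_ * _).
    by rewrite !mxE eqxx.
  by apply: eq_bigr => j ji; rewrite !mxE (negbTE ji).
transitivity (\int[mu]_x (K * (psi x * (v x * gauss e2 m2 x)))).
  apply: eq_Rintegral => x _.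
  transitivity (psi x * (v x * (gauss e m x * gauss1 e' c (x ord0 i)))); first by ring.
  by rewrite E (mulrCA (v x)) (mulrCA (psi x)).
by rewrite RintegralZl ?h ?mulr0//; exact: (good_integ m2 gp e20).
Qed.

Let good_lim (psi_ : nat -> Rn -> R) psi (c : R) : measurable_fun setT psi ->
  (forall k, good (psi_ k)) -> (forall k x, `|psi_ k x| <= c) ->
  (forall x, psi_ k x @[k --> \oo] --> psi x) -> good psi.
Proof.
move=> mp gp bp cp; split=> //.
  exists c => x; rewrite -[leLHS](cvg_lim _ (cvg_norm (cp x)))//.
  by apply: limr_le; [apply/cvg_ex; exists `|psi x|; exact: cvg_norm|exact: nearW].
move=> e m e0.
have [|||||_] := @Rint_dominated _ _ _ mu (fun k x => psi_ k x * (v x * gauss e m x))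
   (fun x => psi x * (v x * gauss e m x)) (fun x => c * `|v x * gauss e m x|).
- by move=> k; apply: integ_meas; exact: good_integ.
- by apply: measurable_funM => //; exact: integ_meas (iv m e0).
- by apply/aeW => x; apply: cvgM => //; exact: cvg_cst.
- by apply: integZ; apply: integ_norm; exact: iv.
- by apply/aeW => x k; rewrite normrM ler_wpM2r.
under eq_fun => k do have [_ _ ->] := gp k => //.
by move=> h; rewrite -(cvg_lim _ h)// lim_cst.
Qed.

(** Expanding one factor 1 - gauss1 at a time leaves a difference of two good multipliers. *)
Let good_cutoff psi (e' c : R) i (N : nat) : 0 < e' -> good psi ->
  good (fun x => psi x * (1 - gauss1 e' c (x ord0 i)) ^+ N).
Proof.
move=> e0' gp; elim: N => [|N IH].
  by under eq_fun do rewrite expr0 mulr1.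
have := goodB IH (good_gauss1 c i e0' IH).
rewrite (_ : (fun x => _ - _) = fun x => psi x * (1 - gauss1 e' c (x ord0 i)) ^+ N.+1)//.
by apply/funext => x; rewrite exprS; ring.
Qed.

Let mcoord_lt (c r : R) i : measurable_fun setT (fun x : Rn => (r < `|x ord0 i - c|)%R).
Proof.
apply: measurable_fun_ltr => //; apply: measurableT_comp => //.
by apply: measurable_funB => //; exact: measurable_rV_coord.
Qed.

Let mnat (P : Rn -> bool) : measurable_fun setT P -> measurable_fun setT (fun x => (P x)%:R : R).
Proof.
move=> mP; rewrite (_ : (fun x => _) = fun x => if P x then 1 else 0).
  exact: measurable_fun_ifT.
by apply/funext => x; case: (P x).
Qed.

Let good_out psi (c r : R) i : 0 < r -> good psi ->
  good (fun x => psi x * (r < `|x ord0 i - c|)%R%:R).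
Proof.
move=> r0 gp; have [mp [C b] _] := gp.
have l2 : 0 < ln 2 :> R by rewrite ln_gt0// ltr1n.
(* Chosen so that the Gaussian [gauss1 e' c] takes the value 1/2, the threshold of [cvg_cutoff],
   exactly at distance [r] from [c]. *)
pose e' : R := 2 * ln 2 / r ^+ 2.
have e0' : 0 < e' by rewrite divr_gt0 ?exprn_gt0// mulr_gt0.
have ek (k : nat) : 0 < k.+1%:R ^+ 2 * e' by rewrite mulr_gt0// exprn_gt0.
apply: (@good_lim (fun k x => psi x *
   (1 - gauss1 (k.+1%:R ^+ 2 * e') c (x ord0 i)) ^+ (2 ^ (k.+1 ^ 2 + k.+1))) _ C).
- by apply: measurable_funM => //; apply: mnat; exact: mcoord_lt.
- by move=> k; exact: good_cutoff.
- move=> k x; rewrite normrM; apply: le_trans (b x); rewrite ler_piMr// normrX.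
  have g0 := gauss1_gt0 (k.+1%:R ^+ 2 * e') c (x ord0 i).
  have g1 := gauss1_le1 c (x ord0 i) (ek k).
  by rewrite exprn_ile1// ger0_norm ?subr_ge0// gerBl ltW.
move=> x; apply: cvgM; first exact: cvg_cst.
pose a := e' * (x ord0 i - c) ^+ 2 / 2.
have a0 : 0 <= a by rewrite /a divr_ge0// mulr_ge0 ?sqr_ge0// ltW.
have := cvg_cutoff a0.
rewrite (_ : (fun k => _) = (fun k => (1 - gauss1 (k.+1%:R ^+ 2 * e') c (x ord0 i))
   ^+ (2 ^ (k.+1 ^ 2 + k.+1)))); last first.
  by apply/funext => k; rewrite /gauss1 /a !mulrA.
suff -> : (if ln 2 < a then 1 else 0) = (r < `|x ord0 i - c|)%R%:R :> R by [].
have -> : a = ln 2 * ((x ord0 i - c) ^+ 2 / r ^+ 2) by rewrite /a /e'; field; rewrite gt_eqF.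
rewrite ltr_pMr// ltr_pdivlMr ?exprn_gt0// mul1r -(real_normK (num_real (_ - c))).
by rewrite ltr_pXn2r// ?nnegrE ?(ltW r0)//; case: (r < _).
Qed.

(** The half-space is the limit of the slabs b <= x_i <= b + 2K, which are the complements of the
    sets |x_i - (b + K)| > K treated in [good_out]. *)
Let good_half psi (b : R) i : good psi -> good (fun x => psi x * (b <= x ord0 i)%R%:R).
Proof.
move=> gp; have [mp [C bC] _] := gp.
apply: (@good_lim (fun k x => psi x -
   psi x * (k.+1%:R < `|x ord0 i - (b + k.+1%:R)|)%R%:R) _ C).
- apply: measurable_funM => //; apply: mnat; apply: measurable_fun_ler => //.
  exact: measurable_rV_coord.
- by move=> k; apply: goodB => //; exact: good_out.
- move=> k x; rewrite -{1}(mulr1 (psi x)) -mulrBr normrM; apply: le_trans (bC x).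
  by rewrite ler_piMr//; case: (_ < _); rewrite ?subrr ?subr0 ?normr0 ?normr1.
move=> x; apply: cvg_near_cst; near=> k.
rewrite -{1}(mulr1 (psi x)) -mulrBr; congr (_ * _).
have Kx : `|x ord0 i - b| <= k%:R by near: k; exact: nbhs_infty_ger.
have Kx' : `|x ord0 i - b| < k.+1%:R by rewrite (le_lt_trans Kx)// ltr_nat.
have K0 : 0 <= k.+1%:R :> R by [].
case: (leP b (x ord0 i)) => [bx|bx].
- have -> : (k.+1%:R < `|x ord0 i - (b + k.+1%:R)|) = false; last by rewrite subr0.
  apply/negbTE; rewrite -leNgt ler_norml; move: Kx'; rewrite ltr_norml => /andP[_ h].
  by apply/andP; split; lra.
- have -> : (k.+1%:R < `|x ord0 i - (b + k.+1%:R)|) = true; last by rewrite subrr.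
  by rewrite ltr0_norm; lra.
Unshelve. all: by end_near. Qed.

(** Lists of half-space constraints make stability under intersection a concatenation and allow
    [good_box] to proceed by induction; the empty list is the whole space. *)
Let box (s : seq ('I_n * R)) : set Rn := [set x | all (fun p => p.2 <= x ord0 p.1) s].
Let boxes : set (set Rn) := [set A | exists s, A = box s].

Let good_box s : good (fun x => \1_(box s) x).
Proof.
elim: s => [|[i b] s IH].
  by rewrite (_ : (fun x => _) = (fun=> 1))//; apply/funext => x; rewrite indicE mem_set.
have := good_half b i IH.
rewrite (_ : (fun x => _ * _) = fun x => \1_(box ((i, b) :: s)) x)//.
apply/funext => x; rewrite !indicE -natrM mulnb; congr ((nat_of_bool _)%:R).
apply/idP/idP => [/andP[/set_mem h bx]|/set_mem/= /andP[bx h]].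
  by apply/mem_set; rewrite /box/= bx.
by apply/andP; split => //; exact/mem_set.
Qed.

Let boxesI : setI_closed boxes.
Proof.
move=> _ _ [s ->] [t ->]; exists (s ++ t); apply/seteqP; split => x; rewrite /box/= all_cat.
  by move=> [-> ->].
by move=> /andP[].
Qed.

Let measurable_box s : measurable (box s).
Proof.
have [mb _ _] := good_box s.
have := mb measurableT _ (measurable_set1 (1 : R)).
rewrite setTI (_ : _ @^-1` _ = box s)//.
apply/seteqP; split => x /=; rewrite indicE.
  by case: (boolP (x \in box s)) => [/set_mem//|_ /eqP]; rewrite eq_sym oner_eq0.
by move=> h; rewrite mem_set.
Qed.

(** The coordinates are measurable for the sigma-algebra generated by the boxes, because closed
    half-lines generate the Borel sets of R. *)
Let measurable_boxes : @measurable _ Rn = <<s boxes >>.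
Proof.
apply/seteqP; split; last first.
  apply: smallest_sub; first exact: sigma_algebra_measurable.
  by move=> _ [s ->]; exact: measurable_box.
have mid : measurable_fun setT (id : g_sigma_algebraType boxes -> Rn).
  apply: measurable_fun_rVP => i.
  apply: (measurability (@RGenCInfty.G R)) => [|_ [_ [r ->] <-]].
    exact: RGenCInfty.measurableE.
  apply: sub_sigma_algebra; exists [:: (i, r)]; rewrite setTI.
  apply/seteqP; split => x /=; rewrite /box/= in_itv/= andbT ?andbT//.
by move=> A mA; have := mid measurableT A mA; rewrite setTI preimage_id.
Qed.

(** Let w be [v] times a fixed Gaussian, which makes it integrable. Its integral vanishes over
    boxes, hence over every measurable set by Dynkin's theorem; the set where w >= 0 and its
    complement then show that the L^1 norm of w is zero. *)
Lemma gauss_orthogonal_ae0 : {ae mu, forall x, v x = 0}.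
Proof.
pose g := gauss (const_mx 1) 0 : Rn -> R.
have e1 : rVpos (const_mx 1 : Rn) by move=> i; rewrite mxE.
pose w x := v x * g x.
have iw : integ mu w by exact: iv.
have mw := integ_meas iw.
have iA A : measurable A -> integ mu (fun x => \1_A x * w x).
  move=> mA; apply: (@integ_bound _ _ _ _ 1) => // x.
  by rewrite indicE; case: (_ \in _); rewrite ?normr1 ?normr0.
have H A : measurable A -> \int[mu]_x (\1_A x * w x) = 0.
  move=> mA; have sA : <<s boxes >> A by rewrite -measurable_boxes.
  move: A sA {mA}.
  apply: (dynkin_induction (P := fun A => \int[mu]_x (\1_A x * w x) = 0) measurable_boxes boxesI).
  - rewrite -[RHS](v0 0 e1); apply: eq_Rintegral => x _.
    by rewrite indicE mem_set// mul1r.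
  - by move=> _ [s ->]; have [_ _ h] := good_box s; exact: h.
  - move=> S mS S0.
    transitivity (\int[mu]_x (w x - \1_S x * w x)).
      apply: eq_Rintegral => x _; rewrite !indicE in_setC.
      by case: (_ \in _); rewrite ?mul0r ?mul1r ?subrr ?subr0.
    by rewrite RintegralB ?S0 ?subr0//; [exact: v0|exact: iA].
  - move=> F mF tF F0.
    pose U k := \big[setU/set0]_(j < k) F j.
    have mU k : measurable (U k) by apply: bigsetU_measurable => j _.
    have [|||||_] := @Rint_dominated _ _ _ mu (fun k x => \1_(U k) x * w x)
      (fun x => \1_(\bigcup_k F k) x * w x) (fun x => `|w x|).
    + by move=> k; exact/integ_meas/iA.
    + by apply: integ_meas; apply: iA; exact: bigcup_measurable.
    + apply/aeW => x; apply: cvgM; last exact: cvg_cst.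
      apply: cvg_near_cst; case: (pselect ((\bigcup_k F k) x)) => [[j _ Fj]|nF].
        near=> k; rewrite !indicE !mem_set//; first by exists j.
        have jk : (j < k)%N by near: k; exact: nbhs_infty_gt.
        by rewrite /U -bigcup_mkord; exists j.
      apply: nearW => k; rewrite !indicE !memNset//.
      by rewrite /U -bigcup_mkord => -[j _ Fj]; apply: nF; exists j.
    + exact: integ_norm.
    + apply/aeW => x k; rewrite normrM ler_piMl// indicE.
      by case: (_ \in _); rewrite ?normr1 ?normr0.
    have E k : \int[mu]_x (\1_(U k) x * w x) = 0.
      elim: k => [|k IH].
        rewrite /U big_ord0; under eq_Rintegral do rewrite indic0 mul0r.
        by rewrite Rintegral_cst// mul0r.
      transitivity (\int[mu]_x (\1_(U k) x * w x + \1_(F k) x * w x)).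
        apply: eq_Rintegral => x _; rewrite -mulrDl; congr (_ * _).
        rewrite /U big_ord_recr/= -/(U k) !indicE in_setU.
        have : ~ (U k x /\ F k x).
          rewrite /U -bigcup_mkord => -[[j /= jk Fj] Fk].
          move/trivIsetP : tF => /(_ j k I I); rewrite neq_ltn jk => /(_ isT).
          by move/seteqP => [/(_ x) + _]; apply.
        move=> nUF; case: (boolP (x \in U k)) => [/set_mem xU|_]; last by rewrite add0r.
        case: (boolP (x \in F k)) => [/set_mem xF|_]; last by rewrite addr0.
        by exfalso; apply: nUF.
      by rewrite RintegralD ?IH ?F0 ?addr0//; exact: iA.
    under eq_fun do rewrite E.
    by move=> h; rewrite -(cvg_lim _ h)// lim_cst.
pose A := [set x | 0 <= w x].
have mA : measurable A.
  rewrite -[A]setTI; have := mw measurableT `[0, +oo[%classic (measurable_itv _).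
  rewrite (_ : w @^-1` _ = A)//; apply/seteqP; split=> x/=; rewrite in_itv/= andbT//.
have w0 : \int[mu]_x `|w x| = 0.
  transitivity (\int[mu]_x (\1_A x * w x - \1_(~` A) x * w x)).
    apply: eq_Rintegral => x _; rewrite !indicE in_setC.
    case: (boolP (x \in A)) => [/set_mem/= h|h]; rewrite ?mul1r ?mul0r ?subr0 ?sub0r.
      by rewrite ger0_norm.
    by rewrite ltr0_norm// ltNge; apply/negP => /mem_set; exact/negP.
  rewrite RintegralB//; [|exact: iA|by apply: iA; exact: measurableC].
  by rewrite !H ?subrr//; exact: measurableC.
have : (\int[mu]_x `|(w x)%:E| = 0)%E.
  by rewrite -[LHS]/(\int[mu]_x (`|w x|)%:E)%E -RintegralE ?w0//; exact: integ_norm.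
have mEw : measurable_fun setT (fun x => (w x)%:E) by exact/measurable_EFinP.
move=> /(ae_eq_integral_abs mu measurableT mEw).1.
apply: filterS => x /(_ I) /= [] /eqP; rewrite mulf_eq0 => /orP[/eqP//|].
by rewrite gt_eqF// gauss_gt0.
Unshelve. all: by end_near. Qed.

End uniqueness.

(** * Almost everywhere bounds from summable integrals *)

Section summable.
Context {d} {T : measurableType d} {R : realType} (mu : {measure set T -> \bar R}).

(** By Tonelli the sum of the series is integrable, hence finite almost everywhere; [B] is the set
    where it is finite, and [w] is the sum made real-valued. The integrable majorant [w] is what
    later permits dominated convergence in [L2_bound]. *)
Lemma ae_series_bound (F : nat -> T -> R) (c : nat -> R) (C : R) :
  (forall j, measurable_fun setT (F j)) -> (forall j x, 0 <= F j x) ->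
  (forall j, (\int[mu]_x (F j x)%:E <= (c j)%:E)%E) ->
  (forall N, \sum_(j < N) c j <= C) ->
  exists B : set T, exists w : T -> R,
  [/\ measurable B, {ae mu, forall x, B x}, integ mu w, forall x, 0 <= w x &
    forall x, B x -> forall N, \sum_(j < N) F j x <= w x].
Proof.
move=> mF F0 Fc cC.
pose W x := (\sum_(0 <= j <oo) (F j x)%:E)%E.
have F0E j x : (0 <= (F j x)%:E)%E by rewrite lee_fin.
have mEF j : measurable_fun setT (fun x => (F j x)%:E) by exact/measurable_EFinP.
have W0 x : (0 <= W x)%E by apply: nneseries_ge0.
have mW : measurable_fun setT W by apply: (ge0_emeasurable_sum (P := xpredT)).
have iW : (\int[mu]_x W x <= C%:E)%E.
  rewrite integral_nneseries//; apply: lime_le.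
    by apply: is_cvg_nneseries => k _ _; apply: integral_ge0.
  apply: nearW => N; rewrite big_mkord.
  apply: (@le_trans _ _ (\sum_(j < N) (c j)%:E)%E); first exact: lee_sum.
  by rewrite sumEFin lee_fin.
have WI : mu.-integrable setT W.
  apply/integrableP; split=> //.
  under eq_integral do rewrite gee0_abs//.
  by apply: le_lt_trans iW _; rewrite ltry.
exists (W @^-1` (~` [set +oo%E])), (fine \o W); split.
- rewrite -[X in measurable X]setTI; apply: mW => //.
  by apply: measurableC; exact: emeasurable_set1.
- apply: filterS (integrable_ae measurableT WI) => x /(_ I) h /= Wx.
  by move: h; rewrite Wx.
- apply: integ_lty.
  + exact: measurableT_comp.
  + by move=> x /=; rewrite fine_ge0.
  + apply: le_lt_trans (ltry C); apply: le_trans iW.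
    apply: ge0_le_integral => //.
    * by move=> x _ /=; rewrite lee_fin fine_ge0.
    * by apply/measurable_EFinP; exact: measurableT_comp.
    * by move=> x _ /=; case: (W x) (W0 x).
- by move=> x /=; rewrite fine_ge0.
- move=> x /= Wx N.
  have fW : W x \is a fin_num by rewrite ge0_fin_numE// ltey; apply/eqP.
  rewrite -lee_fin fineK// -sumEFin -(big_mkord xpredT (fun j => (F j x)%:E)).
  exact: nneseries_lim_ge.
Qed.

Lemma ae_series_cvg0 (F : nat -> T -> R) (c : nat -> R) (C : R) :
  (forall j, measurable_fun setT (F j)) -> (forall j x, 0 <= F j x) ->
  (forall j, (\int[mu]_x (F j x)%:E <= (c j)%:E)%E) ->
  (forall N, \sum_(j < N) c j <= C) ->
  {ae mu, forall x, F j x @[j --> \oo] --> 0}.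
Proof.
move=> mF F0 Fc cC; have [B [w [mB aB _ _ Bw]]] := ae_series_bound mF F0 Fc cC.
apply: filterS aB => x Bx; apply: cvg_series_cvg_0.
apply: nondecreasing_is_cvgn.
  apply/nondecreasing_seqP => n; rewrite /series/= !big_mkord big_ord_recr/=.
  by rewrite lerDl.
exists (w x) => _ [n _ <-]; rewrite /series/= big_mkord; exact: Bw.
Qed.

End summable.

(** * The L2 bound for Gaussian-tested transforms *)

Section L2_bound.
Context {R : realType} {n : nat}.
Local Notation Rn := 'rV[R]_n.
Local Notation mu := (@lebesgue_rV R n).

Variables (v h1 h2 : Rn -> R).
Hypotheses (mv : measurable_fun setT v)
  (m1 : measurable_fun setT h1) (m2 : measurable_fun setT h2).
Let H x := h1 x ^+ 2 + h2 x ^+ 2.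
Hypothesis iH : integ mu H.
Hypothesis iv : forall e m, rVpos e -> integ mu (fun x => v x * gauss e m x).
Hypothesis vh : ftrel v h1 h2.

Let H0 x : 0 <= H x. Proof. by rewrite addr_ge0 ?sqr_ge0. Qed.

(* [h1 + i h2] is approximated by its restriction to [H >= 1 / (M + 1)], which is
   integrable. *)
Let chi (M : nat) x : R := (M.+1%:R^-1 <= H x)%R%:R.

Let chi01 M x : 0 <= chi M x <= 1.
Proof. by rewrite /chi; case: (M.+1%:R^-1 <= H x); rewrite ?lexx ?ler01. Qed.

Let chi2 M x : chi M x ^+ 2 = chi M x.
Proof. by rewrite /chi; case: (_ <= _); rewrite ?expr1n ?expr0n. Qed.

Let mH : measurable_fun setT H := integ_meas iH.

Let mchi M : measurable_fun setT (chi M).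
Proof.
rewrite (_ : chi M = fun x => if M.+1%:R^-1 <= H x then 1 else 0).
  by apply: measurable_fun_ifT => //; exact: measurable_fun_ler.
by apply/funext => x; rewrite /chi; case: (_ <= _).
Qed.

Let cvg_chi x : H x != 0 -> chi M x @[M --> \oo] --> (1 : R).
Proof.
move=> Hx; have {Hx} Hx : 0 < H x by rewrite lt_neqAle eq_sym Hx H0.
apply: cvg_near_cst; near=> M; rewrite /chi (_ : _ <= _)//.
rewrite -[leRHS]invrK lef_pV2 ?posrE ?invr_gt0//.
apply: (@le_trans _ _ M%:R); last by rewrite ler_nat.
by near: M; exact: nbhs_infty_ger.
Unshelve. all: by end_near. Qed.

(** Where H >= 1 / K with K = M + 1 >= 1, one has K H >= 1 and so H <= (K H)^2. This is how
    truncation makes a square-integrable function integrable. *)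
Let sq_le (h : Rn -> R) M x : h x ^+ 2 <= H x -> `|chi M x * h x| <= M.+1%:R * H x.
Proof.
move=> hH; rewrite /chi; case: (leP M.+1%:R^-1 (H x)) => [MH|_]; last first.
  by rewrite mul0r normr0 mulr_ge0.
rewrite mul1r; set K : R := M.+1%:R in MH *.
have K1 : 1 <= K by rewrite /K ler1n.
have KH : 1 <= K * H x by rewrite -ler_pdivrMl ?mulr1//; lra.
rewrite -(@ler_pXn2r _ 2) ?nnegrE ?mulr_ge0//.
rewrite real_normK ?num_real//; apply: le_trans hH _.
rewrite expr2; have := H0 x; nra.
Qed.

Let i1 M : integ mu (fun x => chi M x * h1 x).
Proof.
apply: (@integ_le _ _ _ _ _ (fun x => M.+1%:R * H x)).
- exact: measurable_funM.
- exact: integZ.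
- by move=> x; apply: sq_le; rewrite lerDl sqr_ge0.
Qed.

Let i2 M : integ mu (fun x => chi M x * h2 x).
Proof.
apply: (@integ_le _ _ _ _ _ (fun x => M.+1%:R * H x)).
- exact: measurable_funM.
- exact: integZ.
- by move=> x; apply: sq_le; rewrite lerDr sqr_ge0.
Qed.

Let iHchi M : integ mu (fun x => (1 - chi M x) * H x).
Proof.
apply: (@integ_bound _ _ _ _ 1) => //; first exact: measurable_funB.
by move=> x; have /andP[] := chi01 M x => a b; rewrite ger0_norm; lra.
Qed.

Let cvgHchi : \int[mu]_x ((1 - chi M x) * H x) @[M --> \oo] --> 0.
Proof.
have [|||||_] := @Rint_dominated _ _ _ mu (fun M x => (1 - chi M x) * H x) (fun=> 0) H.
- by move=> M; exact: integ_meas (iHchi M).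
- by [].
- apply/aeW => x; have [->|Hx] := eqVneq (H x) 0.
    by under eq_fun do rewrite mulr0; exact: cvg_cst.
  rewrite -(mul0r (H x)); apply: cvgM; last exact: cvg_cst.
  by rewrite -(subrr 1); apply: cvgB; [exact: cvg_cst|exact: cvg_chi].
- exact: iH.
- apply/aeW => x M; rewrite normrM (ger0_norm (H0 x)) ler_piMl//.
  by have /andP[] := chi01 M x => a b; rewrite ger0_norm; lra.
by rewrite Rintegral_cst// mul0r.
Qed.

(** The condition j <= M j makes the truncation levels tend to infinity; the rate 4^-j leaves room
    for a weight 2^j in [L2_bound]. *)
Let subseqM : exists M : nat -> nat, forall j, (j <= M j)%N /\
  \int[mu]_x ((1 - chi (M j) x) * H x) <= 4^-1 ^+ j.
Proof.
suff /boolp.choice[M hM] : forall j, exists M, (j <= M)%N /\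
    \int[mu]_x ((1 - chi M x) * H x) <= 4^-1 ^+ j by exists M.
move=> j.
have e0 : 0 < 4^-1 ^+ j :> R by rewrite exprn_gt0.
have := cvgHchi => /cvgrPdist_le /(_ _ e0) [N _ hN].
exists (maxn j N); split; first exact: leq_maxl.
have := hN (maxn j N) (leq_maxr _ _); rewrite sub0r normrN.
by apply: le_trans; rewrite ler_norm.
Qed.

(** As in Riesz-Fischer, the transforms [f j] of the truncations converge almost everywhere along a
    fast subsequence. The limit has the same Gaussian integrals as [v], hence equals [v] almost
    everywhere, and Fatou's lemma transfers the uniform Plancherel bound of the [f j] to [v]. *)
Lemma L2_bound : (\int[mu]_x (v x ^+ 2)%:E <=
   (2 * (2 * pi) ^+ n * \int[mu]_x (h1 x ^+ 2 + h2 x ^+ 2))%:E)%E.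
Proof.
have q4 (z : R) : 0 <= z -> 4^-1 * z + z <= 2 * z by move=> z0; lra.
have [M MP] := subseqM.
pose f j x := retr (fun xi => chi (M j) xi * h1 xi) (fun xi => chi (M j) xi * h2 xi) x.
have mf j : measurable_fun setT (f j).
  by apply: measurable_retr; exact: measurable_funM.
pose K : R := 2 * (2 * pi) ^+ n.
have K0 : 0 <= K by rewrite mulr_ge0// exprn_ge0// mulr_ge0// ltW// pi_gt0.
(* The squared norms of the differences decay like 4^-j, so the weight 2^j keeps the integrals
   summable; it is needed to control the differences themselves and not only their squares. *)
pose F j x := 2 ^+ j * (f j.+1 x - f j x) ^+ 2.
have mF j : measurable_fun setT (F j).
  by apply: measurable_funM => //; apply: measurable_funX; exact: measurable_funB.
have F0 j x : 0 <= F j x by rewrite mulr_ge0 ?sqr_ge0.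
have fB j x : f j.+1 x - f j x =
    retr (fun xi => chi (M j.+1) xi * h1 xi - chi (M j) xi * h1 xi)
         (fun xi => chi (M j.+1) xi * h2 xi - chi (M j) xi * h2 xi) x.
  by rewrite /f retrB.
have Fc j : (\int[mu]_x (F j x)%:E <= ((K * 2) * 2^-1 ^+ j)%:E)%E.
  under eq_integral do rewrite /F EFinM.
  rewrite ge0_integralZl//; last 2 first.
  - by apply/measurable_EFinP; apply: measurable_funX; exact: measurable_funB.
  - by move=> x _; rewrite lee_fin sqr_ge0.
  under eq_integral do rewrite fB.
  set d1 := (fun xi => chi (M j.+1) xi * h1 xi - chi (M j) xi * h1 xi).
  set d2 := (fun xi => chi (M j.+1) xi * h2 xi - chi (M j) xi * h2 xi).
  have dE x : d1 x ^+ 2 + d2 x ^+ 2 = (chi (M j.+1) x - chi (M j) x) ^+ 2 * H x.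
    by rewrite /d1 /d2 /H; ring.
  pose b x : R := (1 - chi (M j.+1) x) * H x + (1 - chi (M j) x) * H x.
  have ib : integ mu b by exact: integD.
  have db x : d1 x ^+ 2 + d2 x ^+ 2 <= b x.
    rewrite dE /b -mulrDl ler_wpM2r//.
    by rewrite sqrrB !chi2; have /andP[] := chi01 (M j) x; have /andP[] := chi01 (M j.+1) x; nra.
  have id : integ mu (fun x => d1 x ^+ 2 + d2 x ^+ 2).
    apply: integ_le ib _ => [|x].
      by apply: measurable_funD; apply: measurable_funX; apply: measurable_funB;
        exact: measurable_funM.
    by rewrite ger0_norm// addr_ge0// sqr_ge0.
  have P := plancherel_retr (integB (i1 _) (i1 _)) (integB (i2 _) (i2 _)) id.
  have Ib : \int[mu]_x (d1 x ^+ 2 + d2 x ^+ 2) <= 2 * 4^-1 ^+ j.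
    apply: (@le_trans _ _ (\int[mu]_x b x)); first exact: le_Rintegral.
    rewrite /b (RintegralD measurableT (iHchi _) (iHchi _)); have [_ a1] := MP j; have [_ a2] := MP j.+1.
    apply: le_trans (lerD a2 a1) _; rewrite exprS.
    exact: q4.
  apply: (@le_trans _ _ ((2 ^+ j)%:E * (K * (2 * 4^-1 ^+ j))%:E)%E).
    by rewrite lee_pmul2l ?lte_fin ?exprn_gt0//; apply: le_trans P _;
      rewrite lee_fin ler_wpM2l.
  rewrite -EFinM lee_fin.
  have -> : (4^-1 : R) = 2^-1 * 2^-1 by field.
  rewrite exprMn; have -> : 2 ^+ j * (K * (2 * (2^-1 ^+ j * 2^-1 ^+ j))) =
     K * 2 * 2^-1 ^+ j * (2 ^+ j * 2^-1 ^+ j) by ring.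
  by rewrite -exprMn divff// expr1n mulr1.
have geo N : \sum_(j < N) 2^-1 ^+ j = 2 - 2 * 2^-1 ^+ N :> R.
  elim: N => [|N IH]; first by rewrite big_ord0 expr0; ring.
  by rewrite big_ord_recr/= IH exprS; field.
have geo2 N : \sum_(j < N) 2^-1 ^+ j <= 2 :> R.
  by rewrite geo gerBl mulr_ge0.
have cC N : \sum_(j < N) K * 2 * 2^-1 ^+ j <= K * 2 * 2.
  by rewrite -mulr_sumr ler_wpM2l// mulr_ge0.
have [B [w [mB aB iw w0 Bw]]] := ae_series_bound mF F0 Fc cC.
(* AM-GM in the form |d| <= (2^j d^2 + 2^-j) / 2. Summed over j it bounds the total variation of the
   sequence by (w + 2) / 2 on [B]. *)
have AB j x : `|f j.+1 x - f j x| <= 2^-1 * (F j x + 2^-1 ^+ j).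
  rewrite /F -(real_normK (num_real (f j.+1 x - f j x))).
  move: `|_| => r; set p : R := 2 ^+ j; set q : R := 2^-1 ^+ j.
  have pq : p * q = 1 by rewrite -exprMn divff// expr1n.
  have q0 : 0 <= q by rewrite exprn_ge0.
  have : 0 <= q * (p * r - 1) ^+ 2 by rewrite mulr_ge0 ?sqr_ge0.
  have -> : q * (p * r - 1) ^+ 2 = (p * q) * (p * r ^+ 2) - 2 * ((p * q) * r) + q by ring.
  rewrite pq; lra.
have SB N x : B x -> \sum_(j < N) `|f j.+1 x - f j x| <= 2^-1 * (w x + 2).
  move=> Bx; apply: (@le_trans _ _ (\sum_(j < N) (2^-1 * (F j x + 2^-1 ^+ j)))).
    by apply: ler_sum => j _; exact: AB.
  by rewrite -mulr_sumr ler_wpM2l// big_split/= (lerD (Bw _ Bx _) (geo2 _)).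
have fE N x : f N x = f 0%N x + \sum_(j < N) (f j.+1 x - f j x).
  by rewrite -(big_mkord xpredT (fun j => f j.+1 x - f j x)) telescope_sumr// addrC subrK.
have fN N x : B x -> `|f N x| <= `|f 0%N x| + 2^-1 * (w x + 2).
  move=> Bx; rewrite fE; apply: le_trans (ler_normD _ _) _; rewrite lerD2l.
  by apply: le_trans (SB N x Bx); exact: ler_norm_sum.
have cB x : B x -> cvgn (fun j => f j x).
  move=> Bx; rewrite (_ : (fun j => f j x) = fun j => f 0%N x + series (fun j => f j.+1 x - f j x) j).
    apply: is_cvgD; first exact: is_cvg_cst.
    apply: normed_cvg.
    rewrite [X in cvgn X](_ : _ = fun k => \sum_(j < k) `|f j.+1 x - f j x|); last first.
      by apply/funext => k; rewrite -(big_mkord xpredT (fun j => `|f j.+1 x - f j x|)).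
    apply: nondecreasing_is_cvgn.
      by apply/nondecreasing_seqP => k; rewrite big_ord_recr/= lerDl.
    by exists (2^-1 * (w x + 2)) => _ [k _ <-]; exact: SB.
  by apply/funext => j; rewrite fE /series/= big_mkord.
(* The indicator of [B] makes the sequence converge everywhere, hence to a measurable limit, and
   changes no integral since [B] has full measure. *)
pose v' x := limn (fun j => f j x * \1_B x).
have cv' x : f j x * \1_B x @[j --> \oo] --> v' x.
  have [Bx|nBx] := pselect (B x).
    apply: is_cvgM; first exact: cB.
    exact: is_cvg_cst.
  rewrite /v' (_ : (fun j => f j x * \1_B x) = fun=> 0) ?lim_cst//; first exact: cvg_cst.
  by apply/funext => j; rewrite indicE memNset// mulr0.
have mfB j : measurable_fun setT (fun x => f j x * \1_B x).
  by apply: measurable_funM => //; exact: measurable_indic.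
have mv' : measurable_fun setT v' by apply: (measurable_fun_cvg mfB) => x _; exact: cv'.
have w2 x : 0 <= 2^-1 * (w x + 2) by rewrite mulr_ge0// addr_ge0.
have fBN N x : `|f N x * \1_B x| <= `|f 0%N x| + 2^-1 * (w x + 2).
  rewrite normrM indicE; case: (boolP (x \in B)) => [/set_mem Bx|_].
    by rewrite normr1 mulr1 fN.
  by rewrite normr0 mulr0 addr_ge0.
have lim e m : rVpos e -> integ mu (fun x => v' x * gauss e m x) /\
    \int[mu]_x (f j x * \1_B x * gauss e m x) @[j --> \oo] --> \int[mu]_x (v' x * gauss e m x).
  move=> e0; apply: (@Rint_dominated _ _ _ mu (fun j x => f j x * \1_B x * gauss e m x) _
    (fun x => (`|f 0%N x| + 2^-1 * (w x + 2)) * gauss e m x)).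
  - by move=> j; apply: measurable_funM => //; exact: measurable_gauss.
  - by apply: measurable_funM => //; exact: measurable_gauss.
  - by apply/aeW => x; apply: cvgM; [exact: cv'|exact: cvg_cst].
  - under eq_fun do rewrite mulrDl -mulrA mulrDl.
    apply: integD.
      have := integ_norm (integ_retr_gauss m (i1 (M 0%N)) (i2 (M 0%N)) e0).
      by apply: eq_integrable => // x _; rewrite normrM (ger0_norm (ltW (gauss_gt0 _ _ _))).
    apply: integZ; apply: integD; last exact/integZ/integ_gauss.
    exact: integ_gaussM.
  - apply/aeW => x j; rewrite normrM (ger0_norm (ltW (gauss_gt0 _ _ _))).
    by rewrite ler_wpM2r// ltW// gauss_gt0.
have aeB (g1 : Rn -> R) j : measurable_fun setT g1 ->
    \int[mu]_x (f j x * \1_B x * g1 x) = \int[mu]_x (f j x * g1 x).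
  move=> mg; rewrite /Rintegral; congr fine; apply: ae_eq_integral => //.
  - by apply/measurable_EFinP; exact: measurable_funM.
  - by apply/measurable_EFinP; exact: measurable_funM.
  - by apply: filterS aB => x Bx _; rewrite indicE mem_set// mulr1.
have iHg e : rVpos e -> integ mu (fun x => (1 + H x) * gauss e 0 x).
  move=> e0; under eq_fun do rewrite mulrDl mul1r.
  by apply: integD; [exact: integ_gauss|exact: integ_gaussM].
have hle x : `|h1 x| + `|h2 x| <= 1 + H x.
  rewrite /H -(real_normK (num_real (h1 x))) -(real_normK (num_real (h2 x))).
  have := sqr_ge0 (`|h1 x| - 1); have := sqr_ge0 (`|h2 x| - 1).
  have := sqr_ge0 (`|h1 x|); have := sqr_ge0 (`|h2 x|); nra.
(* On the frequency side (1 + H) times a Gaussian dominates the truncated data, so the Gaussian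
   integrals of the [f j] converge to the expression that [ftrel] attaches to [v]. *)
have lim2 e m : rVpos e -> \int[mu]_x (v' x * gauss e m x) = \int[mu]_x (v x * gauss e m x).
  move=> e0; have [_ c1] := lim e m e0.
  have : \int[mu]_x (f j x * \1_B x * gauss e m x) @[j --> \oo] -->
      \int[mu]_x (v x * gauss e m x).
    rewrite vh//.
    rewrite (_ : (fun j => _) = fun j => gauss_mass e * \int[mu]_xi
      ((cos (rdot xi m) * (chi (M j) xi * h1 xi) - sin (rdot xi m) * (chi (M j) xi * h2 xi)) *
       gauss (rVinv e) 0 xi)); last first.
      by apply/funext => j; rewrite aeB ?ftrel_retr//; exact: measurable_gauss.
    apply: cvgM; first exact: cvg_cst.
    have mk (h1' h2' : Rn -> R) : measurable_fun setT h1' -> measurable_fun setT h2' ->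
       measurable_fun setT (fun xi => (cos (rdot xi m) * h1' xi - sin (rdot xi m) * h2' xi) *
       gauss (rVinv e) 0 xi).
      move=> q1 q2; apply: measurable_funM; last exact: measurable_gauss.
      apply: measurable_funB; apply: measurable_funM => //.
        exact: measurable_cos_rdot.
      exact: measurable_sin_rdot.
    apply: (@Rint_dominated _ _ _ mu (fun j xi => (cos (rdot xi m) * (chi (M j) xi * h1 xi) -
        sin (rdot xi m) * (chi (M j) xi * h2 xi)) * gauss (rVinv e) 0 xi) _
        (fun xi => (1 + H xi) * gauss (rVinv e) 0 xi) _ _ _ _ _).2.
    - by move=> j; apply: mk; exact: measurable_funM.
    - exact: mk.
    - apply/aeW => xi; apply: cvgM; last exact: cvg_cst.
      have [Hx|Hx] := eqVneq (H xi) 0.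
        have z1 : h1 xi = 0.
          by apply/eqP; rewrite -sqrf_eq0 eq_le sqr_ge0 andbT -Hx lerDl sqr_ge0.
        have z2 : h2 xi = 0.
          by apply/eqP; rewrite -sqrf_eq0 eq_le sqr_ge0 andbT -Hx lerDr sqr_ge0.
        by rewrite z1 z2; under eq_fun do rewrite !mulr0; rewrite !mulr0; exact: cvg_cst.
      have cc : chi (M j) xi @[j --> \oo] --> (1 : R).
        apply: (cvg_comp M (chi^~ xi)); last exact: cvg_chi.
        by apply/cvgnyPge => N; near=> j; apply: (@leq_trans j);
          [near: j; exact: nbhs_infty_ge|have [] := MP j].
      have z (h : Rn -> R) : chi (M j) xi * h xi @[j --> \oo] --> h xi.
        by rewrite -[X in _ --> X]mul1r; apply: cvgM => //; exact: cvg_cst.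
      by apply: cvgB; apply: cvgM; try exact: cvg_cst; exact: z.
    - by apply: iHg; exact: rVinv_pos.
    - apply/aeW => xi j; rewrite normrM (ger0_norm (ltW (gauss_gt0 _ _ _))).
      rewrite ler_wpM2r ?(ltW (gauss_gt0 _ _ _))//.
      apply: le_trans (hle xi); apply: le_trans (ler_normB _ _) _.
      have /andP[a b] := chi01 (M j) xi.
      by rewrite !normrM (ger0_norm a) lerD// mulrA ler_piMl// mulr_ile1//
        ?normr_cos_le1 ?normr_sin_le1.
  by move=> c2; rewrite -(cvg_lim _ c1)// (cvg_lim _ c2).
have vv' : {ae mu, forall x, v x - v' x = 0}.
  apply: gauss_orthogonal_ae0.
  - move=> e m e0; under eq_fun do rewrite mulrBl.
    by apply: integB; [exact: iv|have [] := lim e m e0].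
  - move=> e m e0; under eq_Rintegral do rewrite mulrBl.
    by rewrite RintegralB ?lim2 ?subrr//; [exact: iv|have [] := lim e m e0].
apply: (@fatou_le _ _ _ mu (fun j x => f j x ^+ 2)).
- by move=> j; exact: measurable_funX.
- exact: measurable_funX.
- by move=> j x; exact: sqr_ge0.
- apply: filterS2 aB vv' => x Bx /eqP; rewrite subr_eq0 => /eqP ->.
  have := cv' x; under eq_fun do rewrite indicE mem_set// mulr1.
  by move=> c; rewrite expr2; under eq_fun do rewrite expr2; exact: cvgM.
- move=> j.
  have hH x : (chi (M j) x * h1 x) ^+ 2 + (chi (M j) x * h2 x) ^+ 2 = chi (M j) x * H x.
    by rewrite !exprMn chi2 mulrDr.
  have iHc : integ mu (fun x => chi (M j) x * H x).
    apply: (@integ_bound _ _ _ _ 1) => // x.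
    by have /andP[a b] := chi01 (M j) x; rewrite ger0_norm.
  have P := @plancherel_retr _ _ _ _ (i1 (M j)) (i2 (M j)).
  under [X in (_ <= (_ * X)%:E)%E]eq_Rintegral do rewrite -/(H _).
  apply: le_trans (P _) _; first by under eq_fun do rewrite hH.
  rewrite lee_fin ler_wpM2l//; apply: le_Rintegral => //.
    by under eq_fun do rewrite hH.
  by move=> x _; rewrite hH ler_piMl//; have /andP[] := chi01 (M j) x.
Unshelve. all: by end_near. Qed.

End L2_bound.

(** * The dyadic sum behind the frequency cutoff, and auxiliary facts *)

Section prelim.
Context {R : realType}.

(** The sum is geometric and starts at the first l with 2^l >= rho, so it is at most of order
    rho^-2. The induction shifts l by one and replaces rho by rho / 2; the plain bound is carried
    along for the case rho <= 1, where the term l = 0 is present. *)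
Lemma sum_dyadic_cutoff (rho : R) (N : nat) : 0 < rho ->
  \sum_(l < N) (4^-1 ^+ l * (rho <= 2 ^+ l)%R%:R : R) <= 2 /\
  (\sum_(l < N) (4^-1 ^+ l * (rho <= 2 ^+ l)%R%:R : R)) * rho ^+ 2 <= 2.
Proof.
elim: N rho => [|N IH] rho rho0; first by rewrite !big_ord0 mul0r.
have [IH1 IH2] := IH (rho / 2) (divr_gt0 rho0 (ltr0Sn R 1)).
rewrite big_ord_recl/= expr0 mul1r.
have -> : \sum_(i < N) (4^-1 ^+ bump 0 i * (rho <= 2 ^+ bump 0 i)%R%:R : R) =
    4^-1 * \sum_(l < N) (4^-1 ^+ l * (rho / 2 <= 2 ^+ l)%R%:R : R).
  rewrite mulr_sumr; apply: eq_bigr => i _.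
  by rewrite /bump/= add1n !exprS mulrA ler_pdivrMr// (mulrC 2).
move: IH1 IH2; set S := \sum_(l < N) _ => IH1 IH2.
rewrite expr0; have [r1|r1] := leP rho 1.
  split; rewrite ?mulr1n; first lra.
  have : rho ^+ 2 <= 1 by rewrite expr_le1// ltW.
  have := sqr_ge0 rho; have : 0 <= S by apply: sumr_ge0 => i _; rewrite mulr_ge0.
  nra.
rewrite mulr0n add0r; split; first lra.
apply: le_trans IH2; rewrite le_eqVlt; apply/orP; left; apply/eqP; by field.
Qed.

Lemma measurable_enorm n : measurable_fun setT (@enorm R n).
Proof.
have ms : measurable_fun setT (@Num.sqrt R).
  by apply: continuous_measurable_fun; exact: sqrt_continuous.
apply: (measurableT_comp ms).
by apply: measurable_sum => i; apply: measurable_funM; exact: measurable_rV_coord.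
Qed.

Lemma enorm_ge0 n (x : 'rV[R]_n) : 0 <= enorm x.
Proof. exact: sqrtr_ge0. Qed.

Lemma enorm_sqr n (x : 'rV[R]_n) : enorm x ^+ 2 = \sum_i x ord0 i ^+ 2.
Proof.
by rewrite /enorm sqr_sqrtr /rdot; [|apply: sumr_ge0 => i _]; rewrite ?sqr_ge0//;
  under eq_bigr do rewrite -expr2.
Qed.

Lemma gauss_enorm n (x : 'rV[R]_n) : gauss (const_mx 1) 0 x = expR (- (enorm x ^+ 2 / 2)).
Proof.
rewrite enorm_sqr mulr_suml -sumrN expR_sum /gauss; apply: eq_bigr => i _.
by rewrite /gauss1 !mxE subr0 mul1r.
Qed.

(** As 0 < gauss <= 1, the product |h| gauss is at most gauss + h^2. *)
Lemma integ_sqr_gauss n (h : 'rV[R]_n -> R) e m : measurable_fun setT h ->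
  integ (lebesgue_rV n) (fun x => h x ^+ 2) -> rVpos e ->
  integ (lebesgue_rV n) (fun x => h x * gauss e m x).
Proof.
move=> mh ih e0.
apply: (@integ_le _ _ _ _ _ (fun x => gauss e m x + h x ^+ 2)).
- by apply: measurable_funM => //; exact: measurable_gauss.
- by apply: integD => //; exact: integ_gauss.
- move=> x; rewrite normrM (ger0_norm (ltW (gauss_gt0 e m x))).
  have := gauss_le1 m x e0; have := ltW (gauss_gt0 e m x).
  move: (gauss e m x) => g g0 g1; rewrite -(real_normK (num_real (h x))).
  have := normr_ge0 (h x); move: `|h x| => z z0; have := sqr_ge0 (z - 1); nra.
Qed.

Lemma ftrelB n (v v' h1 h2 h1' h2' : 'rV[R]_n -> R) :
  ftrel v h1 h2 -> ftrel v' h1' h2' ->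
  (forall e m, rVpos e -> integ (lebesgue_rV n) (fun x => v x * gauss e m x)) ->
  (forall e m, rVpos e -> integ (lebesgue_rV n) (fun x => v' x * gauss e m x)) ->
  (forall e m, rVpos e -> integ (lebesgue_rV n) (fun x => h1 x * gauss e m x)) ->
  (forall e m, rVpos e -> integ (lebesgue_rV n) (fun x => h2 x * gauss e m x)) ->
  (forall e m, rVpos e -> integ (lebesgue_rV n) (fun x => h1' x * gauss e m x)) ->
  (forall e m, rVpos e -> integ (lebesgue_rV n) (fun x => h2' x * gauss e m x)) ->
  ftrel (fun x => v x - v' x) (fun x => h1 x - h1' x) (fun x => h2 x - h2' x).
Proof.
move=> f f' iv iv' i1 i2 i1' i2' e m e0.
have e0' := rVinv_pos e0.
have J k1 k2 : (forall e m, rVpos e -> integ (lebesgue_rV n) (fun x => k1 x * gauss e m x)) ->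
    (forall e m, rVpos e -> integ (lebesgue_rV n) (fun x => k2 x * gauss e m x)) ->
    integ (lebesgue_rV n) (fun xi => (cos (rdot xi m) * k1 xi - sin (rdot xi m) * k2 xi) * gauss (rVinv e) 0 xi).
  move=> j1 j2; under eq_fun do rewrite mulrBl -!mulrA.
  by apply: integB; [apply: integ_cosM; exact: j1|apply: integ_sinM; exact: j2].
have H1 := RintegralB measurableT (iv e m e0) (iv' e m e0).
have H2 := RintegralB measurableT (J _ _ i1 i2) (J _ _ i1' i2').
under eq_Rintegral do rewrite mulrBl.
rewrite H1 f// f'// -mulrBr -H2; congr (_ * _).
by apply: eq_Rintegral => xi _; ring.
Qed.

Lemma cos_sub1_sin (x : R) : (cos x - 1) ^+ 2 + sin x ^+ 2 <= 4.
Proof. by have := cos2Dsin2 x; have := cos_geN1 x; rewrite sqrrB; lra. Qed.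

End prelim.

(** * Almost everywhere convergence of the flow *)

Section flow.
Context {R : realType} {n : nat}.
Local Notation Rn := 'rV[R]_n.
Local Notation mu := (@lebesgue_rV R n).
Local Notation leb := (@lebesgue_measure R).

Variables (a s : R) (g1 g2 : Rn -> R).
Hypotheses (a1 : 1 < a) (s0 : 0 < s) (s1 : s <= 1 / 2).
Hypotheses (mg1 : measurable_fun setT g1) (mg2 : measurable_fun setT g2).

Let G x := g1 x ^+ 2 + g2 x ^+ 2.
Let W (x : Rn) := (1 + enorm x ^+ 2) `^ s.
Hypothesis iWG : integ mu (fun x => W x * G x).

Let lam x := @enorm R n x `^ a.
Let rho x := @enorm R n x `^ (a - s).

(* real and imaginary parts of e^{i tau |xi|^a} (g1 + i g2) *)
Definition flowr (tau : R) x : R := cos (tau * lam x) * g1 x - sin (tau * lam x) * g2 x.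
Definition flowi (tau : R) x : R := sin (tau * lam x) * g1 x + cos (tau * lam x) * g2 x.

Let G0 x : 0 <= G x. Proof. by rewrite addr_ge0 ?sqr_ge0. Qed.

Let W1 x : 1 <= W x.
Proof.
have e : (1 : R) `^ s = 1 by rewrite powR1.
rewrite /W -[leLHS]e ge0_ler_powR ?nnegrE//; first exact: ltW.
  by rewrite addr_ge0// sqr_ge0.
by rewrite lerDl sqr_ge0.
Qed.

Let mlam : measurable_fun setT lam.
Proof. by apply: (measurableT_comp (measurable_powR a)); exact: measurable_enorm. Qed.

Let mrho : measurable_fun setT rho.
Proof. by apply: (measurableT_comp (measurable_powR (a - s))); exact: measurable_enorm. Qed.

Let mW : measurable_fun setT W.
Proof.
apply: (measurableT_comp (measurable_powR s)); apply: measurable_funD => //.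
by apply: measurable_funX; exact: measurable_enorm.
Qed.

Let mG : measurable_fun setT G.
Proof. by apply: measurable_funD; apply: measurable_funX. Qed.

Let iG : integ mu G.
Proof.
apply: integ_le mG iWG _ => x.
by rewrite ger0_norm// ler_peMl.
Qed.

Let as0 : 0 < a - s. Proof. by move: a1 s1 => h1 h2; lra. Qed.

Let lam0 x : 0 <= lam x. Proof. exact: powR_ge0. Qed.

Let flow_sqr tau x : flowr tau x ^+ 2 + flowi tau x ^+ 2 = G x.
Proof.
rewrite /flowr /flowi /G.
transitivity ((cos (tau * lam x) ^+ 2 + sin (tau * lam x) ^+ 2) * (g1 x ^+ 2 + g2 x ^+ 2)).
  by ring.
by rewrite cos2Dsin2 mul1r.
Qed.

Let mflow : measurable_fun setT (fun z : R * Rn => flowr z.1 z.2) /\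
  measurable_fun setT (fun z : R * Rn => flowi z.1 z.2).
Proof.
have mt : measurable_fun setT (fun z : R * Rn => z.1 * lam z.2).
  by apply: measurable_funM => //; exact: (measurableT_comp mlam measurable_snd).
have mc : measurable_fun setT (fun z : R * Rn => cos (z.1 * lam z.2)).
  exact: (measurableT_comp measurable_cos mt).
have ms : measurable_fun setT (fun z : R * Rn => sin (z.1 * lam z.2)).
  exact: (measurableT_comp measurable_sin mt).
have m1 : measurable_fun setT (fun z : R * Rn => g1 z.2).
  exact: (measurableT_comp mg1 measurable_snd).
have m2 : measurable_fun setT (fun z : R * Rn => g2 z.2).
  exact: (measurableT_comp mg2 measurable_snd).
by split; [apply: measurable_funB|apply: measurable_funD]; exact: measurable_funM.
Qed.

Let mflowr tau : measurable_fun setT (flowr tau).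
Proof. exact: (measurableT_comp mflow.1 (measurable_pair1 tau)). Qed.

Let mflowi tau : measurable_fun setT (flowi tau).
Proof. exact: (measurableT_comp mflow.2 (measurable_pair1 tau)). Qed.

Let kap (l : nat) x : R := (rho x <= 2 ^+ l)%R%:R.

Let mkap l : measurable_fun setT (kap l).
Proof.
rewrite (_ : kap l = fun x => if rho x <= 2 ^+ l then 1 else 0).
  by apply: measurable_fun_ifT => //; exact: measurable_fun_ler.
by apply/funext => x; rewrite /kap; case: (_ <= _).
Qed.

Let kap2 l x : kap l x ^+ 2 = kap l x.
Proof. by rewrite /kap; case: (_ <= _); rewrite ?expr1n ?expr0n. Qed.

Let kap01 l x : 0 <= kap l x <= 1.
Proof. by rewrite /kap; case: (rho x <= _); rewrite ?lexx ?ler01. Qed.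

Let kap_enorm l : exists2 r : R, 0 <= r & forall x, kap l x != 0 -> enorm x <= r.
Proof.
exists ((2 ^+ l) `^ (a - s)^-1); first exact: powR_ge0.
move=> x; rewrite /kap; case: leP; rewrite ?eqxx// => h _.
have E : enorm x = enorm x `^ ((a - s) * (a - s)^-1).
  by rewrite mulfV ?gt_eqF// powRr1// enorm_ge0.
rewrite E powRrM ge0_ler_powR ?nnegrE ?invr_ge0 ?powR_ge0 ?exprn_ge0// ltW//.
Qed.

(** A majorant, uniform in time, of the low-frequency data (up to a factor 2) and of their time
    derivative; the summand [lam x] accounts for the derivative. *)
Let D l x := kap l x * (1 + lam x) * (`|g1 x| + `|g2 x|).

Let D0 l x : 0 <= D l x.
Proof. by rewrite !mulr_ge0 ?addr_ge0//; have /andP[] := kap01 l x. Qed.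

Let iD l : integ mu (D l).
Proof.
have [r r0 hr] := kap_enorm l.
have ig : integ mu (gauss (const_mx 1) (0 : Rn)).
  by apply: integ_gauss => i; rewrite mxE.
(* The function e^(r^2 / 2) e^(-|x|^2 / 2) is at least 1 on the ball |x| <= r that supports [kap l],
   and serves as an integrable majorant of its indicator; then |g1| + |g2| <= 1 + G. *)
apply: (@integ_le _ _ _ mu _ (fun x => (1 + r `^ a) *
   (expR (r ^+ 2 / 2) * gauss (const_mx 1) (0 : Rn) x + W x * G x))).
- apply: measurable_funM; last by apply: measurable_funD; apply: measurableT_comp.
  by apply: measurable_funM => //; exact: measurable_funD.
- by apply: integZ; apply: integD => //; exact: integZ.
move=> x; rewrite ger0_norm//.
have WG0 : 0 <= W x * G x by rewrite mulr_ge0// (le_trans ler01 (W1 x)).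
have gg0 := ltW (gauss_gt0 (const_mx 1) (0 : Rn) x).
have [k0|k0] := eqVneq (kap l x) 0.
  by rewrite /D k0 !mul0r mulr_ge0// addr_ge0 ?powR_ge0// mulr_ge0// expR_ge0.
have xr := hr x k0.
have /andP[kx0 kx1] := kap01 l x.
apply: ler_pM.
- by rewrite mulr_ge0// addr_ge0.
- by rewrite addr_ge0.
- rewrite -[leRHS]mul1r; apply: ler_pM => //; first by rewrite addr_ge0.
  by rewrite lerD2l ge0_ler_powR ?nnegrE ?enorm_ge0//; move: a1 => h; lra.
apply: (@le_trans _ _ (1 + G x)).
  rewrite /G -(real_normK (num_real (g1 x))) -(real_normK (num_real (g2 x))).
  have := sqr_ge0 (`|g1 x| - 1); have := sqr_ge0 (`|g2 x| - 1).
  have := sqr_ge0 `|g1 x|; have := sqr_ge0 `|g2 x|; nra.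
apply: lerD; last by rewrite ler_peMl.
rewrite gauss_enorm -expRD -expR0 ler_expR subr_ge0 ler_wpM2r//.
by rewrite lerXn2r ?nnegrE ?enorm_ge0.
Qed.

Let flow_le tau x : `|flowr tau x| <= `|g1 x| + `|g2 x| /\ `|flowi tau x| <= `|g1 x| + `|g2 x|.
Proof.
split; [apply: le_trans (ler_normB _ _) _|apply: le_trans (ler_normD _ _) _];
 by rewrite !normrM lerD// ler_piMl// ?normr_cos_le1 ?normr_sin_le1.
Qed.

(** Differentiating e^(i tau lam) multiplies by i lam, which exchanges real and imaginary parts:
    [dr] and [di] are the time derivatives of [lowr] and [lowi] below. *)
Let dr l tau x := - (kap l x * lam x * flowi tau x).
Let di l tau x := kap l x * lam x * flowr tau x.

Let dr_le l tau x : `|dr l tau x| <= D l x.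
Proof.
have /andP[k0 _] := kap01 l x.
rewrite /dr /D normrN !normrM (ger0_norm k0) (ger0_norm (lam0 x)).
by rewrite ler_pM ?mulr_ge0//; [rewrite ler_wpM2l// lerDr|have [] := flow_le tau x].
Qed.

Let di_le l tau x : `|di l tau x| <= D l x.
Proof.
have /andP[k0 _] := kap01 l x.
rewrite /di /D !normrM (ger0_norm k0) (ger0_norm (lam0 x)).
by rewrite ler_pM ?mulr_ge0//; [rewrite ler_wpM2l// lerDr|have [] := flow_le tau x].
Qed.

Let mdr l : measurable_fun setT (fun z : R * Rn => dr l z.1 z.2).
Proof.
apply: measurableT_comp => //; apply: measurable_funM; last exact: mflow.2.
by apply: measurable_funM; [exact: (measurableT_comp (mkap l) measurable_snd)|
  exact: (measurableT_comp mlam measurable_snd)].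
Qed.

Let mdi l : measurable_fun setT (fun z : R * Rn => di l z.1 z.2).
Proof.
apply: measurable_funM; last exact: mflow.1.
by apply: measurable_funM; [exact: (measurableT_comp (mkap l) measurable_snd)|
  exact: (measurableT_comp mlam measurable_snd)].
Qed.

Let idr l tau : integ mu (dr l tau).
Proof.
apply: integ_le (iD l) (dr_le l tau).
exact: (measurableT_comp (mdr l) (measurable_pair1 tau)).
Qed.

Let idi l tau : integ mu (di l tau).
Proof.
apply: integ_le (iD l) (di_le l tau).
exact: (measurableT_comp (mdi l) (measurable_pair1 tau)).
Qed.

Let lowr l tau x := kap l x * (flowr tau x - g1 x).
Let lowi l tau x := kap l x * (flowi tau x - g2 x).

Let ilow l tau : integ mu (lowr l tau) /\ integ mu (lowi l tau).
Proof.
have k0 x : 0 <= kap l x by have /andP[] := kap01 l x.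
split; apply: (@integ_le _ _ _ mu _ (fun x => 2 * D l x)).
- by apply: measurable_funM => //; exact: measurable_funB.
- by apply: integZ; exact: iD.
- move=> x; rewrite normrM (ger0_norm (k0 x)) /D.
  have h : `|flowr tau x - g1 x| <= 2 * ((1 + lam x) * (`|g1 x| + `|g2 x|)).
    apply: le_trans (ler_normB _ _) _; have [+ _] := flow_le tau x.
    have := lam0 x; have := normr_ge0 (g1 x); have := normr_ge0 (g2 x); nra.
  by apply: le_trans (ler_wpM2l (k0 x) h) _; rewrite mulrCA -!mulrA.
- by apply: measurable_funM => //; exact: measurable_funB.
- by apply: integZ; exact: iD.
- move=> x; rewrite normrM (ger0_norm (k0 x)) /D.
  have h : `|flowi tau x - g2 x| <= 2 * ((1 + lam x) * (`|g1 x| + `|g2 x|)).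
    apply: le_trans (ler_normB _ _) _; have [_ +] := flow_le tau x.
    have := lam0 x; have := normr_ge0 (g1 x); have := normr_ge0 (g2 x); nra.
  by apply: le_trans (ler_wpM2l (k0 x) h) _; rewrite mulrCA -!mulrA.
Qed.

Let low l tau x := retr (lowr l tau) (lowi l tau) x.
Let B l tau x := retr (dr l tau) (di l tau) x.

Let mB l : measurable_fun setT (fun z : R * Rn => B l z.1 z.2).
Proof.
have msw : measurable_fun setT (fun z : (R * Rn) * Rn => (z.1.1, z.2)).
  apply/measurable_fun_pairP; split; last exact: measurable_snd.
  exact: (measurableT_comp measurable_fst measurable_fst).
have mdot : measurable_fun setT (fun z : (R * Rn) * Rn => rdot z.2 z.1.2).
  have ms2 : measurable_fun setT (fun z : (R * Rn) * Rn => (z.2, z.1.2)).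
    apply/measurable_fun_pairP; split; first exact: measurable_snd.
    exact: (measurableT_comp measurable_snd measurable_fst).
  exact: (measurableT_comp (@measurable_rdot2 R n) ms2).
apply: measurable_funB.
- apply: (@measurable_Rintegral _ _ _ _ _ mu (fun z : (R * Rn) * Rn =>
    cos (rdot z.2 z.1.2) * dr l z.1.1 z.2)).
  apply: measurable_funM; first exact: (measurableT_comp measurable_cos mdot).
  exact: (measurableT_comp (mdr l) msw).
- apply: (@measurable_Rintegral _ _ _ _ _ mu (fun z : (R * Rn) * Rn =>
    sin (rdot z.2 z.1.2) * di l z.1.1 z.2)).
  apply: measurable_funM; first exact: (measurableT_comp measurable_sin mdot).
  exact: (measurableT_comp (mdi l) msw).
Qed.

Let mB1 l x : measurable_fun setT (fun tau : R => B l tau x).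
Proof. exact: (measurableT_comp (mB l) (measurable_pair2 x)). Qed.

Let B_le l tau x : `|B l tau x| <= 2 * \int[mu]_y D l y.
Proof.
rewrite /B /retr; apply: le_trans (ler_normB _ _) _.
rewrite mulr_natl mulr2n; apply: lerD.
  apply: le_trans (costr_le x (idr l tau)) _.
  by apply: le_Rintegral; [by []|exact: (integ_norm (idr l tau))|exact: iD|move=> y _; exact: dr_le].
apply: le_trans (sintr_le x (idi l tau)) _.
by apply: le_Rintegral; [by []|exact: (integ_norm (idi l tau))|exact: iD|move=> y _; exact: di_le].
Qed.

Let iI (t : R) : integ leb (\1_(`[0, t]%classic : set R)).
Proof.
apply: integ_lty.
- by apply: measurable_indic; exact: measurable_itv.
- by move=> x; rewrite indicE.
rewrite integral_indic ?setIT//=.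
by rewrite lebesgue_measure_itv/=; case: ifP => _; rewrite -?EFinB ltry.
Qed.

(** At a fixed frequency the integrand of [low] vanishes at time 0, hence is the integral of its
    time derivative; Fubini, with majorant 2 D on [0, t], takes the time integral outside. *)
Let lowE l (t : R) x : 0 < t -> low l t x =
  \int[leb]_tau (\1_(`[0, t]%classic : set R) tau * B l tau x).
Proof.
move=> t0; set I := \1_(`[0, t]%classic : set R).
have [il1 il2] := ilow l t.
pose J tau xi := cos (rdot xi x) * dr l tau xi - sin (rdot xi x) * di l tau xi.
have BJ tau : B l tau x = \int[mu]_xi J tau xi.
  by rewrite /J (RintegralB measurableT (integ_cosM x (idr l tau)) (integ_sinM x (idi l tau))).
have J_le tau xi : `|J tau xi| <= 2 * D l xi.
  have hc (u w : R) : `|u| <= 1 -> `|u * w| <= `|w| by move=> u1; rewrite normrM ler_piMl.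
  apply: le_trans (ler_normB _ _) _; rewrite mulr_natl mulr2n.
  apply: lerD; first exact: le_trans (hc _ _ (normr_cos_le1 _)) (dr_le l tau xi).
  exact: le_trans (hc _ _ (normr_sin_le1 _)) (di_le l tau xi).
have mJ : measurable_fun setT (fun z : R * Rn => J z.1 z.2).
  apply: measurable_funB; apply: measurable_funM => //.
    exact: (measurableT_comp (measurable_cos_rdot x) measurable_snd).
  exact: (measurableT_comp (measurable_sin_rdot x) measurable_snd).
have I0 tau : 0 <= I tau by rewrite /I indicE.
have I1 tau : I tau <= 1 by rewrite /I indicE; case: (_ \in _).
have mI : measurable_fun setT I by exact: (integ_meas (iI t)).
transitivity (\int[mu]_xi \int[leb]_tau (I tau * J tau xi)); last first.
  transitivity (\int[leb]_tau \int[mu]_xi (I tau * J tau xi)); last first.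
    apply: eq_Rintegral => tau _; rewrite RintegralZl//; first by rewrite BJ.
    apply: (integB (integ_cosM x (idr l tau)) (integ_sinM x (idi l tau))).
  apply/esym; apply: (@RFubini _ _ _ _ R leb mu (fun tau xi => I tau * J tau xi)).
  - apply: (@integ_le _ _ R (leb \x mu)%E _ (fun z => I z.1 * (2 * D l z.2))).
    + by apply: measurable_funM => //; exact: (measurableT_comp mI measurable_fst).
    + exact: (@integ_prod _ _ _ _ R leb mu I (fun xi => 2 * D l xi) (iI t) (integZ 2 (iD l))).
    + by move=> z; rewrite normrM (ger0_norm (I0 _)) ler_wpM2l.
  - move=> tau; apply: integZ.
    exact: (integB (integ_cosM x (idr l tau)) (integ_sinM x (idi l tau))).
  - move=> xi; apply: (@integ_le _ _ R leb _ (fun tau => (2 * D l xi) * I tau)).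
    + by apply: measurable_funM => //; exact: (measurableT_comp mJ (measurable_pair2 xi)).
    + by apply: integZ; exact: iI.
    + by move=> tau; rewrite normrM (ger0_norm (I0 _)) mulrC ler_wpM2r.
rewrite /low /retr /costr /sintr.
rewrite -(RintegralB measurableT (integ_cosM x il1) (integ_sinM x il2)).
apply: eq_Rintegral => xi _.
pose Phi tau := cos (rdot xi x) * lowr l tau xi - sin (rdot xi x) * lowi l tau xi.
have dPhi (tau : R) : is_derive tau 1 Phi (J tau xi).
  rewrite /Phi /J /lowr /lowi /flowr /flowi /dr /di /flowr /flowi.
  by apply: trigger_derive; rewrite /GRing.scale/=; ring.
have Phi0 : Phi 0 = 0.
  by rewrite /Phi /lowr /lowi /flowr /flowi !mul0r cos0 sin0; ring.
have cPhi (tau : R) : {for tau, continuous Phi}.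
  by apply: differentiable_continuous; apply/derivable1_diffP; exact: ex_derive.
under [RHS]eq_Rintegral do rewrite mulrC.
rewrite /I Rintegral_indicr /Rintegral (@continuous_FTC2 _ (J^~ xi) Phi)//.
- by rewrite Phi0 sube0.
- apply: continuous_subspaceT => tau; rewrite /J /dr /di /flowr /flowi.
  apply: differentiable_continuous; apply/derivable1_diffP.
  exact: ex_derive.
- split.
  + by move=> y _; exact: ex_derive.
  + by apply: cvg_at_right_filter; exact: cPhi.
  + by apply: cvg_at_left_filter; exact: cPhi.
- by move=> y _; rewrite derive1E; exact: derive_val.
Qed.

Let X l x := 2^-1 ^+ l * \int[leb]_tau (\1_(`[0, 2^-1 ^+ l]%classic : set R) tau * B l tau x ^+ 2).

Let iB2 l x (t : R) : integ leb (fun tau => \1_(`[0, t]%classic : set R) tau * B l tau x ^+ 2).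
Proof.
have C0 : 0 <= 2 * \int[mu]_y D l y by rewrite mulr_ge0// Rintegral_ge0.
apply: (@integ_le _ _ R leb _ (fun tau => (2 * \int[mu]_y D l y) ^+ 2 * \1_(`[0, t]%classic : set R) tau)).
- apply: measurable_funM; first exact: (integ_meas (iI t)).
  by apply: measurable_funX; exact: mB1.
- by apply: integZ; exact: iI.
- move=> tau; rewrite mulrC normrM [`|\1__ _|]ger0_norm ?indicE// ler_wpM2r//.
  rewrite normrX lerXn2r ?nnegrE//.
Qed.

(* AM-GM: |B| <= eta / (2 r) + (r / (2 eta)) B^2 on [0, r], with r = 2^-l. *)
Let low_le l (t : R) x (eta : R) : 0 < t <= 2^-1 ^+ l -> 0 < eta -> X l x <= eta ^+ 2 ->
  `|low l t x| <= eta.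
Proof.
move=> /andP[t0 tl] eta0 Xe; rewrite lowE//.
set r : R := 2^-1 ^+ l in tl Xe *.
have r0 : 0 < r by rewrite exprn_gt0.
have iIB (t' : R) : integ leb (fun tau => \1_(`[0, t']%classic : set R) tau * B l tau x).
  under eq_fun do rewrite mulrC.
  apply: (@integ_bound _ _ R leb (2 * \int[mu]_y D l y) (fun tau => B l tau x)).
    - exact: mB1.
    - by move=> tau; exact: B_le.
    - exact: iI.
apply: le_trans (le_normr_Rintegral measurableT (iIB t)) _.
pose b tau := (eta / (2 * r)) * \1_(`[0, r]%classic : set R) tau +
  (r / (2 * eta)) * (\1_(`[0, r]%classic : set R) tau * B l tau x ^+ 2).
have ib : integ leb b by apply: integD; apply: integZ.
apply: (@le_trans _ _ (\int[leb]_tau b tau)).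
  apply: le_Rintegral => //; first exact: integ_norm.
  move=> tau _; rewrite normrM [`|\1__ _|]ger0_norm ?indicE//.
  rewrite /b !indicE.
  have [h|_] := boolP (tau \in _); last first.
    rewrite mul0r; apply: addr_ge0.
      by apply: mulr_ge0; [apply: divr_ge0; [exact: ltW|exact: mulr_ge0 (ltW r0)]|rewrite ler0n].
    apply: mulr_ge0; first by apply: divr_ge0; [exact: ltW|exact: mulr_ge0 (ltW eta0)].
    by apply: mulr_ge0; [rewrite ler0n|exact: sqr_ge0].
  have -> : tau \in (`[0, r]%classic : set R).
    move: h; rewrite !inE/= !in_itv/= => /andP[-> h]; exact: le_trans h tl.
  rewrite mul1r !mulr1n mulr1 mul1r -(real_normK (num_real (B l tau x))).
  move: `|B l tau x| => z.
  rewrite -subr_ge0.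
  have -> : eta / (2 * r) + r / (2 * eta) * z ^+ 2 - z = (r * z - eta) ^+ 2 / (2 * eta * r).
    by field; rewrite !gt_eqF.
  by rewrite divr_ge0 ?sqr_ge0// !mulr_ge0// ltW.
rewrite /b RintegralD//; [|by apply: integZ; exact: iI|by apply: integZ].
rewrite !RintegralZl//; [|exact: iB2|exact: iI].
have -> : \int[leb]_tau \1_(`[0, r]%classic : set R) tau = r.
  under eq_Rintegral do rewrite -[\1__ _]mul1r.
  rewrite Rintegral_indicr Rintegral_cst//= lebesgue_measure_itv/= lte_fin r0.
  by rewrite -EFinB/= subr0 mul1r.
have -> : eta / (2 * r) * r = eta / 2 by field; rewrite gt_eqF.
have : (r / (2 * eta)) * (\int[leb]_tau (\1_(`[0, r]%classic : set R) tau * B l tau x ^+ 2))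
    <= eta / 2.
  rewrite mulrAC ler_pdivrMr ?mulr_gt0//.
  by apply: le_trans Xe _; rewrite le_eqVlt; apply/orP; left; apply/eqP; field.
lra.
Qed.

Let K0 : R := 2 * (2 * pi) ^+ n.

Let K0_ge0 : 0 <= K0.
Proof. by rewrite /K0 mulr_ge0// exprn_ge0// mulr_ge0// pi_ge0. Qed.

Let Q l x := kap l x * lam x ^+ 2 * G x.

Let iQ l : integ mu (Q l).
Proof.
have [r r0 hr] := kap_enorm l.
apply: (@integ_bound _ _ _ mu ((r `^ a) ^+ 2) (fun x => kap l x * lam x ^+ 2)) => //.
  by apply: measurable_funM => //; exact: measurable_funX.
move=> x; have /andP[k0 k1] := kap01 l x.
have [->|kx] := eqVneq (kap l x) 0; first by rewrite mul0r normr0 sqr_ge0.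
rewrite ger0_norm ?mulr_ge0 ?sqr_ge0// -[leRHS]mul1r ler_pM ?sqr_ge0//.
rewrite lerXn2r ?nnegrE ?powR_ge0// ge0_ler_powR ?nnegrE ?enorm_ge0//; last exact: hr.
by move: a1 => h; lra.
Qed.

Let deriv_sqr l tau x : dr l tau x ^+ 2 + di l tau x ^+ 2 = Q l x.
Proof.
transitivity (kap l x ^+ 2 * lam x ^+ 2 * (flowr tau x ^+ 2 + flowi tau x ^+ 2)).
  rewrite /dr /di; ring.
by rewrite kap2 flow_sqr.
Qed.

Let mX l : measurable_fun setT (X l).
Proof.
apply: measurable_funM => //.
apply: (@measurable_Rintegral _ _ _ _ R leb (fun z : Rn * R =>
  \1_(`[0, 2^-1 ^+ l]%classic : set R) z.2 * B l z.2 z.1 ^+ 2)).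
apply: measurable_funM.
  exact: (measurableT_comp (integ_meas (iI (2^-1 ^+ l))) measurable_snd).
apply: measurable_funX.
have msw : measurable_fun setT (fun z : Rn * R => (z.2, z.1)).
  by apply/measurable_fun_pairP; split; [exact: measurable_snd|exact: measurable_fst].
exact: (measurableT_comp (mB l) msw).
Qed.

Let X_ge0 l x : 0 <= X l x.
Proof.
rewrite mulr_ge0 ?exprn_ge0//; apply: Rintegral_ge0 => tau _.
by rewrite mulr_ge0 ?sqr_ge0// indicE.
Qed.

(** Tonelli exchanges x and tau. Plancherel bounds the integral of B^2 by K0 times that of [Q] at
    every time, because |e^(i tau lam)| = 1. The time interval contributes one factor 2^-l and the
    definition of [X] another, whence 4^-l. *)
Let X_le l : (\int[mu]_x (X l x)%:E <= (K0 * \int[mu]_x (4^-1 ^+ l * Q l x))%:E)%E.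
Proof.
set r : R := 2^-1 ^+ l.
have r0 : 0 < r by rewrite exprn_gt0.
have r4 : 4^-1 ^+ l = r * r.
  by rewrite /r -exprMn; congr (_ ^+ l); field.
pose J (tau : R) : R := \1_(`[0, r]%classic : set R) tau.
have J0 tau : 0 <= J tau by rewrite /J indicE.
have mJ : measurable_fun setT J by exact: (integ_meas (iI r)).
have mJB : measurable_fun setT (fun z : R * Rn => J z.1 * B l z.1 z.2 ^+ 2).
  apply: measurable_funM; first exact: (measurableT_comp mJ measurable_fst).
  by apply: measurable_funX; exact: mB.
have step : (\int[mu]_x \int[leb]_tau (J tau * B l tau x ^+ 2)%:E <=
    (r * (K0 * \int[mu]_x Q l x))%:E)%E.
  have <- := @fubini_tonelli _ _ _ _ R leb mu
    (fun z : R * Rn => (J z.1 * B l z.1 z.2 ^+ 2)%:E)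
    ltac:(exact/measurable_EFinP) ltac:(by move=> z; rewrite lee_fin mulr_ge0 ?sqr_ge0).
  apply: (@le_trans _ _ (\int[leb]_tau (J tau * (K0 * \int[mu]_x Q l x))%:E)%E); last first.
    rewrite -(@RintegralE _ _ _ leb); last first.
      by under eq_fun do rewrite mulrC; apply: integZ; exact: iI.
    rewrite lee_fin RintegralZr//; last exact: iI.
    rewrite le_eqVlt; apply/orP; left; apply/eqP; congr (_ * _).
    under eq_Rintegral do rewrite -[J _]mul1r.
    rewrite Rintegral_indicr Rintegral_cst//= lebesgue_measure_itv/= lte_fin r0.
    by rewrite -EFinB/= subr0 mul1r.
  have Q0 : 0 <= \int[mu]_x Q l x.
    apply: Rintegral_ge0 => x _; have /andP[k0 _] := kap01 l x.
    by rewrite !mulr_ge0 ?sqr_ge0.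
  apply: ge0_le_integral => //.
  - by move=> tau _; apply: integral_ge0 => x _; rewrite lee_fin mulr_ge0 ?sqr_ge0.
  - apply: (measurable_fun_fubini_tonelli_F (fun z : R * Rn => (J z.1 * B l z.1 z.2 ^+ 2)%:E)).
      exact/measurable_EFinP.
    by move=> z; rewrite lee_fin mulr_ge0 ?sqr_ge0.
  - by apply/measurable_EFinP; apply: measurable_funM.
  move=> tau _ /=; under eq_integral do rewrite EFinM.
  rewrite ge0_integralZl//; last 3 first.
  - apply/measurable_EFinP; apply: measurable_funX.
    exact: (measurableT_comp (mB l) (measurable_pair1 tau)).
  - by move=> x _; rewrite lee_fin sqr_ge0.
  - by rewrite lee_fin.
  rewrite EFinM lee_wpmul2l ?lee_fin//.
  have := plancherel_retr (idr l tau) (idi l tau).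
  under eq_fun do rewrite deriv_sqr.
  under eq_Rintegral do rewrite deriv_sqr.
  by apply; exact: iQ.
have -> : (\int[mu]_x (X l x)%:E = r%:E * \int[mu]_x \int[leb]_tau (J tau * B l tau x ^+ 2)%:E)%E.
  under eq_integral => x _ do
    rewrite /X EFinM (@RintegralE _ _ _ leb (fun tau => J tau * B l tau x ^+ 2) (iB2 l x r)).
  rewrite ge0_integralZl//; last 2 first.
  - apply: (@measurable_fun_fubini_tonelli_G _ _ _ _ R leb (fun z : R * Rn => (J z.1 * B l z.1 z.2 ^+ 2)%:E)).
      exact/measurable_EFinP.
    by move=> z; rewrite lee_fin mulr_ge0 ?sqr_ge0.
  - by move=> x _; apply: integral_ge0 => tau _; rewrite lee_fin mulr_ge0 ?sqr_ge0.
apply: (le_trans (lee_wpmul2l _ step)); first by rewrite lee_fin ltW.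
rewrite -EFinM lee_fin RintegralZl//; last exact: iQ.
by rewrite r4 le_eqVlt; apply/orP; left; apply/eqP; ring.
Qed.

Let enormW x : enorm x `^ (2 * s) <= W x.
Proof.
rewrite powRrM powR_mulrn ?enorm_ge0//.
rewrite ge0_ler_powR ?nnegrE ?sqr_ge0 ?addr_ge0 ?sqr_ge0//; first exact: ltW.
by rewrite lerDr.
Qed.

(** Since |xi|^a = rho |xi|^s, the dyadic sum absorbs the factor rho^2 of lam^2, and |xi|^(2s) <= W
    is left. *)
Let sum_Q_le N x : \sum_(l < N) 4^-1 ^+ l * Q l x <= 2 * (W x * G x).
Proof.
have -> : \sum_(l < N) 4^-1 ^+ l * Q l x =
    (\sum_(l < N) 4^-1 ^+ l * kap l x) * lam x ^+ 2 * G x.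
  by rewrite !mulr_suml; apply: eq_bigr => i _; rewrite /Q !mulrA.
rewrite mulrA ler_wpM2r//.
have W0 : 0 <= W x by rewrite (le_trans ler01 (W1 x)).
have [e0|e0] := eqVneq (enorm x) 0.
  have -> : lam x = 0 by rewrite /lam e0 powR0//; move: a1 => h; rewrite gt_eqF//; lra.
  by rewrite expr0n/= mulr0 mulr_ge0.
have {}e0 : 0 < enorm x by rewrite lt_neqAle eq_sym e0 enorm_ge0.
have rho0 : 0 < rho x by exact: powR_gt0.
have [_ h2] := sum_dyadic_cutoff N rho0.
have -> : lam x = rho x * enorm x `^ s.
  by rewrite /lam /rho -powRD ?subrK// (gt_eqF e0) implybT.
rewrite exprMn mulrA.
apply: ler_pM => //.
- rewrite mulr_ge0 ?sqr_ge0// sumr_ge0// => i _.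
  by rewrite mulr_ge0 ?exprn_ge0//; have /andP[] := kap01 i x.
- exact: sqr_ge0.
- by rewrite -powR_mulrn ?powR_ge0// -powRrM mulrC enormW.
Qed.

Let X_cvg0 : {ae mu, forall x, X l x @[l --> \oo] --> 0}.
Proof.
apply: (ae_series_cvg0 mX X_ge0 X_le (C := K0 * (2 * \int[mu]_x (W x * G x)))) => N.
rewrite -mulr_sumr ler_wpM2l//.
have iQ4 l : integ mu (fun x => 4^-1 ^+ l * Q l x) by apply: integZ; exact: iQ.
have [i1 <-] := integ_sum N iQ4.
rewrite -RintegralZl//; apply: le_Rintegral => //; first exact: integZ.
Qed.

Let gam := 2 * s / (a - s).

Let high_le l (t : R) x : 0 < t -> 2^-1 ^+ l.+1 < t ->
  ((flowr t x - g1 x) - lowr l t x) ^+ 2 + ((flowi t x - g2 x) - lowi l t x) ^+ 2 <=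
  4 * (2 * t) `^ gam * (W x * G x).
Proof.
move=> t0 tl.
have -> : ((flowr t x - g1 x) - lowr l t x) ^+ 2 + ((flowi t x - g2 x) - lowi l t x) ^+ 2 =
   (1 - kap l x) ^+ 2 * (((cos (t * lam x) - 1) ^+ 2 + sin (t * lam x) ^+ 2) * G x).
  rewrite /lowr /lowi /flowr /flowi /G; ring.
have WG0 : 0 <= W x * G x by rewrite mulr_ge0// (le_trans ler01 (W1 x)).
have gam0 : 0 <= gam.
  by rewrite /gam divr_ge0//; [rewrite mulr_ge0//; exact: ltW|exact: ltW].
rewrite /kap; case: (leP (rho x) (2 ^+ l)) => h; first by rewrite subrr expr0n mul0r !mulr_ge0 ?powR_ge0.
rewrite subr0 expr1n mul1r -!mulrA.
apply: le_trans (ler_wpM2r (G0 x) (cos_sub1_sin _)) _.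
rewrite ler_wpM2l// mulrA ler_peMl//.
have t20 : 0 <= 2 * t by rewrite mulr_ge0// ltW.
apply: le_trans (_ : (2 * t) `^ gam * rho x `^ gam <= _).
  rewrite -powRM ?powR_ge0//.
  have e : (1 : R) `^ gam = 1 by rewrite powR1.
  rewrite -[leLHS]e; apply: ge0_ler_powR => //; rewrite ?nnegrE//.
    by apply: mulr_ge0 => //; exact: powR_ge0.
  (* This is where t > 2^-(l+1) enters; together with rho > 2^l it yields 2 t rho >= 1. *)
  have h2 : 2^-1 ^+ l <= 2 * t.
    by move: tl; rewrite exprS => tl; move: (2^-1 ^+ l) tl => z tl; lra.
  apply: (@le_trans _ _ (2^-1 ^+ l * 2 ^+ l)).
    by rewrite -exprMn mulVf// expr1n.
  by rewrite ler_pM// ?exprn_ge0// ltW.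
rewrite ler_wpM2l ?powR_ge0//.
apply: le_trans (enormW x).
by rewrite /rho -powRrM /gam mulrC divfK ?gt_eqF.
Qed.

Variable t : nat -> R.
Hypotheses (t0_lt1 : t 0%N < 1) (t_decr : forall k, t k.+1 < t k)
  (t_gt0 : forall k, 0 < t k) (t_cvg0 : t @ \oo --> (0 : R))
  (t_sum : cvgn (series (fun k => t k `^ gam))).

Let t_lt1 k : t k < 1.
Proof. by elim: k => // k IH; exact: lt_trans (t_decr k) IH. Qed.

(** Take the least exponent with 2^-l < t_k. It is positive because t_k < 1, and its predecessor is
    the level. *)
Let t_level : exists lv : nat -> nat, forall k, 2^-1 ^+ (lv k).+1 < t k <= 2^-1 ^+ lv k.
Proof.
suff /boolp.choice[lv h] : forall k, exists l, 2^-1 ^+ l.+1 < t k <= 2^-1 ^+ l.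
  by exists lv.
move=> k.
have ex : exists l, 2^-1 ^+ l < t k.
  have h : (fun j : nat => (2^-1 : R) ^+ j) @ \oo --> (0 : R).
    by apply: cvg_expr; rewrite ger0_norm// invf_lt1// ltr1n.
  have /cvgrPdist_lt/(_ _ (t_gt0 k))[N _ hN] := h.
  exists N; have := hN N (leqnn N); rewrite /= sub0r normrN ger0_norm//.
case: (ex_minnP ex) => -[|m] hm hmin.
  by move: hm; rewrite expr0 => hm; have := lt_trans hm (t_lt1 k); rewrite ltxx.
exists m; rewrite hm/= leNgt; apply/negP => h.
by have := hmin _ h; rewrite ltnn.
Qed.

Let iflow tau : [/\ integ mu (fun x => (flowr tau x - g1 x) ^+ 2) &
  integ mu (fun x => (flowi tau x - g2 x) ^+ 2)].
Proof.
have h x : (flowr tau x - g1 x) ^+ 2 + (flowi tau x - g2 x) ^+ 2 <= 4 * G x.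
  have -> : (flowr tau x - g1 x) ^+ 2 + (flowi tau x - g2 x) ^+ 2 =
     ((cos (tau * lam x) - 1) ^+ 2 + sin (tau * lam x) ^+ 2) * G x.
    by rewrite /flowr /flowi /G; ring.
  by rewrite ler_wpM2r// cos_sub1_sin.
have i4 : integ mu (fun x => 4 * G x) by exact: integZ.
split; apply: integ_le i4 _.
- by apply: measurable_funX; exact: measurable_funB.
- move=> x; rewrite ger0_norm ?sqr_ge0//; apply: le_trans (h x); by rewrite lerDl sqr_ge0.
- by apply: measurable_funX; exact: measurable_funB.
- move=> x; rewrite ger0_norm ?sqr_ge0//; apply: le_trans (h x); by rewrite lerDr sqr_ge0.
Qed.

(** To be instantiated with (2 pi)^n times the real part, then the imaginary part, of S_{t_k} f - f.
    Only the Gaussian-tested relation links it to the frequency data. *)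
Variable v : nat -> Rn -> R.
Hypotheses (mv : forall k, measurable_fun setT (v k))
  (iv : forall k e m, rVpos e -> integ mu (fun x => v k x * gauss e m x))
  (vft : forall k, ftrel (v k) (fun x => flowr (t k) x - g1 x) (fun x => flowi (t k) x - g2 x)).

Lemma flow_ae_cvg0 : {ae mu, forall x, v k x @[k --> \oo] --> 0}.
Proof.
have [lv hlv] := t_level.
have lvP k : 2^-1 ^+ (lv k).+1 < t k by have /andP[] := hlv k.
have tlv k : 0 < t k <= 2^-1 ^+ lv k by rewrite t_gt0; have /andP[] := hlv k.
(* The high-frequency remainder. Its data [h1], [h2] are square integrable but not known to be
   integrable, hence the use of [L2_bound]. *)
pose w k x := v k x - low (lv k) (t k) x.
pose h1 k x := (flowr (t k) x - g1 x) - lowr (lv k) (t k) x.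
pose h2 k x := (flowi (t k) x - g2 x) - lowi (lv k) (t k) x.
have mlr k : measurable_fun setT (lowr (lv k) (t k)) := integ_meas (ilow (lv k) (t k)).1.
have mli k : measurable_fun setT (lowi (lv k) (t k)) := integ_meas (ilow (lv k) (t k)).2.
have mh1 k : measurable_fun setT (h1 k) by do 2 apply: measurable_funB => //.
have mh2 k : measurable_fun setT (h2 k) by do 2 apply: measurable_funB => //.
have mw k : measurable_fun setT (w k) by apply: measurable_funB => //; exact: measurable_retr.
have hle k x : h1 k x ^+ 2 + h2 k x ^+ 2 <= 4 * (2 * t k) `^ gam * (W x * G x).
  exact: high_le.
have iH k : integ mu (fun x => h1 k x ^+ 2 + h2 k x ^+ 2).
  apply: (@integ_le _ _ _ mu _ (fun x => 4 * (2 * t k) `^ gam * (W x * G x))).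
  - by apply: measurable_funD; exact: measurable_funX.
  - exact: integZ.
  - by move=> x; rewrite ger0_norm// addr_ge0 ?sqr_ge0.
have iw k e m : rVpos e -> integ mu (fun x => w k x * gauss e m x).
  move=> e0; under eq_fun do rewrite mulrBl.
  by apply: integB; [exact: iv|apply: integ_retr_gauss => //; have [] := ilow (lv k) (t k)].
have wft k : ftrel (w k) (h1 k) (h2 k).
  have [i1 i2] := ilow (lv k) (t k); have [j1 j2] := iflow (t k).
  apply: ftrelB; [exact: vft|exact: ftrel_retr|exact: iv|by move=> *; exact: integ_retr_gauss| | | |] => //.
  - by move=> e m e0; apply: integ_sqr_gauss => //; exact: measurable_funB.
  - by move=> e m e0; apply: integ_sqr_gauss => //; exact: measurable_funB.
  - by move=> e m e0; exact: integ_gaussM.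
  - by move=> e m e0; exact: integ_gaussM.
pose c k := K0 * \int[mu]_x (4 * (2 * t k) `^ gam * (W x * G x)).
have wc k : (\int[mu]_x (w k x ^+ 2)%:E <= (c k)%:E)%E.
  apply: (le_trans (L2_bound (mw k) (mh1 k) (mh2 k) (iH k) (iw k) (wft k))).
  rewrite lee_fin ler_wpM2l//; apply: (le_Rintegral measurableT (iH k)); [exact: integZ|by move=> x _; exact: hle].
pose M := K0 * (4 * 2 `^ gam * \int[mu]_x (W x * G x)).
have cE k : c k = M * t k `^ gam.
  rewrite /c RintegralZl// powRM//; last exact: ltW.
  rewrite /M; ring.
have WG0 : 0 <= \int[mu]_x (W x * G x).
  by apply: Rintegral_ge0 => x _; rewrite mulr_ge0// (le_trans ler01 (W1 x)).
have csum N : \sum_(k < N) c k <= M * lim (series (fun k => t k `^ gam) @ \oo).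
  under eq_bigr do rewrite cE.
  have b0 : 0 <= 4 * 2 `^ gam * \int[mu]_x (W x * G x).
    by rewrite mulr_ge0// mulr_ge0// powR_ge0.
  rewrite -mulr_sumr ler_wpM2l//; first exact: mulr_ge0 K0_ge0 b0.
  have := nondecreasing_cvgn_le (u_ := series (fun k => t k `^ gam)) _ t_sum N.
  rewrite /series/= big_mkord; apply.
  apply/nondecreasing_seqP => m; rewrite !big_mkord big_ord_recr/= lerDl powR_ge0//.
have w0 : {ae mu, forall x, w k x ^+ 2 @[k --> \oo] --> 0}.
  apply: (ae_series_cvg0 _ _ wc csum) => [k|k x]; last exact: sqr_ge0.
  exact: measurable_funX.
apply: filterS2 w0 X_cvg0 => x wx Xx.
have wx0 : w k x @[k --> \oo] --> 0.
  apply/cvgrPdist_lt => eps eps0; have e20 : 0 < eps ^+ 2 by rewrite exprn_gt0.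
  move/cvgrPdist_lt : wx => /(_ _ e20); apply: filterS => k.
  rewrite !sub0r !normrN normrX ltr_pXn2r// ?nnegrE// ltW//.
have lx0 : low (lv k) (t k) x @[k --> \oo] --> 0.
  apply/cvgrPdist_le => eps eps0; have e20 : 0 < eps ^+ 2 by rewrite exprn_gt0.
  (* Let X_l <= eps^2 for all l >= N. Once t_k < 2^-N, the level of t_k is at least N, so [low_le]
     applies whatever the number of k in the block. *)
  move/cvgrPdist_le : Xx => /(_ _ e20)[N _ hN].
  have p0 : 0 < (2^-1 : R) ^+ N by rewrite exprn_gt0.
  move/cvgrPdist_lt : t_cvg0 => /(_ _ p0); apply: filterS => k.
  rewrite !sub0r !normrN ger0_norm ?(ltW (t_gt0 k))// => tk.
  apply: low_le => //.
  have Nk : (N <= lv k)%N.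
    rewrite leqNgt; apply/negP => h.
    have := lt_trans (lvP k) tk; apply/negP; rewrite -leNgt.
    by rewrite ler_wiXn2l// invf_le1// ler1n.
  by have := hN _ Nk; rewrite /= sub0r normrN; apply: le_trans; rewrite ler_norm.
have -> : (fun k => v k x) = (fun k => w k x + low (lv k) (t k) x).
  by apply/funext => k; rewrite subrK.
by rewrite -[X in _ --> X](addr0 0); exact: cvgD.
Qed.

End flow.

(** * Gaussians as Schwartz functions *)

Section gaussian_functions.
Context {R : realType} {n : nat}.
Local Notation Rn := 'rV[R]_n.
Local Notation mu := (@lebesgue_rV R n).
Implicit Types (e m x y : Rn) (f g : Rn -> R) (i : 'I_n).

(* A class stable under partial derivatives and made of rapidly decreasing
   functions, which gives all Schwartz bounds without an explicit formula for the
   iterated derivatives. *)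
Inductive gaussian_fun e m y : (Rn -> R) -> Prop :=
| gaussian_cos : gaussian_fun e m y (fun x => gauss e m x * cos (rdot x y))
| gaussian_sin : gaussian_fun e m y (fun x => gauss e m x * sin (rdot x y))
| gaussianD f g : gaussian_fun e m y f -> gaussian_fun e m y g ->
    gaussian_fun e m y (fun x => f x + g x)
| gaussianZ c f : gaussian_fun e m y f -> gaussian_fun e m y (fun x => c * f x)
| gaussianX i f : gaussian_fun e m y f ->
    gaussian_fun e m y (fun x => x ord0 i * f x).

(** Reduces a directional derivative to the derivative at 0 of a function of one real variable, to
    which the one-variable rules apply. *)
Lemma is_derive_line f x v d :
  is_derive (0 : R) 1 (fun h : R => f (h *: v + x)) d -> is_derive x v f d.
Proof.
move=> -[ex dv].
have E : (fun h : R => h^-1 *: ((f \o shift x) (h *: v) - f x)) =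
    (fun h : R => h^-1 *: (((fun h : R => f (h *: v + x)) \o shift 0) (h *: 1)
       - (fun h : R => f (h *: v + x)) 0)).
  apply/funext => h; rewrite /= /shift/= addr0 scale0r add0r.
  by rewrite /GRing.scale/= mulr1.
split; first by rewrite /derivable E.
by rewrite /derive E.
Qed.

Let d_ i : Rn := delta_mx ord0 i.

Let line_coord i j h x : (h *: d_ i + x) ord0 j = h * (i == j)%:R + x ord0 j.
Proof. by rewrite !mxE eqxx /= eq_sym. Qed.

Let line_rdot i h x y : rdot (h *: d_ i + x) y = h * y ord0 i + rdot x y.
Proof.
rewrite /rdot (bigD1 i)//= [in RHS](bigD1 i)//= line_coord eqxx mulr1 mulrDl -addrA.
congr (_ + (_ + _)); apply: eq_bigr => j ji.
by rewrite line_coord eq_sym (negbTE ji) mulr0 add0r.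
Qed.

Let line_gauss i h e m x : gauss e m (h *: d_ i + x) =
  gauss1 (e ord0 i) (m ord0 i) (h + x ord0 i) *
  \prod_(j | j != i) gauss1 (e ord0 j) (m ord0 j) (x ord0 j).
Proof.
rewrite /gauss (bigD1 i)//= line_coord eqxx mulr1; congr (_ * _).
by apply: eq_bigr => j ji; rewrite line_coord eq_sym (negbTE ji) mulr0 add0r.
Qed.

Let gaussE i e m x : gauss e m x = gauss1 (e ord0 i) (m ord0 i) (x ord0 i) *
  \prod_(j | j != i) gauss1 (e ord0 j) (m ord0 j) (x ord0 j).
Proof. by rewrite /gauss (bigD1 i). Qed.

Lemma is_derive_gaussian_fun e m y f i : gaussian_fun e m y f ->
  exists2 g, gaussian_fun e m y g & forall x, is_derive x (d_ i) f (g x).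
Proof.
pose gc := fun x => gauss e m x * cos (rdot x y).
pose gs := fun x => gauss e m x * sin (rdot x y).
have kc : gaussian_fun e m y gc by exact: gaussian_cos.
have ks : gaussian_fun e m y gs by exact: gaussian_sin.
elim=> [||f1 f2 _ [g1 k1 d1] _ [g2 k2 d2]|c f1 _ [g1 k1 d1]|j f1 kf1 [g1 k1 d1]].
- exists (fun x => - e ord0 i * (x ord0 i * gc x) + ((e ord0 i * m ord0 i) * gc x + (- y ord0 i) * gs x)).
    apply: gaussianD; first by apply: gaussianZ; exact: gaussianX.
    by apply: gaussianD; exact: gaussianZ.
  move=> x; apply: is_derive_line.
  under eq_fun do rewrite line_gauss line_rdot.
  rewrite /gc /gs (gaussE i); set P := \prod_(_ | _) _.
  rewrite /gauss1.
  by apply: trigger_derive; rewrite /GRing.scale/= mul0r !add0r; field.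
- exists (fun x => - e ord0 i * (x ord0 i * gs x) + ((e ord0 i * m ord0 i) * gs x + y ord0 i * gc x)).
    apply: gaussianD; first by apply: gaussianZ; exact: gaussianX.
    by apply: gaussianD; exact: gaussianZ.
  move=> x; apply: is_derive_line.
  under eq_fun do rewrite line_gauss line_rdot.
  rewrite /gc /gs (gaussE i); set P := \prod_(_ | _) _.
  rewrite /gauss1.
  by apply: trigger_derive; rewrite /GRing.scale/= mul0r !add0r; field.
- by exists (fun x => g1 x + g2 x); [exact: gaussianD|move=> x; exact: is_deriveD].
- by exists (fun x => c * g1 x); [exact: gaussianZ|move=> x; exact: is_deriveZ].
- exists (fun x => x ord0 j * g1 x + (i == j)%:R * f1 x).
    by apply: gaussianD; [exact: gaussianX|exact: gaussianZ].
  move=> x.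
  have dx : is_derive x (d_ i) (fun z : Rn => z ord0 j) (i == j)%:R.
    apply: is_derive_line; under eq_fun do rewrite line_coord.
    by apply: trigger_derive; rewrite /GRing.scale/=; ring.
  have := @is_deriveM _ _ _ _ x (d_ i) _ _ dx (d1 x).
  by rewrite /GRing.scale/= (mulrC (f1 x)).
Qed.

Lemma continuous_sum_rV (F : 'I_n -> Rn -> R) :
  (forall i, continuous (F i)) -> continuous (fun x => \sum_i F i x).
Proof.
move=> cF; elim: (index_enum _) => [|i r IH].
  have -> : (fun x : Rn => \sum_(i <- [::]) F i x) = cst 0.
    by apply/funext => z; rewrite big_nil.
  exact: cst_continuous.
have -> : (fun x => \sum_(j <- i :: r) F j x) = (fun x => F i x + \sum_(j <- r) F j x).
  by apply/funext => z; rewrite big_cons.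
by move=> x; exact: (continuousD (cF i x) (IH x)).
Qed.

Lemma continuous_prod_rV (F : 'I_n -> Rn -> R) :
  (forall i, continuous (F i)) -> continuous (fun x => \prod_i F i x).
Proof.
move=> cF; elim: (index_enum _) => [|i r IH].
  have -> : (fun x : Rn => \prod_(i <- [::]) F i x) = cst 1.
    by apply/funext => z; rewrite big_nil.
  exact: cst_continuous.
have -> : (fun x => \prod_(j <- i :: r) F j x) = (fun x => F i x * \prod_(j <- r) F j x).
  by apply/funext => z; rewrite big_cons.
by move=> x; exact: (continuousM (cF i x) (IH x)).
Qed.

Lemma continuous_gaussian_fun e m y f : gaussian_fun e m y f -> continuous f.
Proof.
have cdot : continuous (fun x => rdot x y).
  apply: (@continuous_sum_rV (fun i x => x ord0 i * y ord0 i)) => i x.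
  have c0 : {for x, continuous (fun _ : Rn => y ord0 i)} by exact: cst_continuous.
  exact: (continuousM (@coord_continuous R 1 n ord0 i x) c0).
have cg : continuous (gauss e m).
  apply: (@continuous_prod_rV (fun i x => gauss1 (e ord0 i) (m ord0 i) (x ord0 i))) => i x.
  by apply: (continuous_comp (@coord_continuous R 1 n ord0 i x)); exact: continuous_gauss1.
elim=> [||f1 f2 _ c1 _ c2|c f1 _ c1|j f1 _ c1] x.
- exact: (continuousM (cg x) (continuous_comp (cdot x) (@continuous_cos R _))).
- exact: (continuousM (cg x) (continuous_comp (cdot x) (@continuous_sin R _))).
- exact: (continuousD (c1 x) (c2 x)).
- have c0 : {for x, continuous (fun _ : Rn => c)} by exact: cst_continuous.
  exact: (continuousM c0 (c1 x)).
- exact: (continuousM (@coord_continuous R 1 n ord0 j x) (c1 x)).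
Qed.

(** Gaussians factor over the coordinates; this bound replaces the radial weight by a product, which
    can be estimated one coordinate at a time. *)
Lemma enorm_le_prod x : 1 + enorm x <= \prod_i (1 + `|x ord0 i|).
Proof.
suff [P1 h] : 1 <= \prod_i (1 + `|x ord0 i|) /\
    \sum_i x ord0 i ^+ 2 <= (\prod_i (1 + `|x ord0 i|) - 1) ^+ 2.
  rewrite addrC -lerBrDr -(@ler_pXn2r _ 2) ?nnegrE ?enorm_ge0 ?subr_ge0//.
  by rewrite enorm_sqr.
elim/big_rec2 : _ => [|i S P _ [P1 h]]; first by rewrite subrr expr0n.
have := normr_ge0 (x ord0 i); rewrite -(real_normK (num_real (x ord0 i))).
move: `|x ord0 i| => z z0; split; first by nra.
have -> : (1 + z) * P - 1 = (P - 1) + z * P by ring.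
have : z ^+ 2 <= (z * P) ^+ 2 by rewrite lerXn2r ?nnegrE ?mulr_ge0// ?ler_peMr// (le_trans _ P1).
have : 0 <= (P - 1) * (z * P) by rewrite !mulr_ge0// ?subr_ge0// (le_trans _ P1).
rewrite sqrrD; lra.
Qed.

(** The induction treats all N at once: a coordinate factor x_j is bounded by 1 + |x|, at the price
    of raising N by one. *)
Lemma gaussian_fun_le e m y f (N : nat) : rVpos e -> gaussian_fun e m y f ->
  exists2 C : R, 0 <= C & forall x, (1 + enorm x) ^+ N * `|f x| <= C.
Proof.
move=> e0 kf; elim: kf N => [||f1 f2 _ IH1 _ IH2|c f1 _ IH|j f1 _ IH] N.
1,2: pose C i := s2val (gauss1_pow_le (m ord0 i) N (e0 i)).
1,2: have C0 i : 0 <= C i by rewrite /C; case: (gauss1_pow_le _ _ _).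
1,2: have hC i x : (1 + `|x ord0 i|) ^+ N * gauss1 (e ord0 i) (m ord0 i) (x ord0 i) <= C i
       by rewrite /C; case: (gauss1_pow_le _ _ _) => /=.
1,2: have bnd x : (1 + enorm x) ^+ N * gauss e m x <= \prod_i C i.
1,3: apply: (@le_trans _ _ ((\prod_i (1 + `|x ord0 i|)) ^+ N * gauss e m x)).
1,3: rewrite ler_wpM2r ?(ltW (gauss_gt0 e m x))// lerXn2r ?enorm_le_prod// nnegrE ?addr_ge0 ?enorm_ge0//.
1,2: by rewrite prodr_ge0// => i _; rewrite addr_ge0.
1,2: rewrite -prodrXl -big_split/=; apply: ler_prod => i _; rewrite hC andbT.
1,2: by rewrite mulr_ge0 ?exprn_ge0 ?addr_ge0// ltW// gauss1_gt0.
1,2: exists (\prod_i C i); first by rewrite prodr_ge0.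
1,2: move=> x; apply: le_trans (bnd x); rewrite ler_wpM2l ?exprn_ge0 ?addr_ge0 ?enorm_ge0//.
1,2: rewrite normrM (ger0_norm (ltW (gauss_gt0 e m x))) ler_piMr ?(ltW (gauss_gt0 e m x))//.
- exact: normr_cos_le1.
- exact: normr_sin_le1.
- have [C1 C10 h1] := IH1 N; have [C2 C20 h2] := IH2 N.
  exists (C1 + C2); first exact: addr_ge0.
  move=> x; apply: le_trans (lerD (h1 x) (h2 x)); rewrite -mulrDr ler_wpM2l ?ler_normD//.
  by rewrite exprn_ge0// addr_ge0 ?enorm_ge0.
- have [C C0 h] := IH N; exists (`|c| * C); first by rewrite mulr_ge0.
  by move=> x; rewrite normrM mulrCA ler_wpM2l.
- have [C C0 h] := IH N.+1; exists C => // x; apply: le_trans (h x).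
  rewrite normrM mulrA ler_wpM2r// exprSr ler_wpM2l ?exprn_ge0 ?addr_ge0 ?enorm_ge0//.
  apply: (@le_trans _ _ (enorm x)); last by rewrite lerDr.
  rewrite -(@ler_pXn2r _ 2) ?nnegrE ?enorm_ge0// real_normK ?num_real// enorm_sqr.
  by rewrite (bigD1 j)//= lerDl sumr_ge0// => i _; rewrite sqr_ge0.
Qed.

Lemma partials_gaussian_fun e m y f g (beta : seq 'I_n) :
  gaussian_fun e m y f -> gaussian_fun e m y g ->
  exists f' g', [/\ gaussian_fun e m y f', gaussian_fun e m y g' &
    partials beta (fun x => Complex (f x) (g x)) = fun x => Complex (f' x) (g' x)].
Proof.
move=> kf kg; elim: beta => [|i b [f' [g' [kf' kg' E]]]]; first by exists f, g.
have [f'' kf'' df] := is_derive_gaussian_fun i kf'.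
have [g'' kg'' dg] := is_derive_gaussian_fun i kg'.
exists f'', g''; split=> //; rewrite /= E; apply/funext => x; rewrite /partial/=.
by congr Complex; [have := df x|have := dg x] => -[].
Qed.

Lemma normc_le (u v : R) : ComplexField.Normc.normc (Complex u v) <= `|u| + `|v|.
Proof.
rewrite /= -(@ler_pXn2r _ 2) ?nnegrE ?sqrtr_ge0 ?addr_ge0// sqr_sqrtr ?addr_ge0 ?sqr_ge0//.
rewrite sqrrD !real_normK ?num_real//.
by have := mulr_ge0 (normr_ge0 u) (normr_ge0 v); lra.
Qed.

Lemma schwartz_gaussian_fun e m y f g : rVpos e ->
  gaussian_fun e m y f -> gaussian_fun e m y g ->
  schwartz (fun x => Complex (f x) (g x)).
Proof.
move=> e0 kf kg; split=> [beta|N].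
  have [f' [g' [kf' kg' ->]]] := partials_gaussian_fun beta kf kg; split.
  - exact: continuous_gaussian_fun kf'.
  - exact: continuous_gaussian_fun kg'.
  - move=> i x; have [f'' _ df] := is_derive_gaussian_fun i kf'.
    have [g'' _ dg] := is_derive_gaussian_fun i kg'.
    by split; [have [] := df x|have [] := dg x].
have /boolp.choice[M hM] : forall beta : seq 'I_n, exists M : R, 0 <= M /\ forall x,
    (1 + enorm x) ^+ N * ComplexField.Normc.normc (partials beta (fun x => Complex (f x) (g x)) x) <= M.
  move=> beta; have [f' [g' [kf' kg' ->]]] := partials_gaussian_fun beta kf kg.
  have [C C0 hC] := gaussian_fun_le N e0 kf'; have [D D0 hD] := gaussian_fun_le N e0 kg'.
  exists (C + D); split; first exact: addr_ge0.
  move=> x; apply: le_trans (lerD (hC x) (hD x)); rewrite -mulrDr ler_wpM2l ?normc_le//.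
  by rewrite exprn_ge0// addr_ge0 ?enorm_ge0.
have M0 b : 0 <= M b by have [] := hM b.
(* There are finitely many words of length at most N, and the sum of their nonnegative bounds
   dominates each of them. *)
apply: (@le_lt_trans _ _ (\sum_(k < N.+1) \sum_(b : k.-tuple 'I_n) M (tval b))%:E); last exact: ltry.
apply: ge_ereal_sup => _ [b [x [bN ->]]]; rewrite lee_fin.
apply: le_trans (proj2 (hM b) x) _.
have bN' : (size b < N.+1)%N by [].
rewrite (bigD1 (Ordinal bN'))//= (bigD1 (in_tuple b))//= -addrA lerDl addr_ge0 ?sumr_ge0// => k _.
by rewrite sumr_ge0.
Qed.

End gaussian_functions.

(** * Distributional Fourier transforms tested on Gaussians *)

Section represents_gauss.
Context {R : realType} {n : nat}.
Local Notation Rn := 'rV[R]_n.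
Local Notation mu := (@lebesgue_rV R n).
Local Notation Re := complex.Re.
Local Notation Im := complex.Im.
Local Notation normc := ComplexField.Normc.normc.
Implicit Types (e m x y : Rn) (f g h u : Rn -> R[i]).

(** The Fourier transform exchanges translation by [m] and modulation by [y] and produces a mass,
    which [c] takes up; one family thus contains the test functions and the transforms computed
    below. *)
Definition mgauss (c : R) e m y x : R[i] :=
  Complex (c * (gauss e m x * cos (rdot x y))) (c * (gauss e m x * sin (rdot x y))).

Lemma schwartz_mgauss c e m y : rVpos e -> schwartz (mgauss c e m y).
Proof.
move=> e0; apply: (schwartz_gaussian_fun e0); apply: gaussianZ.
  exact: gaussian_cos.
exact: gaussian_sin.
Qed.


Let rdot0r x : rdot x 0 = 0. Proof. by rewrite rdotC rdot0l. Qed.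

Let ReM (z w : R[i]) : Re (z * w) = Re z * Re w - Im z * Im w.
Proof. by case: z => a b; case: w. Qed.

Let ImM (z w : R[i]) : Im (z * w) = Re z * Im w + Im z * Re w.
Proof. by case: z => a b; case: w. Qed.

Lemma fourier_gauss e m : rVpos e ->
  fourier (mgauss 1 e m 0) = mgauss (gauss_mass e) (rVinv e) 0 (- m).
Proof.
move=> e0; apply/funext => xi; have [h1 h2] := gauss_transform m xi e0.
rewrite /fourier /cintegral /mgauss; congr Complex.
  transitivity (\int[mu]_x (cos (rdot xi x) * gauss e m x)).
    apply: eq_Rintegral => x _.
    rewrite ReM/= rdot0r cos0 sin0 cosN sinN; ring.
  by rewrite h1 (rdotC xi (- m)) rdotNl cosN (rdotC m) mulrA.
transitivity (\int[mu]_x (- 1 * (sin (rdot xi x) * gauss e m x))).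
  apply: eq_Rintegral => x _.
  rewrite ImM/= rdot0r cos0 sin0 cosN sinN; ring.
rewrite RintegralZl//; last exact: integ_sin_gauss.
rewrite h2 (rdotC xi (- m)) rdotNl sinN (rdotC m); ring.
Qed.

Lemma fourier_cgauss e y : rVpos e ->
  fourier (mgauss 1 e 0 y) = mgauss (gauss_mass e) (rVinv e) y 0.
Proof.
move=> e0; apply/funext => xi; have [h1 h2] := gauss_transform 0 (xi - y) e0.
rewrite /fourier /cintegral /mgauss rdot0r cos0 sin0; congr Complex.
  transitivity (\int[mu]_x (cos (rdot (xi - y) x) * gauss e 0 x)).
    apply: eq_Rintegral => x _.
    rewrite ReM/= rdotBl cosB cosN sinN (rdotC y); ring.
  by rewrite h1 rdot0r cos0 mulr1 mulr1 -gauss_sub.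
transitivity (\int[mu]_x (- 1 * (sin (rdot (xi - y) x) * gauss e 0 x))).
  apply: eq_Rintegral => x _.
  rewrite ImM/= rdotBl sinB cosN sinN (rdotC y); ring.
rewrite RintegralZl//; last exact: integ_sin_gauss.
by rewrite h2 rdot0r sin0 !mulr0.
Qed.

Lemma normc_sqr (z : R[i]) : normc z ^+ 2 = Re z ^+ 2 + Im z ^+ 2.
Proof. by case: z => a b; rewrite /= sqr_sqrtr// addr_ge0 ?sqr_ge0. Qed.

Lemma L2_integ_gauss f : L2 f -> forall e m, rVpos e ->
  integ mu (fun x => Re (f x) * gauss e m x) /\ integ mu (fun x => Im (f x) * gauss e m x).
Proof.
move=> [[m1 m2] fi] e m e0.
have i2 : integ mu (fun x => Re (f x) ^+ 2 + Im (f x) ^+ 2).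
  apply: integ_lty.
  - by apply: measurable_funD; exact: measurable_funX.
  - by move=> x; rewrite addr_ge0 ?sqr_ge0.
  - by under eq_integral do rewrite -normc_sqr.
split; apply: integ_sqr_gauss => //; apply: (integ_le _ i2).
- exact: measurable_funX.
- by move=> x; rewrite ger0_norm ?sqr_ge0// lerDl sqr_ge0.
- exact: measurable_funX.
- by move=> x; rewrite ger0_norm ?sqr_ge0// lerDr sqr_ge0.
Qed.

Let mulgaussE (z : R[i]) c e m x :
  Re (z * mgauss c e m 0 x) = c * (Re z * gauss e m x) /\
  Im (z * mgauss c e m 0 x) = c * (Im z * gauss e m x).
Proof.
by rewrite ReM ImM /= rdot0r cos0 sin0; split; ring.
Qed.

Lemma represents_integ_gauss g T : represents g T -> forall e m, rVpos e ->
  integ mu (fun x => Re (g x) * gauss e m x) /\ integ mu (fun x => Im (g x) * gauss e m x).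
Proof.
move=> [_ hg] e m e0; have [[i1 i2] _] := hg _ (schwartz_mgauss 1 m 0 e0).
split; [move: i1|move: i2]; under eq_fun => x do
  rewrite ?(proj1 (mulgaussE (g x) 1 e m x)) ?(proj2 (mulgaussE (g x) 1 e m x)) mul1r; by [].
Qed.

Lemma dist_gauss g T e m : represents g T -> rVpos e ->
  dist g (mgauss 1 e m 0) =
  Complex (\int[mu]_x (Re (g x) * gauss e m x)) (\int[mu]_x (Im (g x) * gauss e m x)).
Proof.
move=> hg e0; rewrite /dist /cintegral; congr Complex; apply: eq_Rintegral => x _.
  by rewrite (proj1 (mulgaussE (g x) 1 e m x)) mul1r.
by rewrite (proj2 (mulgaussE (g x) 1 e m x)) mul1r.
Qed.

(** The test function is a modulated Gaussian whose Fourier transform is a Gaussian centred at [m]: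
    duality then becomes an averaged inversion formula near [m], with (2 pi)^n from
    [gauss_mass_inv]. The second relation is the first one for -i f, since Im f = Re(-i f) and -i g
    = Im g - i Re g. *)
Lemma ftrel_represents f g : L2 f -> represents g (fourier_dist (dist f)) ->
  ftrel (fun x => (2 * pi) ^+ n * Re (f x)) (fun x => Re (g x)) (fun x => Im (g x)) /\
  ftrel (fun x => (2 * pi) ^+ n * Im (f x)) (fun x => Im (g x)) (fun x => - Re (g x)).
Proof.
move=> Lf [_ hg].
have key e m : rVpos e ->
    gauss_mass (rVinv e) * \int[mu]_x (Re (f x) * gauss e m x) =
      \int[mu]_xi ((cos (rdot xi m) * Re (g xi) - sin (rdot xi m) * Im (g xi)) * gauss (rVinv e) 0 xi) /\
    gauss_mass (rVinv e) * \int[mu]_x (Im (f x) * gauss e m x) =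
      \int[mu]_xi ((cos (rdot xi m) * Im (g xi) - sin (rdot xi m) * - Re (g xi)) * gauss (rVinv e) 0 xi).
  move=> e0; have e0' := rVinv_pos e0.
  have [_] := hg _ (schwartz_mgauss 1 0 m e0').
  rewrite /fourier_dist fourier_cgauss// rVinvK /dist /cintegral => -[E1 E2].
  have [i1 i2] := L2_integ_gauss Lf m e0.
  split; rewrite -RintegralZl//.
    transitivity (\int[mu]_x Re (f x * mgauss (gauss_mass (rVinv e)) e m 0 x)).
      by apply: eq_Rintegral => x _; rewrite (proj1 (mulgaussE _ _ _ _ _)).
    rewrite E1; apply: eq_Rintegral => x _; rewrite ReM/=; ring.
  transitivity (\int[mu]_x Im (f x * mgauss (gauss_mass (rVinv e)) e m 0 x)).
    by apply: eq_Rintegral => x _; rewrite (proj2 (mulgaussE _ _ _ _ _)).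
  rewrite E2; apply: eq_Rintegral => x _; rewrite ImM/=; ring.
split=> e m e0; have [k1 k2] := key e m e0; have [i1 i2] := L2_integ_gauss Lf m e0.
  under eq_Rintegral do rewrite -mulrA.
  by rewrite (RintegralZl _ measurableT i1) -(gauss_mass_inv e0) -mulrA k1.
under eq_Rintegral do rewrite -mulrA.
by rewrite (RintegralZl _ measurableT i2) -(gauss_mass_inv e0) -mulrA k2.
Qed.

(** Reconciles a transform obtained from [T] with one obtained from [dist f]. Both distributions
    agree on the Fourier transforms of Gaussians, which are again Schwartz, so [g] and [h] have the
    same Gaussian integrals. *)
Lemma represents_fourier_unique f T g h : represents f T ->
  represents g (fourier_dist T) -> represents h (fourier_dist (dist f)) ->
  {ae mu, forall x, g x = h x}.
Proof.
move=> [mf hf] hg hh.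
have E e m : rVpos e -> dist g (mgauss 1 e m 0) = dist h (mgauss 1 e m 0).
  move=> e0; have s0 := schwartz_mgauss 1 m 0 e0.
  have [_ <-] := hg.2 _ s0; have [_ <-] := hh.2 _ s0.
  rewrite /fourier_dist fourier_gauss//.
  by have [_ ->] := hf _ (schwartz_mgauss (gauss_mass e) 0 (- m) (rVinv_pos e0)).
have ig := represents_integ_gauss hg; have ih := represents_integ_gauss hh.
have [[mg1 mg2] _] := hg; have [[mh1 mh2] _] := hh.
have E' e m : rVpos e -> \int[mu]_x (Re (g x) * gauss e m x) = \int[mu]_x (Re (h x) * gauss e m x) /\
    \int[mu]_x (Im (g x) * gauss e m x) = \int[mu]_x (Im (h x) * gauss e m x).
  by move=> e0; have := E e m e0; rewrite (dist_gauss _ hg)// (dist_gauss _ hh)// => -[].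
have h1 : {ae mu, forall x, Re (g x) - Re (h x) = 0}.
  apply: gauss_orthogonal_ae0.
  - move=> e m e0; under eq_fun do rewrite mulrBl.
    by apply: integB; [have [] := ig e m e0|have [] := ih e m e0].
  - move=> e m e0; under eq_Rintegral do rewrite mulrBl.
    rewrite (RintegralB measurableT (ig e m e0).1 (ih e m e0).1).
    by rewrite (E' e m e0).1 subrr.
have h2 : {ae mu, forall x, Im (g x) - Im (h x) = 0}.
  apply: gauss_orthogonal_ae0.
  - move=> e m e0; under eq_fun do rewrite mulrBl.
    by apply: integB; [have [] := ig e m e0|have [] := ih e m e0].
  - move=> e m e0; under eq_Rintegral do rewrite mulrBl.
    rewrite (RintegralB measurableT (ig e m e0).2 (ih e m e0).2).
    by rewrite (E' e m e0).2 subrr.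
apply: filterS2 h1 h2 => x /subr0_eq r /subr0_eq i.
by case: (g x) (h x) r i => a b [c d] /= -> ->.
Qed.

Lemma measurable_flow (a tau : R) (h1 h2 : Rn -> R) :
  measurable_fun setT h1 -> measurable_fun setT h2 ->
  measurable_fun setT (flowr a h1 h2 tau) /\ measurable_fun setT (flowi a h1 h2 tau).
Proof.
move=> m1 m2.
have ml : measurable_fun setT (fun x : Rn => tau * enorm x `^ a).
  by apply: measurable_funM => //; apply: (measurableT_comp (measurable_powR a)); exact: measurable_enorm.
have mc := measurableT_comp measurable_cos ml; have ms := measurableT_comp measurable_sin ml.
by split; [apply: measurable_funB|apply: measurable_funD]; exact: measurable_funM.
Qed.

Lemma ftrel_ae (v h1 h2 h1' h2' : Rn -> R) :
  measurable_fun setT h1 -> measurable_fun setT h2 ->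
  measurable_fun setT h1' -> measurable_fun setT h2' ->
  {ae mu, forall x, h1 x = h1' x /\ h2 x = h2' x} ->
  ftrel v h1 h2 -> ftrel v h1' h2'.
Proof.
move=> m1 m2 m1' m2' eqh vh e m e0; rewrite vh//; congr (_ * _).
have mK (k1 k2 : Rn -> R) : measurable_fun setT k1 -> measurable_fun setT k2 ->
    measurable_fun setT (fun xi => ((cos (rdot xi m) * k1 xi - sin (rdot xi m) * k2 xi) *
      gauss (rVinv e) 0 xi)%:E).
  move=> mk1 mk2; apply/measurable_EFinP; apply: measurable_funM; last exact: measurable_gauss.
  by apply: measurable_funB; apply: measurable_funM => //;
    [exact: measurable_cos_rdot|exact: measurable_sin_rdot].
congr fine; apply: ae_eq_integral => //; [exact: mK|exact: mK|].
by apply: filterS eqh => x [-> ->] _.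
Qed.

End represents_gauss.

(** * Back to complex-valued functions and the theorem *)

Lemma complex_cvg (R : realType) (u : nat -> R[i]) (l : R[i]) :
  (fun k => complex.Re (u k)) @ \oo --> complex.Re l ->
  (fun k => complex.Im (u k)) @ \oo --> complex.Im l ->
  (u : nat -> R[i]^o) @ \oo --> (l : R[i]^o).
Proof.
(* In the order of [R[i]] a positive tolerance has imaginary part 0, so it amounts to a positive
   real [r], shared equally by the two parts. *)
move=> hr hi; apply/cvgrPdist_lt => -[r j]; rewrite ltcE/= => /andP[/eqP j0 r0].
have r20 : 0 < r / 2 by rewrite divr_gt0.
move/cvgrPdist_lt : hr => /(_ _ r20) hr; move/cvgrPdist_lt : hi => /(_ _ r20).
apply: filterS2 hr => k h1 h2.
case: (u k) h1 h2 => a b; case: l => c d /= h1 h2.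
rewrite normc_def/= ltcE/= j0 eqxx/=.
apply: le_lt_trans (normc_le _ _) _; lra.
Qed.

Theorem corollary1 (R : realType) (n : nat) (hn : (1 <= n)%N) (a s : R)
  (ha : 1 < a) (hs0 : 0 < s) (hs : s <= 1 / 2)
  (t : nat -> R) (ht1 : t 0%N < 1) (htdec : forall k, t k.+1 < t k)
  (htpos : forall k, 0 < t k) (htlim : t @ \oo --> (0 : R))
  (htsum : cvgn (series (fun k => t k `^ (2 * s / (a - s)))))
  (T : ('rV[R]_n -> R[i]) -> R[i]) (f : 'rV[R]_n -> R[i])
  (hT : Hs s T) (hf : represents f T)
  (u : nat -> 'rV[R]_n -> R[i])
  (hu : forall k, is_schrodinger a (t k) f (u k)) :
  {ae lebesgue_rV n, forall x,
    (fun k => u k x : R[i]^o) @ \oo --> (f x : R[i]^o)}.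
Proof.
have [_ [g hg gs]] := hT.
pose g1 x := complex.Re (g x); pose g2 x := complex.Im (g x).
have [[mg1 mg2] _] := hg.
have Lf : L2 f by have [] := hu 0%N.
have Lu k : L2 (u k) by have [] := hu k.
have iWG : integ (lebesgue_rV n) (fun x => (1 + enorm x ^+ 2) `^ s * (g1 x ^+ 2 + g2 x ^+ 2)).
  apply: integ_lty.
  - apply: measurable_funM; last by apply: measurable_funD; exact: measurable_funX.
    apply: (measurableT_comp (measurable_powR s)); apply: measurable_funD => //.
    by apply: measurable_funX; exact: measurable_enorm.
  - by move=> x; rewrite mulr_ge0 ?powR_ge0// addr_ge0 ?sqr_ge0.
  have h2 : (2^-1 : R) != 0 by rewrite invr_neq0.
  move: gs; rewrite /Hs_norm => /(lty_poweRy h2).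
  apply: le_lt_trans; rewrite le_eqVlt; apply/orP; left; apply/eqP/eq_integral => x _.
  by rewrite normc_sqr.
(* The data (g2, -g1) of -i g have the same weighted norm as (g1, g2); they govern the imaginary
   part of f. *)
have iWG' : integ (lebesgue_rV n) (fun x => (1 + enorm x ^+ 2) `^ s * (g2 x ^+ 2 + (- g1 x) ^+ 2)).
  by under eq_fun => x do rewrite sqrrN (addrC (g2 x ^+ 2)).
have mg1' : measurable_fun setT (fun x => - g1 x) by exact: measurableT_comp.
(* [retr] carries no inversion constant, so (2 pi)^n multiplies the functions instead; [unscale]
   removes it at the end. *)
pose c : R := (2 * pi) ^+ n.
have c0 : 0 < c by rewrite exprn_gt0// mulr_gt0// pi_gt0.
pose v k x := c * complex.Re (u k x) - c * complex.Re (f x).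
pose w k x := c * complex.Im (u k x) - c * complex.Im (f x).
have [[mf1 mf2] _] := Lf.
have mv k : measurable_fun setT (v k).
  by have [[mu1 mu2] _] := Lu k; apply: measurable_funB; exact: measurable_funM.
have mw k : measurable_fun setT (w k).
  by have [[mu1 mu2] _] := Lu k; apply: measurable_funB; exact: measurable_funM.
have ic (h : 'rV[R]_n -> R[i]) e m : L2 h -> rVpos e ->
    integ (lebesgue_rV n) (fun x => c * complex.Re (h x) * gauss e m x) /\
    integ (lebesgue_rV n) (fun x => c * complex.Im (h x) * gauss e m x).
  move=> Lh e0; have [i1 i2] := L2_integ_gauss Lh m e0.
  by split; under eq_fun do rewrite -mulrA; exact: integZ.
have iv k e m : rVpos e -> integ (lebesgue_rV n) (fun x => v k x * gauss e m x).
  move=> e0; under eq_fun do rewrite mulrBl.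
  by apply: integB; [exact: (ic _ _ _ _ e0).1|exact: (ic _ _ _ _ e0).1].
have iw k e m : rVpos e -> integ (lebesgue_rV n) (fun x => w k x * gauss e m x).
  move=> e0; under eq_fun do rewrite mulrBl.
  by apply: integB; [exact: (ic _ _ _ _ e0).2|exact: (ic _ _ _ _ e0).2].
have rel k : ftrel (v k) (fun x => flowr a g1 g2 (t k) x - g1 x) (fun x => flowi a g1 g2 (t k) x - g2 x) /\
   ftrel (w k) (fun x => flowr a g2 (fun x => - g1 x) (t k) x - g2 x)
     (fun x => flowi a g2 (fun x => - g1 x) (t k) x - - g1 x).
  (* Each k comes with its own transform [gk] of f. It has to be identified almost everywhere with
     the [g] of finite H_s norm, after which [ftrel_ae] rewrites the relations in terms of [g]. *)
  have [_ _ [gk hgk huk]] := hu k.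
  have [r1 r2] := ftrel_represents (Lu k) huk.
  have [r3 r4] := ftrel_represents Lf hgk.
  have ae_g := represents_fourier_unique hf hg hgk.
  have iu := represents_integ_gauss huk; have igk := represents_integ_gauss hgk.
  have [[mk1 mk2] _] := hgk; have [[mh1 mh2] _] := huk.
  have iuN e m : rVpos e -> integ (lebesgue_rV n) (fun x =>
      - complex.Re (expi (t k * enorm x `^ a) * gk x) * gauss e m x).
    move=> e0; under eq_fun do rewrite mulNr -mulN1r.
    by apply: integZ; have [] := iu e m e0.
  have ikN e m : rVpos e -> integ (lebesgue_rV n) (fun x => - complex.Re (gk x) * gauss e m x).
    move=> e0; under eq_fun do rewrite mulNr -mulN1r.
    by apply: integZ; have [] := igk e m e0.
  have D1 := ftrelB r1 r3 (fun e m e0 => (ic _ e m (Lu k) e0).1) (fun e m e0 => (ic _ e m Lf e0).1)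
    (fun e m e0 => (iu e m e0).1) (fun e m e0 => (iu e m e0).2)
    (fun e m e0 => (igk e m e0).1) (fun e m e0 => (igk e m e0).2).
  have D2 := ftrelB r2 r4 (fun e m e0 => (ic _ e m (Lu k) e0).2) (fun e m e0 => (ic _ e m Lf e0).2)
    (fun e m e0 => (iu e m e0).2) iuN (fun e m e0 => (igk e m e0).2) ikN.
  have mflow h1 h2 : measurable_fun setT h1 -> measurable_fun setT h2 ->
      measurable_fun setT (@flowr R n a h1 h2 (t k)) /\ measurable_fun setT (@flowi R n a h1 h2 (t k)).
    exact: measurable_flow.
  have [m1 m2] := mflow _ _ mg1 mg2; have [m3 m4] := mflow _ _ mg2 mg1'.
  split.
  - apply: ftrel_ae D1; [exact: measurable_funB|exact: measurable_funB|exact: measurable_funB|exact: measurable_funB|].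
    apply: filterS ae_g => x; rewrite /flowr /flowi /g1 /g2 => ->.
    by case: (gk x) => p q /=; split; ring.
  - apply: ftrel_ae D2; [exact: measurable_funB| |exact: measurable_funB|exact: measurable_funB|].
      by apply: measurable_funB; exact: measurableT_comp.
    apply: filterS ae_g => x; rewrite /flowr /flowi /g1 /g2 => ->.
    by case: (gk x) => p q /=; split; ring.
have V := flow_ae_cvg0 ha hs0 hs mg1 mg2 iWG ht1 htdec htpos htlim htsum mv iv (fun k => (rel k).1).
have W := flow_ae_cvg0 ha hs0 hs mg2 mg1' iWG' ht1 htdec htpos htlim htsum mw iw (fun k => (rel k).2).
have unscale (p : nat -> R) l : c * p k - c * l @[k --> \oo] --> 0 -> p @ \oo --> l.
  move=> h; have -> : p = (fun k => c^-1 * (c * p k - c * l) + l).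
    by apply/funext => k; field; rewrite gt_eqF.
  rewrite -[X in _ --> X]add0r -[X in X + l](mulr0 c^-1).
  by apply: cvgD; [apply: cvgM => //; exact: cvg_cst|exact: cvg_cst].
by apply: filterS2 V W => x vx wx; apply: complex_cvg; exact: unscale.
Qed.
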